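(* Let $m\in\mathbf Z$ and $\theta,\theta',\theta_2,\theta_2'\in[0,\pi]$. Put $\theta_<:=\min\{\theta,\theta'\}$, $\theta_>:=\max\{\theta,\theta'\}$. Then the azimuthal Fourier coefficient $\mathsf G_m^{1/2}$ of a fundamental solution of Laplace's equation on $\mathbf S_R^3$ is given by $$\mathsf G_m^{1/2}(\theta,\theta',\theta_2,\theta_2')=\frac{\pi\epsilon_m}{2\sqrt{\sin\theta\sin\theta'}}\sum_{l=|m|}^\infty(-1)^l(2l+1)\frac{(l-m)!}{(l+m)!}\,\mathsf P_l^m(\cos\theta_2)\,\mathsf P_l^m(\cos\theta_2')\,\mathsf P_{1/2}^{-(1/2+l)}(\cos\theta_<)\,\mathsf P_{1/2}^{1/2+l}(\cos\theta_>).$$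
   Context: Points of $\mathbf S_R^3=\{\mathbf x\in\mathbf R^4:\|\mathbf x\|=R\}$, $R>0$, are parametrized by standard hyperspherical coordinates $x_0=R\cos\theta$, $x_1=R\sin\theta\cos\theta_2$, $x_2=R\sin\theta\sin\theta_2\cos\phi$, $x_3=R\sin\theta\sin\theta_2\sin\phi$, with $\theta,\theta_2\in[0,\pi]$, $\phi\in[-\pi,\pi)$; primed coordinates are those of $\mathbf x'$. A fundamental solution for $-\Delta$ ($\Delta$ the Laplace--Beltrami operator on $\mathbf S_R^3$), defined for $\mathbf x\ne\mathbf x'$, is $\mathcal G_R^3(\mathbf x,\mathbf x')=\frac{1}{4\pi R}\mathfrak g^3$, where $\mathfrak g^3:=\cot\Theta$ (the $3$ is an index, not a power) and $\Theta$ is the geodesic distance between $\mathbf x/R$ and $\mathbf x'/R$ on the unit sphere, so that $\cos\Theta=A+B\cos(\phi-\phi')$ with $$A=\cos\theta\cos\theta'+\sin\theta\sin\theta'\cos\theta_2\cos\theta_2',\qquad B=\sin\theta\sin\theta'\sin\theta_2\sin\theta_2'.$$ The azimuthal Fourier coefficients $\mathsf G_m^{1/2}:[0,\pi]^4\to\mathbf R$ are those in the expansion $\mathfrak g^3=\sum_{m=0}^\infty\mathsf G_m^{1/2}(\theta,\theta',\theta_2,\theta_2')\cos(m(\phi-\phi'))$, that is, $$\mathsf G_m^{1/2}(\theta,\theta',\theta_2,\theta_2')=\frac{\epsilon_m}{\pi}\int_0^\pi\frac{(A+B\cos\psi)\cos(m\psi)}{\sqrt{1-(A+B\cos\psi)^2}}\,d\psi,$$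 where $\epsilon_m:=2-\delta_{m,0}$ is the Neumann factor ($\epsilon_0=1$ and $\epsilon_m=2$ for $m\ne0$). $\mathsf P_\nu^\mu:(-1,1)\to\mathbf C$ is the Ferrers function of the first kind, $\mathsf P_\nu^\mu(x)=\big(\tfrac{1+x}{1-x}\big)^{\mu/2}{}_2\mathbf F_1\big(\nu+1,-\nu;1-\mu;\tfrac{1-x}{2}\big)$, where ${}_2\mathbf F_1(a,b;c;z)={}_2F_1(a,b;c;z)/\Gamma(c)$ is the regularized Gauss hypergeometric function (entire in $c$).
   Formalization: Proved for θ,θ' in (0,π) with θ+θ' ≤ π (beyond this the series diverges), where x, x' neither coincide nor are antipodal for any φ−φ', and excluding m=0 with θ_2,θ_2' both in {0,π} and θ=θ' or θ+θ'=π (no convergence). *)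

(* Defs.v *)
From HB Require Import structures.
From mathcomp Require Export all_boot all_order all_algebra.
From mathcomp Require Export all_classical all_reals all_analysis.
Export Order.TTheory GRing.Theory Num.Theory.
Export numFieldNormedType.Exports.

Set Implicit Arguments.
Unset Strict Implicit.
Unset Printing Implicit Defensive.

Local Open Scope classical_set_scope.
Local Open Scope ring_scope.

(* 1 / Gamma(x), by Gauss' product
     1 / Gamma(x) = lim_n x (x + 1) ... (x + n) / (n! n^x),
   which holds for every real x and vanishes at 0, -1, -2, ... *)
Definition rgamma (R : realType) (x : R) : R :=
  limn (fun n : nat =>
    (\prod_(i < n.+1) (x + i%:R)) / (n`!%:R * n%:R `^ x)).

Definition pochhammer (R : realType) (a : R) (n : nat) : R :=
  \prod_(i < n) (a + i%:R).

(* Regularized Gauss hypergeometric function 2F1(a, b; c; z) / Gamma(c). The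
   regularization is carried by each coefficient, since
   1 / ((c)_n Gamma(c)) = 1 / Gamma(c + n); nothing is singular at
   c = 0, -1, -2, ... The series converges for |z| < 1, and for every z when it
   terminates. *)
Definition reg_hyp2F1 (R : realType) (a b c z : R) : R :=
  limn (series (fun n : nat =>
    pochhammer a n * pochhammer b n * rgamma (c + n%:R) / n`!%:R * z ^+ n)).

(* Ferrers function of the first kind, of degree nu and order mu, on (-1, 1).
   For nonnegative integer nu and integer mu the formula also returns the
   continuous extension at x = 1 and x = -1: the series terminates, x / 0 = 0,
   and 0 `^ s is 1 for s = 0 and 0 otherwise, so that the value is 0 for
   mu != 0, and 1 at x = 1, (-1)^nu at x = -1 for mu = 0. *)
Definition ferrersP (R : realType) (nu mu x : R) : R :=
  ((1 + x) / (1 - x)) `^ (mu / 2) *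
  reg_hyp2F1 (nu + 1) (- nu) (1 - mu) ((1 - x) / 2).

Definition neumann_factor (R : realType) (m : int) : R :=
  if m == 0 then 1 else 2.

(* cos Theta = coefA + coefB cos(phi - phi'), with Theta the geodesic distance
   between the two points on the unit sphere. *)
Definition coefA (R : realType) (theta theta' theta2 theta2' : R) : R :=
  cos theta * cos theta' +
  sin theta * sin theta' * cos theta2 * cos theta2'.

Definition coefB (R : realType) (theta theta' theta2 theta2' : R) : R :=
  sin theta * sin theta' * sin theta2 * sin theta2'.

(* cos Theta at azimuth difference psi *)
Definition cos_sep (R : realType) (theta theta' theta2 theta2' psi : R) : R :=
  coefA theta theta' theta2 theta2' +
  coefB theta theta' theta2 theta2' * cos psi.

(* m-th azimuthal Fourier cosine coefficient of
   cot Theta = cos Theta / sqrt (1 - cos^2 Theta). *)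
Definition azimuthal_coef (R : realType) (m : int)
    (theta theta' theta2 theta2' : R) : R :=
  neumann_factor R m / pi *
  \int[lebesgue_measure]_(psi in `[0, pi])
    (cos_sep theta theta' theta2 theta2' psi * cos (m%:~R * psi) /
     Num.sqrt (1 - cos_sep theta theta' theta2 theta2' psi ^+ 2)).

(* The points with polar angles (theta, theta2) and (theta', theta2') neither
   coincide nor are antipodal for any azimuth difference: cot Theta, hence the
   integrand of azimuthal_coef, is defined on the whole of [0, pi]. *)
Definition nonsingular (R : realType) (theta theta' theta2 theta2' : R) : Prop :=
  forall psi : R, psi \in `[0, pi] ->
    `|cos_sep theta theta' theta2 theta2' psi| < 1.

(* Used with `|m| <= l, so that l - m and l + m are nonnegative and absz is
   the identity on them. *)
Definition factorial_ratio (R : realType) (l : nat) (m : int) : R :=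
  (absz (l%:Z - m)%R)`!%:R / (absz (l%:Z + m)%R)`!%:R.

Definition legendre_term (R : realType) (m : int)
    (theta theta' theta2 theta2' : R) (l : nat) : R :=
  (-1) ^+ l * (2 * l%:R + 1) * factorial_ratio R l m *
  ferrersP l%:R m%:~R (cos theta2) * ferrersP l%:R m%:~R (cos theta2') *
  ferrersP (1 / 2) (- (1 / 2 + l%:R)) (cos (Num.min theta theta')) *
  ferrersP (1 / 2) (1 / 2 + l%:R) (cos (Num.max theta theta')).

(* Terms l = |m|, |m| + 1, ..., reindexed from 0. *)
Definition legendre_tail (R : realType) (m : int)
    (theta theta' theta2 theta2' : R) : R^nat :=
  fun k => legendre_term m theta theta' theta2 theta2' (`|m|%N + k).

(* Main.v *)
(* Write s = tan (theta_< / 2), r = tan (theta_> / 2) and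
   x = cos theta2 cos theta2' + sin theta2 sin theta2' cos psi. The theorem is the
   m-th cosine coefficient in psi of
     cot Theta = sum_l c_l(s, r) P_l(x),   c_l = - (l + 1/2) u_l(s) v_l(r),
   where u_l and v_l are the regular and the singular radial solutions, which
   are Ferrers functions of degree 1/2 up to elementary factors: the addition
   theorem for Legendre polynomials turns the cosine coefficients of P_l(x) into
   the products P_l^m(cos theta2) P_l^m(cos theta2').
   To sum the series at fixed x, move (s, r) to s = 0 (one of the two points at
   the pole) along a curve on which Theta is constant. At s = 0 only the term
   l = 0 survives and equals cot Theta, while along the curve the derivative of
   the N-th partial sum telescopes to its last terms. Integrating bounds the error of that sum by a
   constant times (|P_N(x)| + |P_{N+1}(x)|) ((s / r)^(N+1) + (s r)^(N+1)). The
   constant is uniform in psi and s / r, s r <= 1, so |P_l| <= 1, P_l(x) -> 0 for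
   |x| < 1 and dominated convergence allow integrating term by term. *)
Require Import Defs.
From mathcomp Require Import ring lra zify.

Set Implicit Arguments.
Unset Strict Implicit.
Unset Printing Implicit Defensive.

Local Open Scope classical_set_scope.
Local Open Scope ring_scope.

(** The obstacle is uniformity as h = s / r or k = s r reaches 1, where the series loses its
    geometric decay. The telescoped derivative carries the factors N + 1 and 1 / ((1 - h^2)(1 -
    k^2)), so it is not bounded by a constant. It is instead compared with the derivative of h^(N+1)
    + k^(N+1) along the same curve, which has the factor N + 1 and the same singularities: the
    logarithmic speeds of h and k have denominators 1 - h^2 and 1 - k^2. Integrating the comparison
    leaves only the end values. The singular solution v_l is assembled from u_l(r) and u_l(1 / r),
    the inversion being the reflection theta -> pi - theta, and so inherits its bounds and
    recurrences from u_l. Only afterwards is it identified with the Ferrers function of order l +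
    1/2, by an induction on l that reads v_(l+1) off the derivative of v_l. The constant in that
    identification is Gamma(1/2)^2 = pi, which Wallis' integrals supply. At l = 0, u_0 = 1 and v_0 =
    - 2 cot theta_>, so the first term of the series is cot theta_>, which is cot Theta once the
    other point sits at the pole. *)

Section Derivatives.
Variable R : realType.
Implicit Types (f g : R -> R) (x a b c : R).

Lemma isd_eq f x a b : is_derive x 1 f a -> a = b -> is_derive x 1 f b.
Proof. by move=> ? <-. Qed.

Lemma isd_cst c x : is_derive x 1 (fun _ : R => c) 0.
Proof. exact: is_derive_cst. Qed.

Lemma isd_id x : is_derive x 1 (fun y : R => y) 1.
Proof. exact: is_derive_id. Qed.

Lemma isdD f g x a b : is_derive x 1 f a -> is_derive x 1 g b ->
  is_derive x 1 (fun y => f y + g y) (a + b).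
Proof. by move=> ? ?; exact: is_deriveD. Qed.

Lemma isdB f g x a b : is_derive x 1 f a -> is_derive x 1 g b ->
  is_derive x 1 (fun y => f y - g y) (a - b).
Proof. by move=> ? ?; exact: is_deriveB. Qed.

Lemma isdN f x a : is_derive x 1 f a -> is_derive x 1 (fun y => - f y) (- a).
Proof. by move=> ?; exact: is_deriveN. Qed.

Lemma isdM f g x a b : is_derive x 1 f a -> is_derive x 1 g b ->
  is_derive x 1 (fun y => f y * g y) (a * g x + f x * b).
Proof.
move=> fa gb; have := is_deriveM fa gb => H; apply: (isd_eq H).
by rewrite /GRing.scale /= addrC mulrC.
Qed.

Lemma isdZ c f x a : is_derive x 1 f a -> is_derive x 1 (fun y => c * f y) (c * a).
Proof.
by move=> fa; apply: (isd_eq (isdM (isd_cst c x) fa)); rewrite mul0r add0r.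
Qed.

Lemma isdX n f x a : is_derive x 1 f a ->
  is_derive x 1 (fun y => f y ^+ n) (n%:R * f x ^+ n.-1 * a).
Proof.
move=> fa; have -> : (fun y => f y ^+ n) = f ^+ n by apply/funext => y; rewrite exprfctE.
by have H := is_deriveX n fa; apply: (isd_eq H).
Qed.

Lemma isdV f x a : is_derive x 1 f a -> f x != 0 ->
  is_derive x 1 (fun y => (f y)^-1) (- a / f x ^+ 2).
Proof.
move=> fa f0; have H := is_deriveV f0 fa; apply: (isd_eq H).
by rewrite /GRing.scale /= mulNr mulrC mulNr.
Qed.

Lemma isd_comp f g x a b : is_derive x 1 g b -> is_derive (g x) 1 f a ->
  is_derive x 1 (fun y => f (g y)) (a * b).
Proof. by move=> gb fa; exact: (is_derive1_comp fa gb). Qed.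

Lemma isd_sqrt f x a : is_derive x 1 f a -> 0 < f x ->
  is_derive x 1 (fun y => Num.sqrt (f y)) (a / (2 * Num.sqrt (f x))).
Proof.
move=> fa f0; apply: (isd_eq (isd_comp fa (is_derive1_sqrt f0))).
by rewrite mulrC.
Qed.

Lemma isd_sum n (h : nat -> R -> R) (dh : nat -> R) x :
  (forall i, is_derive x 1 (h i) (dh i)) ->
  is_derive x 1 (fun y => \sum_(i < n) h i y) (\sum_(i < n) dh i).
Proof.
move=> hd; elim: n => [|n IH].
  rewrite big_ord0 (_ : (fun y => _) = fun=> 0); first exact: isd_cst.
  by apply/funext => y; rewrite big_ord0.
rewrite big_ord_recr (_ : (fun y => _) = fun y => \sum_(i < n) h i y + h n y).
  exact: isdD.
by apply/funext => y; rewrite big_ord_recr.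
Qed.

Lemma isd_cvg f x a : is_derive x 1 f a -> {for x, continuous f}.
Proof.
by move=> [fd _]; apply: differentiable_continuous; exact/derivable1_diffP.
Qed.

Lemma isd_near f g x a : (\forall y \near x, f y = g y) ->
  is_derive x 1 f a -> is_derive x 1 g a.
Proof. by move=> fg fa; apply: near_eq_is_derive; first exact: fg. Qed.

(* The endpoints are excluded from the differentiability hypothesis: the square
   roots parametrizing the path below are not differentiable there. *)
Lemma le_dist_of_derive f g (df dg : R -> R) a b : a <= b ->
  {within `[a, b], continuous f} -> {within `[a, b], continuous g} ->
  (forall x, x \in `]a, b[ -> is_derive x 1 f (df x)) ->
  (forall x, x \in `]a, b[ -> is_derive x 1 g (dg x)) ->
  (forall x, x \in `]a, b[ -> `|df x| <= dg x) ->
  `|f b - f a| <= g b - g a.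
Proof.
move=> ab cf cg hf hg hle.
have mono (h dh : R -> R) : {within `[a, b], continuous h} ->
    (forall x, x \in `]a, b[ -> is_derive x 1 h (dh x)) ->
    (forall x, x \in `]a, b[ -> 0 <= dh x) -> h a <= h b.
  move=> ch hh h0; apply: (@ger0_derive1_ndecr _ h a b) => // x xab.
    by case: (hh x xab).
  by rewrite derive1E; have [_ ->] := hh x xab; exact: h0.
rewrite ler_norml; apply/andP; split.
  rewrite -subr_ge0.
  have := @mono (fun x => f x + g x) (fun x => df x + dg x).
  have -> : f b - f a - - (g b - g a) = (f b + g b) - (f a + g a) by ring.
  rewrite subr_ge0; apply.
  - by move=> x; apply: cvgD; [exact: cf|exact: cg].
  - by move=> x xab; apply: isdD; [exact: hf|exact: hg].
  - by move=> x /hle; rewrite ler_norml => /andP[h _]; rewrite -lerBlDr sub0r.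
rewrite -subr_ge0.
have := @mono (fun x => g x - f x) (fun x => dg x - df x).
have -> : g b - g a - (f b - f a) = (g b - f b) - (g a - f a) by ring.
rewrite subr_ge0; apply.
- by move=> x; apply: cvgB; [exact: cg|exact: cf].
- by move=> x xab; apply: isdB; [exact: hg|exact: hf].
- by move=> x /hle; rewrite ler_norml => /andP[_ h]; rewrite subr_ge0.
Qed.

Lemma eq_of_derive f g (df : R -> R) a b : a <= b ->
  {within `[a, b], continuous f} -> {within `[a, b], continuous g} ->
  (forall x, x \in `]a, b[ -> is_derive x 1 f (df x)) ->
  (forall x, x \in `]a, b[ -> is_derive x 1 g (df x)) ->
  f b - f a = g b - g a.
Proof.
move=> ab cf cg hf hg.
have H : `|(f b - g b) - (f a - g a)| <= 0 - 0.
  apply: (@le_dist_of_derive (fun x => f x - g x) (fun=> 0) (fun=> 0) (fun=> 0)).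
  - by [].
  - by move=> x; apply: cvgB; [exact: cf|exact: cg].
  - by move=> x; exact: cvg_cst.
  - by move=> x xab; apply: (isd_eq (isdB (hf x xab) (hg x xab))); rewrite subrr.
  - by move=> x _; rewrite normr0.
move: H; rewrite subrr normr_le0 => /eqP H.
apply/eqP; rewrite -subr_eq0 -H; apply/eqP; ring.
Qed.

End Derivatives.

(** * Legendre polynomials *)

Section Legendre.
Variable R : realType.
Implicit Types (l m n : nat) (x : R).

Fixpoint legendre l : {poly R} :=
  if l is l1.+1 then
    if l1 is l2.+1 then
      (l1.+1%:R^-1)%:P * ((2 * l1%:R + 1) * 'X * legendre l1 - l1%:R * legendre l2)
    else 'X
  else 1.

Lemma natpolyC n : n%:R = n%:R%:P :> {poly R}.
Proof. by rewrite polyC_natr. Qed.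

(** Bonnet's recurrence cleared of its denominator. At [l = 0] the value [0.-1 = 0] does no harm,
    its coefficient being zero. *)
Lemma legendreS l :
  l.+1%:R * legendre l.+1 =
  (2 * l%:R + 1) * 'X * legendre l - l%:R * legendre l.-1.
Proof.
case: l => [|l]; first by rewrite /=; ring.
rewrite [LHS]/= mulrA natpolyC -polyCM divff ?mul1r // pnatr_eq0 //.
Qed.

Lemma natpoly_inj n (p q : {poly R}) : n.+1%:R * p = n.+1%:R * q -> p = q.
Proof. by apply/mulfI; rewrite natpolyC polyC_eq0 pnatr_eq0. Qed.

Lemma deriv_natM n (p : {poly R}) : (n%:R * p)^`() = n%:R * p^`().
Proof. by rewrite derivM natpolyC derivC mul0r add0r. Qed.

(** The two relations are proved together because each needs the other: differentiating Bonnet's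
    recurrence and removing P_l' by the second gives the first one degree higher, and both together
    give the second. *)
Lemma deriv_legendreS l :
  (legendre l.+1)^`() = 'X * (legendre l)^`() + l.+1%:R * legendre l /\
  'X * (legendre l.+1)^`() - (legendre l)^`() = l.+1%:R * legendre l.+1.
Proof.
elim: l => [|l [E1 E2]].
  by rewrite /= derivX derivC; split; ring.
have H := legendreS l.+1.
have Hd : l.+2%:R * (legendre l.+2)^`() =
    (2 * l.+1%:R + 1) * (legendre l.+1 + 'X * (legendre l.+1)^`())
    - l.+1%:R * (legendre l)^`().
  rewrite -deriv_natM H derivB deriv_natM -mulrA.
  have -> : 2 * l.+1%:R + 1 = (2 * l.+1 + 1)%:R :> {poly R} by rewrite natrD natrM.
  by rewrite deriv_natM derivM derivX mul1r.
have F1 : (legendre l.+2)^`() =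
    'X * (legendre l.+1)^`() + l.+2%:R * legendre l.+1.
  apply: (@natpoly_inj l.+1); rewrite Hd.
  have -> : (legendre l)^`() =
    'X * (legendre l.+1)^`() - l.+1%:R * legendre l.+1 by rewrite -E2; ring.
  by ring.
split=> //.
rewrite H F1 -[l.+1.-1]/l.
(* X times the second relation minus the first eliminates P_l'. *)
have E3 : ('X ^+ 2 - 1) * (legendre l.+1)^`() =
    l.+1%:R * ('X * legendre l.+1 - legendre l).
  have -> : ('X ^+ 2 - 1) * (legendre l.+1)^`() =
      'X * ('X * (legendre l.+1)^`() - (legendre l)^`())
      - ((legendre l.+1)^`() - 'X * (legendre l)^`()) by ring.
  by rewrite E2 E1; ring.
transitivity (('X ^+ 2 - 1) * (legendre l.+1)^`() + l.+2%:R * 'X * legendre l.+1).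
  by ring.
rewrite E3; ring.
Qed.

Lemma legendre0 : legendre 0 = 1. Proof. by []. Qed.

Lemma legendre1 : legendre 1 = 'X. Proof. by []. Qed.

Arguments legendre : simpl never.

(** The associated Legendre function without its factor (1 - x^2)^(m/2): a polynomial, hence
    meaningful at x = 1 and x = -1 too. *)
Definition dlegendre l m x : R := (legendre l)^`(m).[x].
Local Notation d := dlegendre.

Lemma derivn_natM n m (p : {poly R}) : (n%:R * p)^`(m) = n%:R * p^`(m).
Proof. by elim: m => [//|m IH]; rewrite !derivnS IH deriv_natM. Qed.

Lemma derivn_XM m (p : {poly R}) :
  ('X * p)^`(m) = 'X * p^`(m) + m%:R * p^`(m.-1).
Proof.
elim: m => [|m IH]; first by rewrite !derivn0 mul0r addr0.
rewrite derivnS IH derivD derivM derivX mul1r deriv_natM -!derivnS.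
case: m {IH} => [|m]; first by rewrite mul0r; ring.
by rewrite /=; ring.
Qed.

Lemma hornerNatM n (p : {poly R}) x : (n%:R * p).[x] = n%:R * p.[x].
Proof. by rewrite natpolyC hornerCM. Qed.

Lemma dlegendreSS l m x :
  d l.+1 m.+1 x = x * d l m.+1 x + (l + m + 1)%:R * d l m x.
Proof.
have [E1 _] := deriv_legendreS l.
rewrite /d derivSn E1 linearD/= derivn_XM derivn_natM -derivSn.
rewrite !(hornerD, hornerNatM) hornerM hornerX.
have -> : m%:R * (legendre l)^`()^`(m.-1).[x] = m%:R * (legendre l)^`(m).[x].
  by case: m {E1} => [|m]; [rewrite !mul0r|rewrite -derivSn].
ring.
Qed.

Lemma dlegendreS_down l m x :
  x * d l.+1 m.+1 x - d l m.+1 x = (l%:R + 1 - m%:R) * d l.+1 m x.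
Proof.
have [_ E2] := deriv_legendreS l.
have := congr1 (fun p : {poly R} => p^`(m).[x]) E2.
rewrite linearB/= derivn_XM derivn_natM.
rewrite !(hornerD, hornerN, hornerNatM) hornerM hornerX.
have -> : m%:R * (legendre l.+1)^`()^`(m.-1).[x] = m%:R * (legendre l.+1)^`(m).[x].
  by case: m => [|m]; [rewrite !mul0r|rewrite -derivSn].
rewrite -!derivSn -/(d l m.+1 x) -/(d l.+1 m x) -/(d l.+1 m.+1 x) => E.
have {}E : x * d l.+1 m.+1 x - d l m.+1 x =
   l.+1%:R * d l.+1 m x - m%:R * d l.+1 m x by rewrite -E; ring.
by rewrite E; ring.
Qed.

Lemma dlegendre0 m x : d 0 m x = (m == 0)%:R.
Proof.
rewrite /d legendre0; case: m => [|m]; first by rewrite derivn0 hornerC.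
by rewrite derivSn derivC; elim: m => [|m IH]; rewrite ?derivn0 ?hornerC // derivSn derivC.
Qed.

Lemma dlegendre1 m x : d 1 m x = if m is m1.+1 then (m1 == 0)%:R else x.
Proof.
case: m => [|m]; first by rewrite /d derivn0 hornerX.
by rewrite dlegendreSS !dlegendre0 mulr0 add0r add0n; case: m => [|m]; rewrite ?mulr1 ?mulr0.
Qed.

(** With [dlegendre_up] and [dlegendre_down], this trades degree l for degrees l + 1 and l - 1 while
    keeping, raising or lowering the order by one. These are the three moves that the recurrence
    behind the addition theorem requires. *)
Lemma dlegendre_rec l m x :
  (2 * l%:R + 1) * x * d l m x =
  (l%:R - m%:R + 1) * d l.+1 m x + (l + m)%:R * d l.-1 m x.
Proof.
case: m => [|m].
  have := congr1 (fun p : {poly R} => p.[x]) (legendreS l).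
  rewrite !(hornerD, hornerN, hornerNatM) -mulrA.
  have -> : 2 * l%:R + 1 = (2 * l + 1)%:R :> {poly R} by rewrite natrD natrM.
  rewrite hornerNatM hornerM hornerX /d !derivn0 addn0 subr0.
  have -> : (2 * l + 1)%:R = 2 * l%:R + 1 :> R by rewrite natrD natrM.
  have -> : l.+1%:R = l%:R + 1 :> R by rewrite -natr1.
  by move=> E; rewrite -mulrA E; ring.
case: l => [|l].
  rewrite dlegendre1 !dlegendre0 /= add0n.
  case: m => [|m] /=; rewrite ?mulr0 ?mul0r //; ring.
rewrite /= (dlegendreSS l.+1).
have -> : d l m.+1 x = x * d l.+1 m.+1 x - (l%:R + 1 - m%:R) * d l.+1 m x.
  by rewrite -dlegendreS_down; ring.
ring.
Qed.

Lemma dlegendre_up l m x :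
  (2 * l%:R + 1) * d l m x = d l.+1 m.+1 x - d l.-1 m.+1 x.
Proof.
case: l => [|l] /=.
  rewrite dlegendre1 !dlegendre0 /=; ring.
rewrite (dlegendreSS l.+1).
have -> : d l m.+1 x = x * d l.+1 m.+1 x - (l%:R + 1 - m%:R) * d l.+1 m x.
  by rewrite -dlegendreS_down; ring.
ring.
Qed.

(** Legendre's equation differentiated m times. *)
Lemma dlegendre_ode l m x :
  (1 - x ^+ 2) * d l m.+2 x =
  2 * m.+1%:R * x * d l m.+1 x - (l + m.+1)%:R * (l%:R - m%:R) * d l m x.
Proof.
case: l => [|l].
  by rewrite !dlegendre0 /=; case: m => [|m] /=; rewrite add0n; ring.
have E1 := dlegendreS_down l m.+1 x.
have E2 := dlegendreS_down l m x.
have E3 := dlegendreSS l m.+1 x.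
have {}E1 : d l m.+2 x = x * d l.+1 m.+2 x - (l%:R + 1 - m.+1%:R) * d l.+1 m.+1 x.
  by rewrite -E1; ring.
have {}E2 : d l m.+1 x = x * d l.+1 m.+1 x - (l%:R + 1 - m%:R) * d l.+1 m x.
  by rewrite -E2; ring.
rewrite E1 E2 in E3.
have -> : (1 - x ^+ 2) * d l.+1 m.+2 x = d l.+1 m.+2 x - x * (x * d l.+1 m.+2 x) by ring.
rewrite {1}E3; ring.
Qed.

Lemma dlegendre_down l m x :
  (2 * l%:R + 1) * ((1 - x ^+ 2) * d l m.+1 x) =
  (l + m)%:R * (l + m + 1)%:R * d l.-1 m x
  - (l%:R - m%:R) * (l%:R - m%:R + 1) * d l.+1 m x.
Proof.
case: l => [|l].
  rewrite dlegendre1 !dlegendre0 /= !add0n.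
  by case: m => [|[|m]] /=; rewrite ?natrD; ring.
have E1 := dlegendreS_down l m x.
have E3 := dlegendreSS l m x.
have {}E1 : d l m.+1 x = x * d l.+1 m.+1 x - (l%:R + 1 - m%:R) * d l.+1 m x.
  by rewrite -E1; ring.
rewrite E1 in E3.
have E4 : (1 - x ^+ 2) * d l.+1 m.+1 x =
   (l + m + 1)%:R * d l m x - (l%:R + 1 - m%:R) * (x * d l.+1 m x).
  have -> : (1 - x ^+ 2) * d l.+1 m.+1 x = d l.+1 m.+1 x - x * (x * d l.+1 m.+1 x) by ring.
  by rewrite {1}E3; ring.
have E5 := dlegendre_rec l.+1 m x.
rewrite E4 mulrBr.
have -> : (2 * l.+1%:R + 1) * ((l%:R + 1 - m%:R) * (x * d l.+1 m x)) =
  (l%:R + 1 - m%:R) * ((2 * l.+1%:R + 1) * x * d l.+1 m x) by ring.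
rewrite E5 /=; ring.
Qed.

Lemma dlegendre_gt l m x : (l < m)%N -> d l m x = 0.
Proof.
elim: l m => [|l IH] [|m] // lm.
  by rewrite dlegendre0.
by rewrite dlegendreSS !IH ?mulr0 ?addr0 // ltnW // .
Qed.

End Legendre.

Arguments legendre : simpl never.

(** * Bound and decay of Legendre polynomials on [-1, 1] *)

Section LegendreBound.
Variable R : realType.
Implicit Types (l n : nat) (x : R).

(* With w_l = x P_{l+1} - P_l, the energy T_l = w_l^2 + (1 - x^2) P_{l+1}^2 is
   nonincreasing, which bounds P_l; its decrements control w_l^2 / l, and the
   divergence of the harmonic series forces T_l -> 0. *)
Let p x l := (legendre R l).[x].
Let w x l := x * p x l.+1 - p x l.
Let T x l := (w x l) ^+ 2 + (1 - x ^+ 2) * (p x l.+1) ^+ 2.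

Let p_rec x l : p x l.+2 = x * p x l.+1 + l.+1%:R / l.+2%:R * w x l.
Proof.
have E := @dlegendre_rec R l.+1 0 x.
rewrite /dlegendre !derivn0 subr0 addn0 /= -!/(p x _) in E.
have l2 : l.+2%:R != 0 :> R by rewrite pnatr_eq0.
apply: (mulfI l2); rewrite /w.
transitivity ((l.+1%:R + 1) * p x l.+2); first by ring.
have -> : (l.+1%:R + 1) * p x l.+2 = (2 * l.+1%:R + 1) * x * p x l.+1 - l.+1%:R * p x l.
  by rewrite E; ring.
by field; rewrite -natrD pnatr_eq0.
Qed.

Let T_step x l : T x l.+1 = T x l - (1 - (l.+1%:R / l.+2%:R) ^+ 2) * w x l ^+ 2.
Proof. by rewrite /T /w !p_rec /w; ring. Qed.

Let T_decr x l : w x l ^+ 2 <= l.+2%:R * (T x l - T x l.+1).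
Proof.
rewrite T_step.
have -> : l.+2%:R * (T x l - (T x l - (1 - (l.+1%:R / l.+2%:R) ^+ 2) * w x l ^+ 2)) =
  (l.+2%:R * (1 - (l.+1%:R / l.+2%:R) ^+ 2)) * w x l ^+ 2 by ring.
rewrite ler_peMl ?sqr_ge0 //.
have -> : l.+2%:R * (1 - (l.+1%:R / l.+2%:R) ^+ 2) = 1 + l.+1%:R / l.+2%:R :> R.
  by field; rewrite -natrD pnatr_eq0.
by rewrite lerDl divr_ge0.
Qed.

Let T_noninc x l : T x l.+1 <= T x l.
Proof.
have := le_trans (sqr_ge0 _) (T_decr x l).
by rewrite pmulr_rge0 ?ltr0n // subr_ge0.
Qed.

Let T0 x : T x 0 = 1 - x ^+ 2.
Proof. by rewrite /T /w /p legendre1 legendre0 hornerX hornerC; ring. Qed.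

Let T_le x l : T x l <= 1 - x ^+ 2.
Proof.
by elim: l => [|l]; [rewrite T0 | apply: le_trans; exact: T_noninc].
Qed.

(** For x^2 < 1 divide (1 - x^2) P_(l+1)^2 <= T_l <= T_0 = 1 - x^2 by 1 - x^2. At x^2 = 1 this is
    void, but then T_l <= 0 forces w_l = 0, so |P_l| stays constant in l. *)
Lemma legendre_le1 x l : `|x| <= 1 -> `|(legendre R l).[x]| <= 1.
Proof.
move=> x1.
have x21 : x ^+ 2 <= 1 by rewrite -real_normK ?num_real// expr_le1.
case: l => [|l]; first by rewrite legendre0 hornerC normr1.
rewrite -/(p x l.+1).
move: x21; rewrite le_eqVlt => /orP[/eqP x21|x21].
  have : `|p x l.+1| = 1 /\ p x l = x * p x l.+1.
    elim: l => [|l [IH1 IH2]].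
      rewrite /p legendre1 legendre0 hornerX hornerC -expr2 x21; split=> //.
      by apply/eqP; rewrite -(@eqrXn2 _ 2) // ?real_normK ?num_real// x21 expr1n.
    have w0 : w x l.+1 = 0.
      apply/eqP; rewrite -sqrf_eq0 eq_le sqr_ge0 andbT.
      by have := T_le x l.+1; rewrite /T x21 subrr mul0r addr0.
    have E : p x l.+1 = x * p x l.+2 by move/eqP: w0; rewrite /w subr_eq0 => /eqP.
    split=> //; rewrite -IH1 E normrM.
    have -> : `|x| = 1.
      by apply/eqP; rewrite -(@eqrXn2 _ 2) // ?real_normK ?num_real// x21 expr1n.
    by rewrite mul1r.
  by case=> ->.
have := T_le x l; rewrite /T => H.
have : (1 - x ^+ 2) * p x l.+1 ^+ 2 <= 1 - x ^+ 2.
  by apply: le_trans H; rewrite lerDr sqr_ge0.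
rewrite ger_pMr ?subr_gt0 // => H2.
by rewrite -(@ler_pXn2r _ 2) ?nnegrE// expr1n real_normK ?num_real.
Qed.

(** The recurrence gives (1 - x^2) P_(l+1) = x t w_l - w_(l+1) with t = (l + 1) / (l + 2), so two
    consecutive w's dominate the whole energy. The constant comes from dividing by 1 - x^2. *)
Let T_control x l : `|x| < 1 ->
  T x l <= (1 + 2 / (1 - x ^+ 2)) * (w x l ^+ 2 + w x l.+1 ^+ 2).
Proof.
move=> x1.
have x21 : 0 < 1 - x ^+ 2 by rewrite subr_gt0 -real_normK ?num_real// expr_lt1.
set t := l.+1%:R / l.+2%:R : R.
have t0 : 0 <= t by rewrite /t divr_ge0.
have t1 : t <= 1 by rewrite /t ler_pdivrMr ?ltr0n // mul1r ler_nat.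
have E : (1 - x ^+ 2) * p x l.+1 = x * t * w x l - w x l.+1.
  by rewrite {2}/w p_rec -/t; ring.
have H : (1 - x ^+ 2) * ((1 - x ^+ 2) * p x l.+1 ^+ 2) <= 2 * (w x l ^+ 2 + w x l.+1 ^+ 2).
  have -> : (1 - x ^+ 2) * ((1 - x ^+ 2) * p x l.+1 ^+ 2) = (x * t * w x l - w x l.+1) ^+ 2.
    by rewrite -E; ring.
  have -> : (x * t * w x l - w x l.+1) ^+ 2 = 2 * ((x * t) ^+ 2 * w x l ^+ 2 + w x l.+1 ^+ 2)
     - (x * t * w x l + w x l.+1) ^+ 2 by ring.
  apply: (@le_trans _ _ (2 * ((x * t) ^+ 2 * w x l ^+ 2 + w x l.+1 ^+ 2))).
    by rewrite gerBl sqr_ge0.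
  have x2l : x ^+ 2 <= 1 by rewrite -subr_ge0 ltW.
  have t2l : t ^+ 2 <= 1 by rewrite expr_le1.
  by rewrite ler_pM2l // lerD2r ler_piMl ?sqr_ge0 // exprMn mulr_ile1 ?sqr_ge0.
have {}H : (1 - x ^+ 2) * p x l.+1 ^+ 2 <= 2 / (1 - x ^+ 2) * (w x l ^+ 2 + w x l.+1 ^+ 2).
  by rewrite mulrAC ler_pdivlMr // mulrC.
rewrite mulrDl mul1r /T lerD // lerDl sqr_ge0 //.
Qed.

(** Each T_l / (l + 3) is at most a constant times T_l - T_(l+2), by [T_control] and [T_decr].
    Summed over l < n, these differences telescope to T_0 + T_1 - T_n - T_(n+1), and T_1 <= T_0; on
    the left T_n <= T_l. *)
Let T_harmonic x n : `|x| < 1 ->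
  T x n * (\sum_(l < n) (l.+3%:R)^-1) <=
  (1 + 2 / (1 - x ^+ 2)) * (2 * T x 0 - T x n - T x n.+1).
Proof.
move=> x1; have x21 : 0 < 1 - x ^+ 2 by rewrite subr_gt0 -real_normK ?num_real// expr_lt1.
have C0 : 0 <= 1 + 2 / (1 - x ^+ 2) by rewrite addr_ge0 // divr_ge0 // ltW.
elim: n => [|n IH].
  rewrite big_ord0 mulr0 mulr_ge0 //; have := T_noninc x 0; lra.
rewrite big_ord_recr /= mulrDr.
have S0 : 0 <= \sum_(i < n) (i.+3%:R)^-1 :> R by apply: sumr_ge0 => i _; rewrite invr_ge0.
apply: (@le_trans _ _ (T x n * (\sum_(i < n) (i.+3%:R)^-1) + T x n / n.+3%:R)).
  by apply: lerD; apply: ler_wpM2r; rewrite ?T_noninc ?invr_ge0.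
have n3 : 0 < n.+3%:R :> R by rewrite ltr0n.
have H : T x n / n.+3%:R <= (1 + 2 / (1 - x ^+ 2)) * ((T x n - T x n.+1) + (T x n.+1 - T x n.+2)).
  rewrite ler_pdivrMr //; apply: le_trans (T_control n x1) _.
  rewrite -mulrA; apply: ler_wpM2l => //.
  rewrite mulrDl; apply: lerD; last by rewrite mulrC T_decr.
  apply: le_trans (T_decr x n) _; rewrite mulrC ler_wpM2l ?subr_ge0 ?T_noninc //.
  by rewrite ler_nat.
apply: le_trans (lerD IH H) _.
by rewrite -mulrDr ler_wpM2l //; lra.
Qed.

Lemma legendre_cvg0 x : `|x| < 1 -> (legendre R l).[x] @[l --> \oo] --> 0.
Proof.
move=> x1; have x21 : 0 < 1 - x ^+ 2 by rewrite subr_gt0 -real_normK ?num_real// expr_lt1.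
rewrite -(cvg_shiftS (fun l => (legendre R l).[x])).
set C := 1 + 2 / (1 - x ^+ 2).
have C0 : 0 < C by rewrite /C addr_gt0 // divr_gt0.
have Sy : (\sum_(l < n) (l.+3%:R)^-1 : R) @[n --> \oo] --> +oo.
  have : series (@harmonic R) n @[n --> \oo] --> +oo.
    apply: nondecreasing_dvgn_lt; last exact: dvg_harmonic.
    by apply: nondecreasing_series => n _; rewrite invr_ge0.
  rewrite -(cvg_shiftn 2) => /cvgryPge H; apply/cvgryPge => A.
  have := H (A + 2).
  apply: filterS => n /=; rewrite /series /= addn2 big_mkord 2!big_ord_recl /=.
  rewrite /harmonic /bump /= => h; move: h; rewrite invr1.
  rewrite (eq_bigr (fun i : 'I_n => (i.+3%:R)^-1)) //.
  move=> h; rewrite -(lerD2r 2); apply: le_trans h _.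
  rewrite [leRHS]addrC addrA lerD2r.
  have : 2%:R^-1 <= 1 :> R by rewrite invf_le1 ?ler1n ?ltr0n.
  by rewrite add1n; lra.
have bnd n : p x n.+1 ^+ 2 * (\sum_(l < n) (l.+3%:R)^-1) <= 2 * C.
  have S0 : 0 <= \sum_(i < n) (i.+3%:R)^-1 :> R by apply: sumr_ge0 => i _; rewrite invr_ge0.
  rewrite -(ler_pM2l x21) mulrA.
  apply: (@le_trans _ _ (T x n * \sum_(l < n) (l.+3%:R)^-1)).
    by rewrite ler_wpM2r // /T lerDr sqr_ge0.
  apply: le_trans (T_harmonic n x1) _.
  rewrite -/C.
  have Tn k : 0 <= T x k by rewrite /T addr_ge0 ?sqr_ge0 // mulr_ge0 ?sqr_ge0 // ltW.
  rewrite [leRHS](_ : _ = C * (2 * T x 0)); last by rewrite T0; ring.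
  by rewrite ler_wpM2l ?(ltW C0) //; have := Tn n; have := Tn n.+1; lra.
apply/cvgr0Pnorm_lt => e e0.
move/cvgryPgt: Sy => /(_ (2 * C / e ^+ 2)).
apply: filterS => n Hn.
rewrite -(@ltr_pXn2r _ 2) ?nnegrE ?normr_ge0 ?(ltW e0)// real_normK ?num_real//.
rewrite -/(p x n.+1).
have e20 : 0 < e ^+ 2 by rewrite exprn_gt0.
have S0 : 0 < \sum_(i < n) (i.+3%:R)^-1 :> R.
  by apply: le_lt_trans Hn; rewrite divr_ge0 ?(ltW e20) // mulr_ge0 ?(ltW C0).
rewrite -(ltr_pM2r S0); apply: le_lt_trans (bnd n) _.
by rewrite [ltRHS]mulrC -ltr_pdivrMr.
Qed.

End LegendreBound.

(** * The addition theorem *)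

Section Addition.
Variable R : realType.
Implicit Types (l m n : nat) (x : R) (f g : R -> R).

Definition int0pi f : R := \int[lebesgue_measure]_(psi in `[0, pi]) f psi.

Lemma integrable0pi f : continuous f ->
  (@lebesgue_measure R).-integrable `[0, pi] (EFin \o f).
Proof.
move=> cf; apply: continuous_compact_integrable; first exact: segment_compact.
exact: continuous_subspaceT.
Qed.

Lemma int0piD f g : continuous f -> continuous g ->
  int0pi (fun x => f x + g x) = int0pi f + int0pi g.
Proof. by move=> cf cg; rewrite /int0pi RintegralD //; exact: integrable0pi. Qed.

Lemma int0piZ a f : continuous f ->
  int0pi (fun x => a * f x) = a * int0pi f.
Proof. by move=> cf; rewrite /int0pi RintegralZl //; exact: integrable0pi. Qed.

Lemma int0piB f g : continuous f -> continuous g ->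
  int0pi (fun x => f x - g x) = int0pi f - int0pi g.
Proof. by move=> cf cg; rewrite /int0pi RintegralB //; exact: integrable0pi. Qed.

Lemma eq_int0pi f g : f =1 g -> int0pi f = int0pi g.
Proof. by move=> /funext ->. Qed.

Lemma int0pi_FTC f (F : R -> R) : continuous f ->
  (forall x, is_derive x 1 F (f x)) -> int0pi f = F pi - F 0.
Proof.
move=> cf dF; rewrite /int0pi /Rintegral.
rewrite (@continuous_FTC2 _ f F) ?pi_gt0 //.
- exact: continuous_subspaceT.
- have cF : continuous F.
    move=> x; apply: differentiable_continuous.
    by apply/derivable1_diffP; have [] := dF x.
  split; first by move=> x _; have [] := dF x.
  + exact/cvg_at_right_filter/cF.
  + exact/cvg_at_left_filter/cF.
- by move=> x _; rewrite derive1E; have [_ ->] := dF x.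
Qed.

Lemma int0pi_cst a : int0pi (fun=> a) = a * pi.
Proof.
have c : continuous (fun _ : R => a) by move=> x; exact: cvg_cst.
have dF (x : R) : is_derive x 1 (fun x => a * x) a.
  by apply: is_derive_eq; rewrite /GRing.scale /= mulr1.
by rewrite (int0pi_FTC c dF) mulr0 subr0.
Qed.

Lemma sin_natpi m : sin (m%:R * pi) = 0 :> R.
Proof.
elim: m => [|m IH]; first by rewrite mul0r sin0.
by rewrite -natr1 mulrDl mul1r sinDpi IH oppr0.
Qed.

Lemma continuous_cosn m : continuous (fun psi : R => cos (m%:R * psi)).
Proof.
move=> x; apply: (@continuous_comp _ _ _ (fun y : R => m%:R * y) cos).
  by apply: cvgMr; exact: cvg_id.
exact: continuous_cos.
Qed.

Lemma int0pi_cosn m : int0pi (fun psi => cos (m%:R * psi)) = (m == 0)%:R * pi.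
Proof.
case: m => [|m].
  rewrite -(int0pi_cst 1); apply: eq_int0pi => x.
  by rewrite mul0r cos0.
have dF (x : R) : is_derive x 1 (fun x => (m.+1%:R)^-1 * sin (m.+1%:R * x)) (cos (m.+1%:R * x)).
  apply: is_derive_eq; rewrite /GRing.scale /= mulr1.
  by rewrite mulrCA mulVf ?mulr1 // pnatr_eq0.
by rewrite (int0pi_FTC (@continuous_cosn _) dF) mulr0 sin0 sin_natpi !mulr0 mul0r subrr.
Qed.

Variables (x1 x2 Y : R).

Let t psi := x1 * x2 + Y * cos psi.
Let P l psi := (legendre R l).[t psi].
(* Both sides of the addition theorem satisfy the same recurrence in l. *)
Let a l m := int0pi (fun psi => P l psi * cos (m%:R * psi)).

Lemma continuous_legendre_arg l : continuous (fun psi => P l psi).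
Proof.
move=> x; apply: (@continuous_comp _ _ _ t (horner (legendre R l))).
  apply: cvgD; first exact: cvg_cst.
  by apply: cvgMr; exact: continuous_cos.
exact: continuous_horner.
Qed.

Let cP l m : continuous (fun psi => P l psi * cos (m%:R * psi)).
Proof.
move=> x; apply: cvgM; first exact: continuous_legendre_arg.
exact: continuous_cosn.
Qed.

Let P_rec l psi :
  P l.+1 psi = (l.+1%:R)^-1 * ((2 * l%:R + 1) * (t psi * P l psi) - l%:R * P l.-1 psi).
Proof.
have := @dlegendre_rec R l 0 (t psi).
rewrite /dlegendre !derivn0 subr0 addn0 -/(P _ _) => E.
rewrite mulrA E; have l1 : l.+1%:R != 0 :> R by rewrite pnatr_eq0.
by apply: (mulfI l1); rewrite mulrA divff // mul1r /P; ring.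
Qed.

(** At [m = 0] the neighbouring frequencies are 1 and -1, which the cosine identifies; hence the
    index 1 there. *)
Let cos_shift m psi :
  cos psi * cos (m%:R * psi) =
  2^-1 * (cos (m.+1%:R * psi) + cos ((if m is 0 then 1 else m.-1)%:R * psi)) :> R.
Proof.
case: m => [|m].
  by rewrite mul0r cos0 mul1r; field.
have -> : m.+2%:R * psi = m.+1%:R * psi + psi by ring.
have -> : m.+1.-1%:R * psi = m.+1%:R * psi - psi by rewrite /=; ring.
by rewrite cosD cosB; field.
Qed.

Let a_rec l m :
  l.+1%:R * a l.+1 m =
  (2 * l%:R + 1) * (x1 * x2 * a l m + Y / 2 * (a l m.+1 + a l (if m is 0 then 1 else m.-1)))
  - l%:R * a l.-1 m.
Proof.
set m' := (if m is 0 then 1 else m.-1).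
have l1 : l.+1%:R != 0 :> R by rewrite pnatr_eq0.
rewrite /a (@eq_int0pi _ (fun psi => (l.+1%:R)^-1 * (
  (2 * l%:R + 1) * (x1 * x2 * (P l psi * cos (m%:R * psi)) +
   Y / 2 * (P l psi * cos (m.+1%:R * psi) + P l psi * cos (m'%:R * psi)))
  - l%:R * (P l.-1 psi * cos (m%:R * psi))))); last first.
  move=> psi; rewrite P_rec -/m'.
  have := cos_shift m psi; rewrite -/m' => E.
  transitivity ((l.+1%:R)^-1 * ((2 * l%:R + 1) * (x1 * x2 * (P l psi * cos (m%:R * psi))
     + Y * P l psi * (cos psi * cos (m%:R * psi))) - l%:R * (P l.-1 psi * cos (m%:R * psi)))).
    by rewrite /t; ring.
  by rewrite E; ring.
have c1 : continuous (fun psi => P l psi * cos (m.+1%:R * psi) + P l psi * cos (m'%:R * psi)).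
  by move=> x; apply: cvgD; exact: cP.
have c2 : continuous (fun psi => x1 * x2 * (P l psi * cos (m%:R * psi))).
  by move=> x; apply: cvgMr; exact: cP.
have c3 : continuous (fun psi => Y / 2 * (P l psi * cos (m.+1%:R * psi) + P l psi * cos (m'%:R * psi))).
  by move=> x; apply: cvgMr; exact: c1.
have c4 : continuous (fun psi => x1 * x2 * (P l psi * cos (m%:R * psi)) +
   Y / 2 * (P l psi * cos (m.+1%:R * psi) + P l psi * cos (m'%:R * psi))).
  by move=> x; apply: cvgD; [exact: c2|exact: c3].
have c5 : continuous (fun psi => (2 * l%:R + 1) * (x1 * x2 * (P l psi * cos (m%:R * psi)) +
   Y / 2 * (P l psi * cos (m.+1%:R * psi) + P l psi * cos (m'%:R * psi)))).
  by move=> x; apply: cvgMr; exact: c4.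
have c6 : continuous (fun psi => l%:R * (P l.-1 psi * cos (m%:R * psi))).
  by move=> x; apply: cvgMr; exact: cP.
rewrite int0piZ; last by move=> x; apply: cvgB; [exact: c5|exact: c6].
rewrite mulrA divff // mul1r int0piB // int0piZ // int0piZ; last exact: cP.
rewrite int0piD // int0piZ; last exact: cP.
by rewrite int0piZ // int0piD //; exact: cP.
Qed.

Let fr l m : R := (l - m)`!%:R / (l + m)`!%:R.
Let d := @dlegendre R.
Let G l m := fr l m * Y ^+ m * d l m x1 * d l m x2.

Hypothesis Y2 : Y ^+ 2 = (1 - x1 ^+ 2) * (1 - x2 ^+ 2).

Let fr_recSl l m : (m <= l)%N ->
  fr l.+1 m = fr l m * (l%:R - m%:R + 1) / (l%:R + m%:R + 1).
Proof.
move=> ml; rewrite /fr subSn // addSn !factS !natrM -natr1 natrB //.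
rewrite -(natr1 (l + m)) natrD.
have : (l + m)`!%:R != 0 :> R by rewrite pnatr_eq0 -lt0n fact_gt0.
have : l%:R + m%:R + 1 != 0 :> R by rewrite -natrD natr1 pnatr_eq0.
by move=> h1 h2; field; rewrite h1 h2.
Qed.

Let fr_recSm l m : (m < l)%N ->
  fr l m.+1 = fr l m / (l%:R - m%:R) / (l%:R + m%:R + 1).
Proof.
move=> ml; rewrite /fr addnS factS natrM.
have -> : (l - m)`! = ((l - m) * (l - m.+1)`!)%N by rewrite -(subnSK ml) factS.
rewrite natrM natrB ?(ltnW ml) // -(natr1 (l + m)) natrD.
have h1 : (l + m)`!%:R != 0 :> R by rewrite pnatr_eq0 -lt0n fact_gt0.
have h2 : l%:R + m%:R + 1 != 0 :> R by rewrite -natrD natr1 pnatr_eq0.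
have h3 : l%:R - m%:R != 0 :> R by rewrite -natrB ?(ltnW ml) // pnatr_eq0 -lt0n subn_gt0.
by field; rewrite h1 h2 h3.
Qed.

Let fr_predl l m : (m < l)%N ->
  fr l.-1 m = fr l m * (l%:R + m%:R) / (l%:R - m%:R).
Proof.
case: l => // l ml; rewrite fr_recSl //=.
have h2 : l%:R + m%:R + 1 != 0 :> R by rewrite -natrD natr1 pnatr_eq0.
have h3 : l.+1%:R - m%:R != 0 :> R by rewrite -natrB ?(ltnW ml) // pnatr_eq0 -lt0n subn_gt0.
by rewrite -natr1 in h3 *; field; rewrite h3 h2.
Qed.

(** [dlegendre_rec], [dlegendre_up] and [dlegendre_down] bring every factor to order m and degree l
    + 1 or l - 1, the factors 1 - x^2 being supplied by Y^2. The mixed products cancel, and the two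
    pure ones are [G l.+1 m] and [G l.-1 m]. *)
Let G_rec l m :
  l.+1%:R * G l.+1 m =
  (2 * l%:R + 1) * (x1 * x2 * G l m + Y / 2 * (G l m.+1 + G l (if m is 0 then 1 else m.-1)))
  - l%:R * G l.-1 m.
Proof.
have o : 2 * l%:R + 1 != 0 :> R by rewrite gt_eqF // ltr_wpDl // mulr_ge0.
have d_up k x : d l k x = (d l.+1 k.+1 x - d l.-1 k.+1 x) / (2 * l%:R + 1).
  by apply: (mulfI o); rewrite [RHS]mulrCA divff // mulr1 -dlegendre_up.
have d_x k x : x * d l k x =
    ((l%:R - k%:R + 1) * d l.+1 k x + (l + k)%:R * d l.-1 k x) / (2 * l%:R + 1).
  by apply: (mulfI o); rewrite [RHS]mulrCA divff // mulr1 -dlegendre_rec mulrA.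
have d_down k x : (1 - x ^+ 2) * d l k.+1 x =
    ((l + k)%:R * (l + k + 1)%:R * d l.-1 k x
     - (l%:R - k%:R) * (l%:R - k%:R + 1) * d l.+1 k x) / (2 * l%:R + 1).
  by apply: (mulfI o); rewrite [RHS]mulrCA divff // mulr1 -dlegendre_down.
have Gx k : x1 * x2 * G l k = fr l k * Y ^+ k * (x1 * d l k x1) * (x2 * d l k x2).
  by rewrite /G; ring.
have Gup k : Y * G l k.+1 = fr l k.+1 * Y ^+ k
    * ((1 - x1 ^+ 2) * d l k.+1 x1) * ((1 - x2 ^+ 2) * d l k.+1 x2).
  transitivity (fr l k.+1 * Y ^+ k * Y ^+ 2 * d l k.+1 x1 * d l k.+1 x2).
    by rewrite /G exprS; ring.
  by rewrite Y2; ring.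
(* The subtraction in [fr] is truncated, so orders above the degree are treated apart. There
   everything vanishes except when the order is l + 1, where [G l l] produces [G l.+1 l.+1]. *)
have [lm|ml] := ltnP l m.
  case: m lm => // m; rewrite ltnS => lm /=.
  have z k x : (l < k)%N -> d l k x = 0 by exact: dlegendre_gt.
  have zp x : d l.-1 m.+1 x = 0.
    by apply: dlegendre_gt; rewrite ltnS (leq_trans (leq_pred l)).
  have -> : G l m.+1 = 0 by rewrite /G z // mulr0 mul0r.
  have -> : G l m.+2 = 0 by rewrite /G z ?mulr0 ?mul0r // ltnS leqW.
  have -> : G l.-1 m.+1 = 0 by rewrite /G zp mulr0 mul0r.
  rewrite !mulr0 !add0r subr0.
  move: lm; rewrite leq_eqVlt => /orP[/eqP lm|lm]; last first.
    rewrite {2}/G (z m) // mulr0 mul0r !mulr0 /G.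
    have -> : d l.+1 m.+1 x1 = 0 by apply: dlegendre_gt.
    by rewrite mulr0 mul0r mulr0.
  subst m; rewrite /G !(d_up l) !zp !subr0 exprS.
  have -> : fr l.+1 l.+1 = fr l l / (2 * (2 * l%:R + 1) * (l%:R + 1)).
    rewrite /fr !subnn addSn addnS !factS fact0 !natrM.
    have h : (l + l)`!%:R != 0 :> R by rewrite pnatr_eq0 -lt0n fact_gt0.
    have h2 : l%:R + 1 != 0 :> R by rewrite natr1 pnatr_eq0.
    have h3 : l%:R + l%:R + 1 != 0 :> R by rewrite -natrD natr1 pnatr_eq0.
    by field; rewrite h h2 o -!natrD pnatr_eq0.
  have h2 : l%:R + 1 != 0 :> R by rewrite natr1 pnatr_eq0.
  by field; rewrite h2 o.
have lm1 : l%:R + m%:R + 1 != 0 :> R by rewrite -natrD natr1 pnatr_eq0.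
have lmn : (m < l)%N -> l%:R - m%:R != 0 :> R.
  by move=> lm; rewrite -natrB // pnatr_eq0 -lt0n subn_gt0.
case: m ml lm1 lmn => [|m] ml lm1 lmn.
  rewrite [RHS](_ : _ = (2 * l%:R + 1) * (x1 * x2 * G l 0 + Y * G l 1) - l%:R * G l.-1 0); last by field.
  rewrite Gx Gup !d_x !d_down.
  case: (posnP l) => [l0|lp].
    rewrite /G /fr l0 /= ?subn0 ?addn0 ?add0n ?fact0 /d !dlegendre0 !dlegendre1 ?factS ?fact0 ?expr0.
    by field.
  rewrite fr_recSm // /G (fr_recSl ml) fr_predl //.
  have l0 := lmn lp.
  rewrite !expr0 !addn0 !subr0 !addr0 in l0 lm1 *.
  by rewrite -natr1 natrD; field; rewrite o l0 lm1.
have -> : Y / 2 * (G l m.+2 + G l m) = 2^-1 * (Y * G l m.+2 + Y * G l m) by ring.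
have -> : Y * G l m = fr l m * Y ^+ m.+1 * d l m x1 * d l m x2 by rewrite /G exprS; ring.
have -> : fr l m = fr l m.+1 * (l%:R - m%:R) * (l%:R + m%:R + 1).
  have h2 : l%:R + m%:R + 1 != 0 :> R by rewrite -natrD natr1 pnatr_eq0.
  have h3 : l%:R - m%:R != 0 :> R by rewrite -natrB ?(ltnW ml) // pnatr_eq0 -lt0n subn_gt0.
  by rewrite fr_recSm //; field; rewrite h2 h3.
rewrite Gx Gup !d_x !d_down !(d_up m).
(* At order equal to degree, [G l.-1] has order above its degree and vanishes, and the ratio
   [fr l.-1] is not covered by [fr_predl]. *)
move: ml; rewrite leq_eqVlt => /orP[/eqP ml|ml].
  have zp x : d l.-1 m.+1 x = 0 by apply: dlegendre_gt; rewrite -ml.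
  have -> : G l.-1 m.+1 = 0 by rewrite /G zp mulr0 mul0r.
  rewrite !zp /G fr_recSl -ml // -!natr1 !natrD.
  by field; rewrite natr1 ml o.
rewrite (fr_recSm ml) /G (fr_recSl (ltnW ml)) fr_predl // !natrD.
have l0 := lmn ml.
by field; rewrite nat1r o l0 lm1.
Qed.

Lemma legendre_addition l m :
  int0pi (fun psi => (legendre R l).[x1 * x2 + Y * cos psi] * cos (m%:R * psi)) =
  pi * (fr l m * Y ^+ m * d l m x1 * d l m x2).
Proof.
rewrite -/(G l m) -[LHS]/(a l m).
suff : a l m = pi * G l m /\ a l.+1 m = pi * G l.+1 m by case.
elim: l m => [|l IH] m.
  have a0 k : a 0 k = pi * G 0 k.
    rewrite /a (@eq_int0pi _ (fun psi => cos (k%:R * psi))); last first.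
      by move=> psi; rewrite /P legendre0 hornerC mul1r.
    rewrite int0pi_cosn /G /d !dlegendre0 /fr.
    case: k => [|k] /=; last by rewrite !mulr0 mul0r.
    by rewrite subnn addn0 fact0 expr0; field.
  split=> //; rewrite -[LHS]mul1r -[X in X * a 1 m]/(1%:R) a_rec mul0r subr0 !a0.
  rewrite -[G 1 m]mul1r -[X in X * G 1 m]/(1%:R) G_rec mul0r subr0; ring.
have H k : a l k = pi * G l k by case: (IH k).
have H1 k : a l.+1 k = pi * G l.+1 k by case: (IH k).
split=> //.
have l1 : l.+2%:R != 0 :> R by rewrite pnatr_eq0.
by apply: (mulfI l1); rewrite mulrCA G_rec a_rec /= !H !H1; ring.
Qed.

End Addition.

(** * The reciprocal Gamma function at half-integers *)

Section ReciprocalGamma.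
Variable R : realType.
Implicit Types (n k : nat) (x : R).

Definition gauss_prod x n : R := (\prod_(i < n.+1) (x + i%:R)) / (n`!%:R * n%:R `^ x).

Lemma gauss_prodS x n : (0 < n)%N ->
  x * gauss_prod (x + 1) n = gauss_prod x n * ((x + n%:R + 1) / n%:R).
Proof.
move=> n0; have n0' : n%:R != 0 :> R by rewrite pnatr_eq0 -lt0n.
have px : n%:R `^ x != 0 :> R by rewrite gt_eqF // powR_gt0 // ltr0n.
have nf : n`!%:R != 0 :> R by rewrite pnatr_eq0 -lt0n fact_gt0.
have E : x * (\prod_(i < n.+1) (x + 1 + i%:R)) =
    (\prod_(i < n.+1) (x + i%:R)) * (x + n%:R + 1).
  transitivity (\prod_(i < n.+2) (x + i%:R)).
    rewrite [RHS]big_ord_recl /= addr0; congr (_ * _); apply: eq_bigr => i _.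
    by rewrite /bump /= add1n -nat1r addrA.
  by rewrite big_ord_recr /= -natr1 addrA.
rewrite /gauss_prod mulrA E powRD; last by rewrite n0' implybT.
rewrite powRr1 //; field; rewrite nf n0' px //.
Qed.

Lemma cvg_ratio x : (n%:R / (x + n%:R + 1)) @[n --> \oo] --> (1 : R).
Proof.
have -> : (1 : R) = 1 - (x + 1) * 0 by rewrite mulr0 subr0.
have h : (x + n%:R + 1) @[n --> \oo] --> +oo.
  rewrite (_ : (fun n => _) = (fun n => n%:R + (x + 1))); last first.
    by apply/funext => n; rewrite -addrA addrCA.
  apply/cvgryPge => A; have /cvgryPge/(_ (A - (x + 1))) := @cvgr_idn R.
  by apply: filterS => n; rewrite lerBlDr.
apply: (@cvg_trans _ ((1 - (x + 1) * (x + n%:R + 1)^-1) @[n --> \oo])).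
  apply: near_eq_cvg; move/cvgryPgt : h => /(_ 0); apply: filterS => n h.
  by field; rewrite gt_eqF.
apply: cvgB; first exact: cvg_cst.
apply: cvgMr; apply/gtr0_cvgV0; last exact: h.
by move/cvgryPgt : h => /(_ 0).
Qed.

(** Downwards the functional equation needs no division, so it passes through the zeros at 0, -1,
    -2, ...; upwards, in [cvg_gauss_prodS], x must be invertible. *)
Lemma rgammaS x : cvgn (gauss_prod (x + 1)) ->
  cvgn (gauss_prod x) /\ rgamma x = x * rgamma (x + 1).
Proof.
move=> c; have : gauss_prod x @ \oo --> x * rgamma (x + 1) * 1.
  apply: (@cvg_trans _ ((x * gauss_prod (x + 1) n * (n%:R / (x + n%:R + 1))) @[n --> \oo])).
    apply: near_eq_cvg; near=> n.
    have n0 : (0 < n)%N by near: n; exact: nbhs_infty_gt.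
    have h : x + n%:R + 1 != 0.
      rewrite gt_eqF // -addrA addrCA -ltrBlDr sub0r.
      near: n; exact: nbhs_infty_gtr.
    rewrite gauss_prodS //; field; rewrite h /=.
    by rewrite pnatr_eq0 -lt0n.
  by apply: cvgM; [apply: cvgMr; exact: c | exact: cvg_ratio].
rewrite mulr1 => h; split; first by apply/cvg_ex; exists (x * rgamma (x + 1)).
exact/cvg_lim.
Unshelve. all: by end_near. Qed.

Lemma cvg_gauss_prodS x : x != 0 -> cvgn (gauss_prod x) -> cvgn (gauss_prod (x + 1)).
Proof.
move=> x0 c; apply/cvg_ex; exists (x^-1 * rgamma x * 1^-1).
apply: (@cvg_trans _ ((x^-1 * gauss_prod x n * (n%:R / (x + n%:R + 1))^-1) @[n --> \oo])).
  apply: near_eq_cvg; near=> n.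
  have n0 : (0 < n)%N by near: n; exact: nbhs_infty_gt.
  apply: (mulfI x0); rewrite gauss_prodS //.
  by rewrite invf_div -2!mulrA mulVKf.
apply: cvgM; first by apply: cvgMr; exact: c.
by apply: cvgV; [exact: oner_neq0 | exact: cvg_ratio].
Unshelve. all: by end_near. Qed.

Lemma rgamma1 : cvgn (gauss_prod 1) /\ rgamma (1 : R) = 1.
Proof.
have c : gauss_prod 1 @ \oo --> (1 : R).
  rewrite -(cvg_shiftS (gauss_prod 1)).
  apply: (@cvg_trans _ ((1 + n.+1%:R^-1) @[n --> \oo])).
    apply: near_eq_cvg; near=> n.
    rewrite [RHS]/gauss_prod powRr1 //. 
    have -> : \prod_(i < n.+2) (1 + i%:R) = (n.+2)`!%:R :> R.
      elim: n.+2 => [|k IH]; first by rewrite big_ord0.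
      by rewrite big_ord_recr /= IH factS mulnC natrM nat1r.
    rewrite factS natrM -(natr1 n.+1).
    have nf : (n.+1)`!%:R != 0 :> R by rewrite pnatr_eq0 -lt0n fact_gt0.
    have n1 : n.+1%:R != 0 :> R by rewrite pnatr_eq0.
    by field; rewrite nf nat1r n1.
  have h : (1 + @harmonic R n) @[n --> \oo] --> (1 + 0 : R).
    by apply: cvgD; [exact: cvg_cst | exact: cvg_harmonic].
  by rewrite addr0 in h.
by split; [apply/cvg_ex; exists 1 | exact/cvg_lim].
Unshelve. all: by end_near. Qed.

Lemma rgamma_nat n : cvgn (gauss_prod n.+1%:R) /\ rgamma (n.+1%:R : R) = (n`!%:R)^-1.
Proof.
elim: n => [|n [c E]]; first by rewrite fact0 invr1; exact: rgamma1.
have n1 : n.+1%:R != 0 :> R by rewrite pnatr_eq0.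
have c1 : cvgn (gauss_prod (n.+1%:R + 1)) by exact: cvg_gauss_prodS.
rewrite -natr1; split=> //.
apply: (mulfI n1); have [_ <-] := rgammaS c1.
by rewrite E factS natrM invfM mulrA divff // mul1r.
Qed.

Lemma rgamma_npos n : cvgn (gauss_prod (- n%:R)) /\ rgamma (- n%:R : R) = 0.
Proof.
elim: n => [|n [c E]].
  have [c1 _] := rgamma1.
  have : cvgn (gauss_prod (0 + 1)) by rewrite add0r.
  by rewrite oppr0 => /rgammaS[? ->]; rewrite mul0r.
have : cvgn (gauss_prod (- n.+1%:R + 1)) by rewrite -natr1 opprD addrNK.
move/rgammaS => [? ->]; split=> //.
by rewrite -natr1 opprD addrNK E mulr0.
Qed.

(* Wallis' integrals give rgamma (1 / 2). *)
Let W k := int0pi (fun psi : R => sin psi ^+ k).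

Let continuous_sinX k : continuous (fun psi : R => sin psi ^+ k).
Proof.
move=> x; apply: (@continuous_comp _ _ _ sin (fun y => y ^+ k)).
  exact: continuous_sin.
exact: exprn_continuous.
Qed.

Let W_rec k : k.+2%:R * W k.+2 = k.+1%:R * W k.
Proof.
have dF (x : R) : is_derive x 1 (fun x => - (sin x ^+ k.+1 * cos x))
    (k.+2%:R * sin x ^+ k.+2 - k.+1%:R * sin x ^+ k).
  apply: (isd_eq (isdN (isdM (isdX k.+1 (is_derive_sin x)) (is_derive_cos x)))).
  have C : cos x * cos x = 1 - sin x ^+ 2 by rewrite -expr2 cos2sin2.
  transitivity (sin x ^+ k.+2 - k.+1%:R * sin x ^+ k * (cos x * cos x)).
    by rewrite /= !exprS; ring.
  by rewrite C !exprS; ring.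
have c j n : continuous (fun psi : R => n%:R * sin psi ^+ j).
  by move=> x; apply: cvgMr; exact: continuous_sinX.
apply/eqP; rewrite -subr_eq0; apply/eqP.
rewrite /W -!int0piZ; try exact: continuous_sinX.
rewrite -int0piB //.
rewrite (int0pi_FTC _ dF); last by move=> x; apply: cvgB; exact: c.
by rewrite sin0 sinpi !expr0n /= !mul0r oppr0 subr0.
Qed.

Let W_le k : W k.+1 <= W k.
Proof.
apply: le_Rintegral; first by [].
- by apply: (@integrable0pi R (fun psi => sin psi ^+ k.+1)); exact: continuous_sinX.
- by apply: (@integrable0pi R (fun psi => sin psi ^+ k)); exact: continuous_sinX.
move=> x; rewrite /= in_itv /= => x0pi.
by rewrite exprS ler_piMl ?sin_le1 // exprn_ge0 // sin_ge0_pi.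
Qed.

Let W0 : W 0 = pi.
Proof.
rewrite /W (@eq_int0pi _ _ (fun=> 1)) ?int0pi_cst ?mul1r // => x.
Qed.

Let W1 : W 1 = 2.
Proof.
have dF (x : R) : is_derive x 1 (fun x => - cos x) (sin x ^+ 1).
  by apply: (isd_eq (isdN (is_derive_cos x))); rewrite opprK.
rewrite /W (int0pi_FTC (@continuous_sinX 1) dF) cospi cos0; ring.
Qed.

(** Gauss' product at 1/2 without its factor n^(1/2). *)
Let q n : R := \prod_(i < n.+1) (1 / 2 + i%:R) / n`!%:R.

Let q_gt0 n : 0 < q n.
Proof.
rewrite divr_gt0 ?ltr0n ?fact_gt0 // prodr_gt0 //.
Qed.

Let q_rec n : q n.+1 = q n * (n%:R + 3 / 2) / n.+1%:R.
Proof.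
rewrite /q big_ord_recr /= factS natrM.
have nf : n`!%:R != 0 :> R by rewrite pnatr_eq0 -lt0n fact_gt0.
have n1 : 1 + n%:R != 0 :> R by rewrite nat1r pnatr_eq0.
by field; rewrite nf n1.
Qed.

Let W_even n : W n.*2.+2 = pi * q n / n.+1%:R.
Proof.
have n2 : n.+1%:R != 0 :> R by rewrite pnatr_eq0.
elim: n n2 => [|n IH] n2.
  apply: (@mulfI _ 2); first by rewrite pnatr_eq0.
  by rewrite (W_rec 0) W0 /q big_ord_recr big_ord0 /= fact0; field.
have h : n.*2.+4%:R != 0 :> R by rewrite pnatr_eq0.
apply: (mulfI h); rewrite (W_rec n.*2.+2) IH ?pnatr_eq0 // q_rec.
have -> : n.*2.+3%:R = 2 * n%:R + 3 :> R by rewrite -muln2 mulnC; ring.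
have -> : n.*2.+4%:R = 2 * n%:R + 4 :> R by rewrite -muln2 mulnC; ring.
have h1 : 1 + n%:R != 0 :> R by rewrite nat1r pnatr_eq0.
have h2 : 2 + n%:R != 0 :> R by rewrite -natrD pnatr_eq0.
by field; rewrite h1 h2.
Qed.

Let W_odd n : W n.*2.+1 = (q n)^-1.
Proof.
have n2 : n.+1%:R != 0 :> R by rewrite pnatr_eq0.
elim: n n2 => [|n IH] n2.
  by rewrite W1 /q big_ord_recr big_ord0 /= fact0; field.
have h : n.*2.+3%:R != 0 :> R by rewrite pnatr_eq0.
apply: (mulfI h); rewrite (W_rec n.*2.+1) IH ?pnatr_eq0 // q_rec.
have -> : n.*2.+2%:R = 2 * n%:R + 2 :> R by rewrite -muln2 mulnC; ring.
have -> : n.*2.+3%:R = 2 * n%:R + 3 :> R by rewrite -muln2 mulnC; ring.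
have h1 : 1 + n%:R != 0 :> R by rewrite nat1r pnatr_eq0.
have h2 : n%:R * 2 + 3 != 0 :> R by rewrite gt_eqF // ltr_wpDl // mulr_ge0.
have h3 : q n != 0 by rewrite gt_eqF.
by field; rewrite h1 h2 h3.
Qed.

(** Even and odd Wallis integrals are pi q_n / (n + 1) and 1 / q_n. As they decrease with the
    exponent, q_n^2 lies between (n + 1/2) / pi and (n + 1) / pi, so q_n^2 / n tends to 1 / pi. *)
Lemma rgamma_half : cvgn (gauss_prod (1 / 2)) /\ rgamma (1 / 2 : R) = Num.sqrt (pi^-1).
Proof.
have pi0 := pi_gt0 R.
suff c : gauss_prod (1 / 2) @ \oo --> Num.sqrt (pi^-1 : R).
  by split; [apply/cvg_ex; exists (Num.sqrt pi^-1) | exact/cvg_lim].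
apply: (@cvg_trans _ (Num.sqrt (q n ^+ 2 / n%:R) @[n --> \oo])).
  apply: near_eq_cvg; near=> n.
  have n0 : (0 < n)%N by near: n; exact: nbhs_infty_gt.
  rewrite /gauss_prod.
  have -> : n%:R `^ (1 / 2) = Num.sqrt n%:R :> R by rewrite mul1r powR12_sqrt.
  rewrite invfM mulrA -/(q n).
  by rewrite sqrtrM ?sqr_ge0 // sqrtr_sqr gtr0_norm // sqrtrV // ler0n.
apply: continuous_cvg; first exact: sqrt_continuous.
have qle n : q n ^+ 2 <= n.+1%:R / pi.
  have := W_le n.*2.+1; rewrite W_even W_odd.
  rewrite ler_pdivrMr ?ltr0n // [leRHS]mulrC ler_pdivlMr ?q_gt0 //.
  by rewrite -mulrA -expr2 mulrC -ler_pdivlMr.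
have qge n : (n%:R + 1 / 2) / pi <= q n ^+ 2.
  case: n => [|n].
    rewrite add0r /q big_ord_recr big_ord0 /= fact0 !mul1r addr0 divr1.
    rewrite expr2 ler_wpM2l ?invr_ge0 //; rewrite lef_pV2 ?posrE //; exact: pi_ge2.
  have := W_le n.*2.+2; rewrite -doubleS W_even W_odd.
  have -> : pi * q n / n.+1%:R = pi * q n.+1 / (n.+1%:R + 1 / 2).
    rewrite q_rec.
    have h1 : 1 + n%:R != 0 :> R by rewrite nat1r pnatr_eq0.
    by field; rewrite h1 andbT gt_eqF // ltr_wpDl // mulr_ge0 // addr_ge0.
  have h3 : 0 < n.+1%:R + 1 / 2 :> R by rewrite ltr_wpDl // divr_gt0.
  rewrite ler_pdivlMr // [leLHS]mulrC ler_pdivrMr ?q_gt0 //.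
  by rewrite -mulrA -expr2 [_ * q _ ^+ 2]mulrC -ler_pdivrMr.
apply: (@squeeze_cvgr _ _ _ _ (fun _ => pi^-1) (fun n => (1 + n%:R^-1) / pi)).
- near=> n; have n0 : 0 < n%:R :> R by rewrite ltr0n; near: n; exact: nbhs_infty_gt.
  apply/andP; split.
    rewrite ler_pdivlMr // mulrC; apply: le_trans (qge n).
    by rewrite ler_wpM2r ?invr_ge0 ?pi_ge0 // lerDl divr_ge0.
  rewrite ler_pdivrMr //; apply: le_trans (qle n) _.
  by rewrite mulrAC ler_wpM2r ?invr_ge0 ?pi_ge0 // mulrDl mulVf ?gt_eqF // mul1r natr1.
- exact: cvg_cst.
- have h : (n%:R^-1 : R) @[n --> \oo] --> (0 : R).
    by rewrite -(cvg_shiftS (fun n : nat => n%:R^-1 : R)); exact: cvg_harmonic.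
  have : (1 + n%:R^-1) / pi @[n --> \oo] --> ((1 + 0) / pi : R).
    by apply: cvgMl; apply: cvgD; [exact: cvg_cst | exact: h].
  by rewrite addr0 mul1r.
Unshelve. all: by end_near. Qed.

End ReciprocalGamma.

(** * Ferrers functions of integer degree and order *)

Section FerrersInteger.
Variable R : realType.
Implicit Types (l m n k : nat) (x z : R).

Lemma pochhammerS (a : R) n : pochhammer a n.+1 = pochhammer a n * (a + n%:R).
Proof. by rewrite /pochhammer big_ord_recr. Qed.

Lemma pochhammer0 (a : R) : pochhammer a 0 = 1.
Proof. by rewrite /pochhammer big_ord0. Qed.

Lemma pochhammer_npos l n : (l < n)%N -> pochhammer (- l%:R : R) n = 0.
Proof.
elim: n => // n IH; rewrite ltnS leq_eqVlt => /orP[/eqP <-|/IH E].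
  by rewrite pochhammerS addNr mulr0.
by rewrite pochhammerS E mul0r.
Qed.

Lemma lim_series_fin (f : nat -> R) N :
  (forall n, (N <= n)%N -> f n = 0) -> limn (series f) = \sum_(n < N) f n.
Proof.
move=> f0; apply: cvg_lim => //.
apply: (@cvg_trans _ ((fun=> \sum_(n < N) f n) @ \oo)); last exact: cvg_cst.
apply: near_eq_cvg; near=> n.
have Nn : (N <= n)%N by near: n; exact: nbhs_infty_ge.
rewrite /series /= -(big_mkord xpredT f) (big_cat_nat (leq0n N) Nn) /= [X in _ + X]big1_seq ?addr0 //.
by move=> i; rewrite mem_index_iota => /andP[_ /andP[Ni _]]; exact: f0.
Unshelve. all: by end_near. Qed.

Let A l n : R := pochhammer (l%:R + 1) n * pochhammer (- l%:R) n.

Let A_gt l n : (l < n)%N -> A l n = 0.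
Proof. by move=> ln; rewrite /A pochhammer_npos // mulr0. Qed.

Lemma reg_hyp2F1_legendre l c z :
  reg_hyp2F1 (l%:R + 1) (- l%:R) c z =
  \sum_(n < l.+1) A l n * rgamma (c + n%:R) / n`!%:R * z ^+ n.
Proof.
apply: lim_series_fin => n ln.
by rewrite -/(A l n) A_gt // !mul0r.
Qed.

(** At x = 1 the leading coefficient of the differentiated Legendre equation vanishes, leaving a
    two-term recursion for the successive derivatives, which is that of the Pochhammer products. *)
Lemma dlegendre_at1 l n : dlegendre l n (1 : R) = A l n * (- 1 / 2) ^+ n / n`!%:R.
Proof.
elim: n => [|n IH].
  rewrite /A !pochhammer0 expr0 fact0 !mul1r invr1.
  suff : (legendre R l).[1] = 1 /\ (legendre R l.+1).[1] = 1 by case.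
  elim: l => [|l [IH1 IH2]].
    by rewrite legendre0 legendre1 hornerC hornerX.
  split=> //; have := @dlegendre_rec R l.+1 0 1.
  rewrite /dlegendre !derivn0 subr0 addn0 /= IH1 IH2 => E.
  have l2 : l.+1%:R + 1 != 0 :> R by rewrite natr1 pnatr_eq0.
  apply: (mulfI l2); have -> : (l.+1%:R + 1) * (legendre R l.+2).[1] =
    (2 * l.+1%:R + 1) * 1 * 1 - l.+1%:R * 1 by rewrite E; ring.
  ring.
have := @dlegendre_ode R l n 1.
rewrite expr1n subrr mul0r mulr1 => /esym/eqP; rewrite subr_eq0 => /eqP E.
have n1 : n.+1%:R != 0 :> R by rewrite pnatr_eq0.
have nf : n`!%:R != 0 :> R by rewrite pnatr_eq0 -lt0n fact_gt0.
have n2 : 2 * n.+1%:R != 0 :> R by rewrite mulf_neq0 // pnatr_eq0.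
apply: (mulfI n2); rewrite E IH /A !pochhammerS factS natrM exprS natrD -natr1.
by field; rewrite nf natr1 n1.
Qed.

Lemma dlegendre_taylor l m z :
  dlegendre l m (1 - 2 * z) =
  (- 1 / 2) ^+ m * \sum_(j < l.+1) A l (m + j) / ((m + j)`!%:R * j`!%:R) * z ^+ j.
Proof.
rewrite /dlegendre nderiv_taylor; last exact: mulrC.
set p := (legendre R l)^`(m).
have cE j : p^`N(j).[1] = A l (m + j) * (- 1 / 2) ^+ (m + j) / ((m + j)`!%:R * j`!%:R).
  have := nderivn_def j p.
  rewrite /p (_ : (legendre R l)^`(m)^`(j) = (legendre R l)^`(m + j)); last first.
    by rewrite addnC /derivn iterD.
  move=> /(congr1 (fun q => q.[1])).
  rewrite hornerMn -/(dlegendre l (m + j) 1) dlegendre_at1 => E.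
  have jf : j`!%:R != 0 :> R by rewrite pnatr_eq0 -lt0n fact_gt0.
  apply: (mulIf jf); transitivity (p^`N(j).[1] *+ j`!); first by rewrite mulr_natr.
  rewrite -E.
  have mf : (m + j)`!%:R != 0 :> R by rewrite pnatr_eq0 -lt0n fact_gt0.
  by field; rewrite mf jf.
(* Taylor's formula sums up to [size p], the hypergeometric sum up to [l]; both are padded with
   zeros to a common length. *)
have tE N : (forall j, (N <= j)%N -> p^`N(j).[1] = 0) -> (N <= maxn (size p) l.+1)%N ->
    \sum_(i < N) p^`N(i).[1] * (- (2 * z)) ^+ i =
    \sum_(i < maxn (size p) l.+1) p^`N(i).[1] * (- (2 * z)) ^+ i.
  move=> h Nm; rewrite -!(big_mkord xpredT (fun i => p^`N(i).[1] * (- (2 * z)) ^+ i)).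
  rewrite [RHS](big_cat_nat (leq0n N) Nm) /= [X in _ + X]big1_seq ?addr0 //.
  by move=> i; rewrite mem_index_iota => /andP[_ /andP[Ni _]]; rewrite h // mul0r.
rewrite (tE (size p)) ?leq_maxl //; last first.
  by move=> j sj; rewrite nderivn_poly0 // horner0.
rewrite -(tE l.+1) ?leq_maxr //; last first.
  by move=> j lj; rewrite cE A_gt ?mul0r // (leq_trans lj) // leq_addl.
rewrite big_distrr /=; apply: eq_bigr => j _; rewrite cE exprD.
have -> : - (2 * z) = (-2) * z by ring.
rewrite [(-2 * z) ^+ j]exprMn.
have E : (- 1 / 2) ^+ j * (-2) ^+ j = 1 :> R.
  rewrite -exprMn; have -> : - 1 / 2 * - 2 = 1 :> R by field.
  by rewrite expr1n.
transitivity (A l (m + j) / ((m + j)`!%:R * j`!%:R) * (- 1 / 2) ^+ m * z ^+ j *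
   ((- 1 / 2) ^+ j * (-2) ^+ j)); first by ring.
by rewrite E; ring.
Qed.

(** 1 / Gamma(1 - m + n) vanishes for n < m, so the series starts at z^m, and what follows is the
    Taylor expansion of the m-th derivative at 1. For m > l both sides are zero. *)
Lemma reg_hyp2F1_legendre_pos l m z :
  reg_hyp2F1 (l%:R + 1) (- l%:R) (1 - m%:R) z = (-2 * z) ^+ m * dlegendre l m (1 - 2 * z).
Proof.
rewrite reg_hyp2F1_legendre dlegendre_taylor.
have E : (-2 * z) ^+ m * (- 1 / 2) ^+ m = z ^+ m.
  by rewrite -exprMn; congr (_ ^+ _); field.
rewrite mulrA E.
have [ml|lm] := leqP m l; last first.
  rewrite !big1 ?mulr0 // => i _.
    by rewrite A_gt ?mul0r // (leq_trans lm) // leq_addr.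
  have il : (i < m)%N := leq_trans (ltn_ord i) lm.
  have -> : 1 - m%:R + i%:R = - (m - i.+1)%:R :> R by rewrite natrB // -natr1; ring.
  by rewrite (rgamma_npos R _).2 mulr0 !mul0r.
rewrite -!(big_mkord xpredT (fun n => A l n * rgamma (1 - m%:R + n%:R) / n`!%:R * z ^+ n)).
rewrite (big_cat_nat (leq0n m) (leqW ml)) /= big1_seq ?add0r; last first.
  move=> i; rewrite mem_index_iota => /andP[_ /andP[_ im]].
  have -> : 1 - m%:R + i%:R = - (m - i.+1)%:R :> R by rewrite natrB // -natr1; ring.
  by rewrite (rgamma_npos R _).2 mulr0 !mul0r.
rewrite -{1}[m]add0n big_addn big_mkord.
have le : (l.+1 - m <= l.+1)%N by rewrite leq_subr.
rewrite -[in RHS](big_mkord xpredT (fun j => A l (m + j) / ((m + j)`!%:R * j`!%:R) * z ^+ j)).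
rewrite (big_cat_nat (leq0n _) le) /= [X in _ = _ * (_ + X)]big1_seq ?addr0; last first.
  move=> i; rewrite mem_index_iota => /andP[_ /andP[im _]].
  by rewrite A_gt ?mul0r // -leq_subLR.
rewrite big_mkord big_distrr /=; apply: eq_bigr => j _.
have -> : 1 - m%:R + (j + m)%:R = j.+1%:R :> R by rewrite natrD -natr1; ring.
rewrite (rgamma_nat R _).2 [(j + m)%N]addnC exprD.
have jf : j`!%:R != 0 :> R by rewrite pnatr_eq0 -lt0n fact_gt0.
have mf : (m + j)`!%:R != 0 :> R by rewrite pnatr_eq0 -lt0n fact_gt0.
by field; rewrite mf jf.
Qed.

(** Induction on m by integration: each side F_m satisfies (y^(m+1) F_(m+1))' = y^m F_m, and y^(m+1)
    F_(m+1) vanishes at 0. On the left this is read off the coefficients, on the right it is the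
    differentiated Legendre equation. *)
Lemma reg_hyp2F1_legendre_neg l m z : (m <= l)%N -> 0 < z <= 1 ->
  reg_hyp2F1 (l%:R + 1) (- l%:R) (1 + m%:R) z =
  (l - m)`!%:R / (l + m)`!%:R * (2 - 2 * z) ^+ m * dlegendre l m (1 - 2 * z).
Proof.
move=> ml /andP[z0 z1].
pose E k := \poly_(n < l.+1) (A l n / ((n + k)`!%:R * n`!%:R)).
pose fr k : R := (l - k)`!%:R / (l + k)`!%:R.
pose G k y := fr k * (2 - 2 * y) ^+ k * dlegendre l k (1 - 2 * y).
have -> : reg_hyp2F1 (l%:R + 1) (- l%:R) (1 + m%:R) z = (E m).[z].
  rewrite reg_hyp2F1_legendre /E horner_poly; apply: eq_bigr => i _.
  have -> : 1 + m%:R + i%:R = (i + m).+1%:R :> R by rewrite -natr1 natrD; ring.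
  rewrite (rgamma_nat R _).2 invfM; ring.
rewrite -/(fr m) -/(G m z).
suff : forall y, 0 < y <= 1 -> (E m).[y] = G m y by apply; rewrite z0.
elim: m ml => [|m IH] ml y /andP[y0 y1].
  rewrite /G /fr subn0 addn0 divff ?pnatr_eq0 -?lt0n ?fact_gt0 // expr0 !mul1r.
  rewrite dlegendre_taylor expr0 mul1r /E horner_poly; apply: eq_bigr => i _.
  by rewrite addn0 add0n.
have E' : ('X^(m.+1) * E m.+1)^`() = 'X^m * E m.
  apply/polyP => i; rewrite coef_deriv coefXnM coefXnM.
  rewrite ltnS; case: ltnP => mi; first by rewrite mul0rn.
  rewrite subSS !coef_poly; case: ifP => _; last by rewrite mul0rn.
  rewrite subnK // addnS subnK // factS natrM -mulr_natr.
  have jf : (i - m)`!%:R != 0 :> R by rewrite pnatr_eq0 -lt0n fact_gt0.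
  have mf : i`!%:R != 0 :> R by rewrite pnatr_eq0 -lt0n fact_gt0.
  have i1 : 1 + i%:R != 0 :> R by rewrite nat1r pnatr_eq0.
  by field; rewrite i1 jf mf.
have dG (t : R) : is_derive t 1 (fun t => t ^+ m.+1 * G m.+1 t) (t ^+ m * G m t).
  have h1 : is_derive t 1 (fun t : R => 1 - 2 * t) (-2).
    by apply: (isd_eq (isdB (isd_cst 1 t) (isdZ 2 (isd_id t)))); ring.
  have h2 : is_derive t 1 (fun t : R => 2 - 2 * t) (-2).
    by apply: (isd_eq (isdB (isd_cst 2 t) (isdZ 2 (isd_id t)))); ring.
  have h3 : is_derive t 1 (fun t : R => dlegendre l m.+1 (1 - 2 * t)) (dlegendre l m.+2 (1 - 2 * t) * -2).
    apply: (isd_comp h1); rewrite /dlegendre derivnS.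
    exact: is_derive_poly.
  apply: (isd_eq (isdM (isdX m.+1 (isd_id t)) (isdM (isdZ (fr m.+1) (isdX m.+1 h2)) h3))).
  rewrite /G /=.
  have ode := @dlegendre_ode R l m (1 - 2 * t).
  have frE : fr m = fr m.+1 * ((l + m.+1)%:R * (l%:R - m%:R)).
    rewrite /fr addnS factS natrM -(subnSK ml) factS natrM (subnSK ml) natrB; last exact: ltnW.
    have h : (l + m)`!%:R != 0 :> R by rewrite pnatr_eq0 -lt0n fact_gt0.
    have h' : (l + m).+1%:R != 0 :> R by rewrite pnatr_eq0.
    by field; rewrite h -natrD nat1r h'.
  rewrite frE.
  transitivity (t ^+ m * (2 - 2 * t) ^+ m * fr m.+1 *
     (2 * m.+1%:R * (1 - 2 * t) * dlegendre l m.+1 (1 - 2 * t)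
      - (1 - (1 - 2 * t) ^+ 2) * dlegendre l m.+2 (1 - 2 * t))).
    by rewrite !exprS; ring.
  by rewrite ode; ring.
have cG : continuous (fun t : R => t ^+ m.+1 * G m.+1 t) by move=> t; exact: isd_cvg (dG t).
have H : ('X^(m.+1) * E m.+1).[y] - ('X^(m.+1) * E m.+1).[0] =
    y ^+ m.+1 * G m.+1 y - 0 ^+ m.+1 * G m.+1 0.
  apply: (@eq_of_derive _ (horner ('X^(m.+1) * E m.+1)) (fun t => t ^+ m.+1 * G m.+1 t) (fun t => t ^+ m * G m t)).
  - exact: ltW.
  - exact/continuous_subspaceT/continuous_horner.
  - exact: continuous_subspaceT.
  - move=> t; rewrite in_itv /= => /andP[t0 ty].
    rewrite -IH ?(ltnW ml) ?t0 ?(le_trans (ltW ty)) //.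
    apply: (isd_eq (is_derive_poly _ _)).
    by rewrite E' hornerM hornerXn.
move: H; rewrite !hornerM !hornerXn !expr0n /= !mul0r !subr0.
have y0' : y ^+ m.+1 != 0 by rewrite expf_neq0 // gt_eqF.
by move=> H; apply: (mulfI y0').
Qed.

(** Here [y] is sin for x = cos. The sign (-1)^m is the Condon-Shortley phase contained in the
    hypergeometric definition. *)
Lemma ferrersP_nat l m x y : `|x| <= 1 -> 0 <= y -> y ^+ 2 = 1 - x ^+ 2 ->
  ferrersP l%:R m%:R x = (- y) ^+ m * dlegendre l m x.
Proof.
move=> x1 y0 yx; rewrite /ferrersP reg_hyp2F1_legendre_pos.
have -> : 1 - 2 * ((1 - x) / 2) = x by field.
have -> : -2 * ((1 - x) / 2) = - (1 - x) by field.
rewrite mulrA; congr (_ * _).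
case: m => [|m]; first by rewrite mul0r powRr0 !expr0 mulr1.
have m2 : m.+1%:R / 2 != 0 :> R by rewrite mulf_neq0 ?invr_eq0 ?pnatr_eq0.
(* At the poles both sides are 0 for m > 0: at x = 1 through the power of 1 - x, at x = -1 because
   the base of the real power is 0. *)
have [xe|xn] := eqVneq (x ^+ 2) 1.
  have -> : y = 0 by apply/eqP; rewrite -sqrf_eq0 yx xe subrr.
  rewrite oppr0 expr0n /=.
  have /orP[/eqP ->|/eqP ->] : (x == 1) || (x == -1) by rewrite -sqrf_eq1 xe.
    by rewrite subrr oppr0 expr0n mulr0.
  by rewrite subrr mul0r powR0 // mul0r.
have x21 : x ^+ 2 < 1 by rewrite lt_neqAle xn -real_normK ?num_real// expr_le1.
have : `|x| < 1 by rewrite -(@ltr_pXn2r _ 2) ?nnegrE// expr1n real_normK ?num_real.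
rewrite ltr_norml => /andP[xl xr].
have a0 : 0 < 1 - x by rewrite subr_gt0.
have b0 : 0 < 1 + x by rewrite -ltrBlDl sub0r.
have -> : ((1 + x) / (1 - x)) `^ (m.+1%:R / 2) = (y / (1 - x)) ^+ m.+1.
  rewrite [m.+1%:R / 2]mulrC powRrM powR12_sqrt ?divr_ge0 ?(ltW a0) ?(ltW b0) //.
  rewrite powR_mulrn ?sqrtr_ge0 //; congr (_ ^+ _).
  have -> : (1 + x) / (1 - x) = (y / (1 - x)) ^+ 2.
    by rewrite expr_div_n yx; field; rewrite gt_eqF.
  by rewrite sqrtr_sqr ger0_norm // divr_ge0 // ltW.
by rewrite -exprMn; congr (_ ^+ _); field; rewrite gt_eqF.
Qed.

Lemma ferrersP_negnat l m x y : (0 < m <= l)%N ->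
  `|x| <= 1 -> 0 <= y -> y ^+ 2 = 1 - x ^+ 2 ->
  ferrersP l%:R (- m%:R) x = (l - m)`!%:R / (l + m)`!%:R * y ^+ m * dlegendre l m x.
Proof.
move=> /andP[m0 ml] x1 y0 yx; rewrite /ferrersP opprK.
have m2 : m%:R / 2 != 0 :> R by rewrite mulf_neq0 ?invr_eq0 ?pnatr_eq0 -?lt0n.
have [xe|xn] := eqVneq (x ^+ 2) 1.
  have -> : y = 0 by apply/eqP; rewrite -sqrf_eq0 yx xe subrr.
  rewrite expr0n gtn_eqF //= mulr0 mul0r mulNr.
  have /orP[/eqP ->|/eqP ->] : (x == 1) || (x == -1) by rewrite -sqrf_eq1 xe.
    by rewrite subrr invr0 mulr0 powR0 ?mul0r // oppr_eq0.
  by rewrite subrr mul0r powR0 ?mul0r // oppr_eq0.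
have x21 : x ^+ 2 < 1 by rewrite lt_neqAle xn -real_normK ?num_real// expr_le1.
have : `|x| < 1 by rewrite -(@ltr_pXn2r _ 2) ?nnegrE// expr1n real_normK ?num_real.
rewrite ltr_norml => /andP[xl xr].
have a0 : 0 < 1 - x by rewrite subr_gt0.
have b0 : 0 < 1 + x by rewrite -ltrBlDl sub0r.
rewrite reg_hyp2F1_legendre_neg //; last first.
  by rewrite divr_gt0 //= ler_pdivrMr //; lra.
have -> : 1 - 2 * ((1 - x) / 2) = x by field.
have -> : 2 - 2 * ((1 - x) / 2) = 1 + x by field.
have -> : ((1 + x) / (1 - x)) `^ (- m%:R / 2) = (y / (1 + x)) ^+ m.
  rewrite mulNr powRN [m%:R / 2]mulrC powRrM powR12_sqrt ?divr_ge0 ?(ltW a0) ?(ltW b0) //.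
  rewrite powR_mulrn ?sqrtr_ge0 // -exprVn; congr (_ ^+ _).
  have -> : (1 + x) / (1 - x) = ((y / (1 + x)) ^+ 2)^-1.
    rewrite expr_div_n yx; field.
    have -> : 1 - x ^+ 2 = (1 - x) * (1 + x) by ring.
    by rewrite mulf_neq0 ?gt_eqF // .
  by rewrite sqrtrV ?sqr_ge0 // invrK sqrtr_sqr ger0_norm // divr_ge0 // ltW.
transitivity ((l - m)`!%:R / (l + m)`!%:R * ((y / (1 + x)) ^+ m * (1 + x) ^+ m)
  * dlegendre l m x); first by ring.
by rewrite -exprMn mulfVK // gt_eqF.
Qed.

End FerrersInteger.

(** * Power series on the unit disc *)

Section UnitDisc.
Variable R : realType.
Implicit Types (f g : nat -> R) (x z r : R) (n : nat).

(** Radius of convergence at least 1, phrased by boundedness of the terms: this form is visibly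
    stable under sums, multiplication by n and termwise differentiation. *)
Definition unit_radius f : Prop :=
  forall r, 0 <= r < 1 -> exists M, forall n, `|f n| * r ^+ n <= M.

Lemma cvg_unit_radius f z : unit_radius f -> `|z| < 1 -> cvgn (pseries f z).
Proof.
move=> fr z1; pose r := (1 + `|z|) / 2.
have z0 : 0 <= `|z| by [].
have r0 : 0 < r by rewrite /r; lra.
have zr : `|z| < r by rewrite /r; lra.
have r1 : r < 1 by rewrite /r; lra.
have [|M fM] := fr r; first by rewrite (ltW r0) r1.
apply: normed_cvg.
apply: (@series_le_cvg _ _ (geometric M (`|z| / r))) => [n|n|n|].
- exact: normr_ge0.
- rewrite /geometric /= mulr_ge0 ?exprn_ge0 ?divr_ge0 ?(ltW r0) //.
  by apply: le_trans (fM 0); rewrite mulr_ge0 // exprn_ge0 // ltW.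
- rewrite /geometric /= normrM normrX expr_div_n mulrA ler_pdivlMr ?exprn_gt0 //.
  by rewrite mulrAC ler_wpM2r ?exprn_ge0.
- apply: is_cvg_geometric_series.
  by rewrite ger0_norm ?divr_ge0 ?(ltW r0) // ltr_pdivrMr // mul1r.
Qed.

Lemma unit_radius_natM f : unit_radius f -> unit_radius (fun n => n%:R * f n).
Proof.
move=> fr r /andP[r0 r1]; pose q := (1 + r) / 2.
have q0 : 0 < q by rewrite /q; lra.
have q1 : q < 1 by rewrite /q; lra.
have rq : r < q by rewrite /q; lra.
have [|M fM] := fr q; first by rewrite (ltW q0) q1.
have M0 : 0 <= M by apply: le_trans (fM 0); rewrite mulr_ge0 // exprn_ge0 // ltW.
pose t := r / q.
have t0 : 0 <= t by rewrite divr_ge0 // ltW.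
have t1 : t < 1 by rewrite ltr_pdivrMr // mul1r.
(* Proved in the sharper form n t^n (1 - t) <= 1 - t^n, which passes through the induction. *)
have nt n : n%:R * t ^+ n <= (1 - t)^-1.
  rewrite -[leRHS]mul1r ler_pdivlMr ?subr_gt0 //.
  suff : n%:R * t ^+ n * (1 - t) <= 1 - t ^+ n.
    by move=> h; apply: le_trans h _; rewrite lerBlDr lerDl exprn_ge0.
  elim: n => [|n IH]; first by rewrite mul0r mul0r expr0 subrr.
  have tn1 : t ^+ n <= 1 by rewrite exprn_ile1 // ltW.
  have tn0 : 0 <= t ^+ n by rewrite exprn_ge0.
  have h1 : t * (n%:R * t ^+ n * (1 - t)) <= t * (1 - t ^+ n) by rewrite ler_wpM2l.
  have h2 : t * t ^+ n * (1 - t) <= 1 - t.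
    by rewrite ler_piMl ?subr_ge0 ?(ltW t1) // mulr_ile1 // ltW.
  rewrite -natr1 exprS.
  have -> : (n%:R + 1) * (t * t ^+ n) * (1 - t) =
     t * (n%:R * t ^+ n * (1 - t)) + t * t ^+ n * (1 - t) by ring.
  by apply: le_trans (lerD h1 h2) _; rewrite mulrBr mulr1; lra.
exists (M * (1 - t)^-1) => n.
rewrite normrM ger0_norm //.
have -> : r = q * t by rewrite /t mulrC mulfVK // gt_eqF.
rewrite exprMn.
have -> : n%:R * `|f n| * (q ^+ n * t ^+ n) = (`|f n| * q ^+ n) * (n%:R * t ^+ n) by ring.
by apply: ler_pM => //; rewrite mulr_ge0 // exprn_ge0 // ltW.
Qed.

Lemma unit_radiusD f g : unit_radius f -> unit_radius g -> unit_radius (fun n => f n + g n).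
Proof.
move=> fr gr r r01; have [M fM] := fr r r01; have [N gN] := gr r r01.
exists (M + N) => n; apply: le_trans (lerD (fM n) (gN n)).
by rewrite -mulrDl ler_wpM2r ?ler_normD // exprn_ge0 //; case/andP: r01.
Qed.

Lemma unit_radius_le c f g : (forall n, `|g n| <= c * `|f n|) ->
  unit_radius f -> unit_radius g.
Proof.
move=> gf fr r r01; have [M fM] := fr r r01; have r0 : 0 <= r by case/andP: r01.
exists (`|c| * M) => n.
apply: (@le_trans _ _ (`|c| * (`|f n| * r ^+ n))); last by rewrite ler_wpM2l.
rewrite mulrA ler_wpM2r ?exprn_ge0 //; apply: le_trans (gf n) _.
by rewrite ler_wpM2r // ler_norm.
Qed.

Lemma unit_radiusZ c f : unit_radius f -> unit_radius (fun n => c * f n).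
Proof. by apply: (@unit_radius_le `|c|) => n; rewrite normrM. Qed.

Lemma unit_radius_diffs f : unit_radius f -> unit_radius (pseries_diffs f).
Proof.
move=> /unit_radius_natM fr r /andP[r0 r1]; pose q := (1 + r) / 2.
have q0 : 0 < q by rewrite /q; lra.
have rq : r <= q by rewrite /q; lra.
have [|M fM] := fr q; first by rewrite (ltW q0) /q; lra.
exists (M / q) => n; rewrite ler_pdivlMr // -mulrA.
apply: le_trans (fM n.+1); rewrite /pseries_diffs ler_wpM2l // exprSr.
by rewrite ler_wpM2r ?(ltW q0) // lerXn2r ?nnegrE // ltW.
Qed.

Definition psum f z : R := limn (pseries f z).

Lemma is_derive_psum f z : unit_radius f -> `|z| < 1 ->
  is_derive z 1 (psum f) (psum (pseries_diffs f) z).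
Proof.
move=> fr z1; pose r := (1 + `|z|) / 2.
have z0 : 0 <= `|z| by [].
have r0 : 0 < r by rewrite /r; lra.
have r1 : `|r| < 1 by rewrite gtr0_norm // /r; lra.
have zr : `|z| < `|r| by rewrite (gtr0_norm r0) /r; lra.
apply: (@pseries_snd_diffs R f r) => //; apply: cvg_unit_radius => //.
- exact: unit_radius_diffs.
- exact/unit_radius_diffs/unit_radius_diffs.
Qed.

Lemma psumD f g z : unit_radius f -> unit_radius g -> `|z| < 1 ->
  psum (fun n => f n + g n) z = psum f z + psum g z.
Proof.
move=> fr gr z1; apply: cvg_lim => //.
have -> : pseries (fun n => f n + g n) z = (pseries f z \+ pseries g z).
  apply/funext => n; rewrite /pseries /series /= -big_split /=.
  by apply: eq_bigr => i _; rewrite mulrDl.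
by apply: cvgD; exact: cvg_unit_radius.
Qed.

Lemma psumZ c f z : unit_radius f -> `|z| < 1 ->
  psum (fun n => c * f n) z = c * psum f z.
Proof.
move=> fr z1; apply: cvg_lim => //.
have -> : pseries (fun n => c * f n) z = (fun n => c * pseries f z n).
  apply/funext => n; rewrite /pseries /series /= big_distrr /=.
  by apply: eq_bigr => i _; rewrite mulrA.
by apply: cvgMr; exact: cvg_unit_radius.
Qed.

Lemma psum_natM f z : unit_radius f -> `|z| < 1 ->
  psum (fun n => n%:R * f n) z = z * psum (pseries_diffs f) z.
Proof.
move=> fr z1; apply: cvg_lim => //.
rewrite -(cvg_shiftS (pseries (fun n => n%:R * f n) z)).
have -> : (fun n => pseries (fun n => n%:R * f n) z n.+1) =
    (fun n => z * pseries (pseries_diffs f) z n).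
  apply/funext => n; rewrite /pseries /series /= big_nat_recl //= mul0r mul0r add0r.
  by rewrite big_distrr /=; apply: eq_bigr => i _; rewrite /pseries_diffs exprS; ring.
by apply: cvgMr; apply: cvg_unit_radius => //; exact: unit_radius_diffs.
Qed.

Lemma psum0 f : psum f 0 = f 0.
Proof.
rewrite /psum /pseries (@lim_series_fin R _ 1).
  by rewrite big_ord_recr big_ord0 /= expr0 mulr1 add0r.
by move=> [|n] // _; rewrite /= expr0n mulr0.
Qed.

End UnitDisc.

(** * The functions 2F1(3/2, -1/2; c; z) with half-integer c *)

Section HalfDegree.
Variable R : realType.
Implicit Types (x z s : R) (n l : nat) (k : int).

(* Ferrers functions of degree 1/2 only involve [c] in the half-integers. *)
Definition halfint k : R := k%:~R + 1 / 2.

Lemma halfintS k : halfint (k + 1) = halfint k + 1.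
Proof. by rewrite /halfint intrD; ring. Qed.

Lemma halfint_neq0 k : halfint k != 0.
Proof.
have E : (2 * k + 1)%:~R = 2 * halfint k :> R.
  by rewrite intrD intrM /halfint; field.
have : 2 * halfint k != 0 by rewrite -E intr_eq0; lia.
by rewrite mulf_eq0 negb_or => /andP[].
Qed.

(** All half-integers are reached from 1/2; the upward steps divide by a half-integer, never zero
    because its double is odd. *)
Lemma rgamma_halfint k : cvgn (gauss_prod (halfint k)) /\
  rgamma (halfint k) = halfint k * rgamma (halfint (k + 1)).
Proof.
have c k' : cvgn (gauss_prod (halfint k')).
  have h0 : cvgn (gauss_prod (halfint 0)) by rewrite /halfint add0r; exact: (rgamma_half R).1.
  elim: k' => [//|n IH|n IH].
    by rewrite intS addrC halfintS; apply: cvg_gauss_prodS => //; exact: halfint_neq0.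
  have : cvgn (gauss_prod (halfint (- n.+1%:Z) + 1)).
    rewrite -halfintS; have -> : - n.+1%:Z + 1 = - n%:Z by lia.
    exact: IH.
  by move/rgammaS => [].
split; first exact: c.
by rewrite halfintS; apply: (rgammaS _).2; rewrite -halfintS; exact: c.
Qed.

Lemma rgamma_half_gt0 n : 0 < rgamma (halfint n%:Z).
Proof.
elim: n => [|n IH].
  rewrite /halfint add0r (rgamma_half R).2 sqrtr_gt0 invr_gt0; exact: pi_gt0.
move: IH; rewrite (rgamma_halfint n%:Z).2 pmulr_rgt0; last first.
  by rewrite /halfint ltr_wpDl // ?ler0z // divr_gt0.
by rewrite -PoszD addn1.
Qed.

(* Coefficients of the regularized 2F1(3/2, -1/2; k + 1/2; z). *)
Definition hyp_coef k n : R :=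
  pochhammer (1 / 2 + 1) n * pochhammer (- (1 / 2)) n * rgamma (halfint k + n%:R) / n`!%:R.

Lemma reg_hyp2F1_psum k z :
  reg_hyp2F1 (1 / 2 + 1) (- (1 / 2)) (halfint k) z = psum (hyp_coef k) z.
Proof. by []. Qed.

Lemma halfintDn k n : halfint k + n%:R = halfint (k + n%:Z).
Proof. by rewrite /halfint intrD; ring. Qed.

Lemma hyp_coef_down k n : hyp_coef k n = (halfint k + n%:R) * hyp_coef (k + 1) n.
Proof.
rewrite /hyp_coef !halfintDn (rgamma_halfint (k + n%:Z)).2.
have -> : k + 1 + n%:Z = k + n%:Z + 1 by lia.
ring.
Qed.

Lemma hyp_coef_succ k n : n.+1%:R * hyp_coef k n.+1 =
  (n%:R + 3 / 2) * (n%:R - 1 / 2) * hyp_coef (k + 1) n.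
Proof.
rewrite /hyp_coef !pochhammerS factS natrM halfintS.
have -> : halfint k + n.+1%:R = halfint k + 1 + n%:R by ring.
have nf : n`!%:R != 0 :> R by rewrite pnatr_eq0 -lt0n fact_gt0.
have n1 : 1 + n%:R != 0 :> R by rewrite nat1r pnatr_eq0.
by field; rewrite nf n1.
Qed.

(** At c = 3/2 the upper parameter 3/2 cancels against c, leaving a binomial series. *)
Lemma hyp_coef1E n : hyp_coef 1 n = rgamma (halfint 1) * pochhammer (- (1 / 2)) n / n`!%:R.
Proof.
rewrite /hyp_coef; congr (_ / _).
rewrite mulrAC; congr (_ * _).
elim: n => [|n IH]; first by rewrite pochhammer0 mul1r addr0.
rewrite -IH pochhammerS !halfintDn (rgamma_halfint (1 + n%:Z)).2.
have -> : 1 + n%:Z + 1 = 1 + n.+1%:Z by lia.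
have -> : halfint (1 + n%:Z) = 1 / 2 + 1 + n%:R by rewrite /halfint intrD; ring.
ring.
Qed.

(** At [k = 1] the coefficients are bounded. Lowering k multiplies them by an affine function of n;
    raising it divides them by a number at least 1. *)
Lemma unit_radius_hyp_coef k : unit_radius (hyp_coef k).
Proof.
have p1 n : `|pochhammer (- (1 / 2)) n / n`!%:R| <= 1 :> R.
  elim: n => [|n IH]; first by rewrite pochhammer0 fact0 divr1 normr1.
  rewrite pochhammerS factS natrM.
  have -> : pochhammer (- (1 / 2)) n * (- (1 / 2) + n%:R) / (n.+1%:R * n`!%:R) =
    pochhammer (- (1 / 2)) n / n`!%:R * ((n%:R - 1 / 2) / n.+1%:R) :> R.
    have nf : n`!%:R != 0 :> R by rewrite pnatr_eq0 -lt0n fact_gt0.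
    have n1 : 1 + n%:R != 0 :> R by rewrite nat1r pnatr_eq0.
    by field; rewrite nf n1.
  rewrite normrM mulr_ile1 // normrM normfV (@ger0_norm _ n.+1%:R) // ler_pdivrMr ?ltr0n //.
  have n0 : 0 <= n%:R :> R by [].
  by rewrite mul1r ler_norml -natr1; lra.
have r1 : unit_radius (hyp_coef 1).
  move=> r /andP[r0 r1]; exists `|rgamma (halfint 1)| => n.
  rewrite hyp_coef1E -mulrA normrM -[leRHS]mulr1 -mulrA ler_wpM2l //.
  by rewrite mulr_ile1 ?exprn_ge0 ?exprn_ile1 // ltW.
have up k' : unit_radius (hyp_coef (k' + 1)) -> unit_radius (hyp_coef k').
  move=> h; have -> : hyp_coef k' = (fun n => halfint k' * hyp_coef (k' + 1) n + n%:R * hyp_coef (k' + 1) n).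
    by apply/funext => n; rewrite hyp_coef_down mulrDl.
  by apply: unit_radiusD; [exact: unit_radiusZ|exact: unit_radius_natM].
have dn n : unit_radius (hyp_coef (1 + n%:Z)).
  elim: n => [|n IH]; first by rewrite addr0.
  apply: (@unit_radius_le _ 1) IH => i; rewrite mul1r.
  have -> : 1 + n.+1%:Z = 1 + n%:Z + 1 by lia.
  rewrite (hyp_coef_down (1 + n%:Z)) [leRHS]normrM ler_peMl //.
  have h : 1 <= halfint (1 + n%:Z) + i%:R.
    rewrite /halfint intrD -pmulrn.
    by have := ler0n R n; have := ler0n R i; lra.
  by rewrite ger0_norm // (le_trans _ h).
have un n : unit_radius (hyp_coef (1 - n%:Z)).
  elim: n => [|n IH]; first by rewrite subr0.
  by apply: up; have -> : 1 - n.+1%:Z + 1 = 1 - n%:Z by lia.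
have -> : k = 1 + (k - 1) by lia.
by case: (k - 1) => n; [exact: dn | rewrite NegzE; exact: un].
Qed.

Definition hypF k z : R := psum (hyp_coef k) z.
Definition dhypF k z : R := psum (pseries_diffs (hyp_coef k)) z.

Lemma is_derive_hypF k z : `|z| < 1 -> is_derive z 1 (hypF k) (dhypF k z).
Proof. by move=> z1; apply: is_derive_psum => //; exact: unit_radius_hyp_coef. Qed.

Lemma hypF_lower k z : `|z| < 1 ->
  z * dhypF (k + 1) z + halfint k * hypF (k + 1) z = hypF k z.
Proof.
move=> z1; have u := unit_radius_hyp_coef.
rewrite /dhypF /hypF -psum_natM // -psumZ // -psumD //.
- by congr (psum _ _); apply/funext => n; rewrite (hyp_coef_down k); ring.
- exact: unit_radius_natM.
- exact: unit_radiusZ.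
Qed.

(** Comparison of coefficients; the factor on the right is (c - a)(c - b) for a = 3/2, b = -1/2, c =
    [halfint k]. *)
Lemma hypF_raise k z : `|z| < 1 ->
  (1 - z) * dhypF k z + (halfint k - 1) * hypF k z =
  (halfint k - 3 / 2) * (halfint k + 1 / 2) * hypF (k + 1) z.
Proof.
move=> z1; have u := unit_radius_hyp_coef.
have u1 := unit_radius_natM (u k); have u2 := unit_radius_diffs (u k).
have u3 : unit_radius (fun n => -1 * (n%:R * hyp_coef k n)) by exact: unit_radiusZ.
have u4 : unit_radius (fun n => (halfint k - 1) * hyp_coef k n) by exact: unit_radiusZ.
transitivity (psum (fun n => pseries_diffs (hyp_coef k) n +
    (-1 * (n%:R * hyp_coef k n) + (halfint k - 1) * hyp_coef k n)) z).
  rewrite psumD //; last exact: unit_radiusD.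
  by rewrite psumD // !psumZ // psum_natM // /dhypF /hypF; ring.
rewrite /hypF -psumZ //; congr (psum _ _); apply/funext => n.
by rewrite /pseries_diffs hyp_coef_succ (hyp_coef_down k); field.
Qed.

End HalfDegree.

(** * Radial solutions *)

Section Radial.
Variable R : realType.
Implicit Types (x z s r : R) (n l : nat) (k : int).

Lemma halfint1 : halfint R 1 = 3 / 2.
Proof. by rewrite /halfint; field. Qed.

Lemma halfint_nat l : halfint R l%:Z = l%:R + 1 / 2.
Proof. by rewrite /halfint -pmulrn. Qed.

(** At c = 3/2 the right side of [hypF_raise] vanishes, which leaves (1 - z) F' + F / 2 = 0; the
    quotient of F by sqrt (1 - z) is then constant. *)
Lemma hypF1 z : 0 <= z < 1 -> hypF 1 z = rgamma (3 / 2) * Num.sqrt (1 - z).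
Proof.
move=> /andP[z0 z1].
pose f t := hypF 1 t / Num.sqrt (1 - t) : R.
have df (t : R) : 0 <= t < 1 -> is_derive t 1 f 0.
  move=> /andP[t0 t1].
  have tn : `|t| < 1 by rewrite ger0_norm.
  have p : 0 < 1 - t by rewrite subr_gt0.
  have sn : Num.sqrt (1 - t) != 0 by rewrite sqrtr_eq0 -ltNge.
  have h1 : is_derive t 1 (fun t : R => 1 - t) (-1).
    by apply: (isd_eq (isdB (isd_cst 1 t) (isd_id t))); ring.
  apply: (isd_eq (isdM (is_derive_hypF 1 tn) (isdV (isd_sqrt h1 p) sn))).
  have := hypF_raise 1 tn; rewrite halfint1 => E.
  have sE : 1 - t = Num.sqrt (1 - t) ^+ 2 by rewrite sqr_sqrtr // ltW.
  rewrite subrr mul0r mul0r in E.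
  apply: (mulfI (_ : (1 - t) != 0)); first by rewrite gt_eqF.
  transitivity (((1 - t) * dhypF 1 t + (3 / 2 - 1) * hypF 1 t) / Num.sqrt (1 - t)
     - hypF 1 t / (2 * Num.sqrt (1 - t)) * (1 - (1 - t) / Num.sqrt (1 - t) ^+ 2)).
    by field.
  rewrite E -sE divff ?gt_eqF //; ring.
have cf : {within `[0, z], continuous f}.
  apply: derivable_within_continuous => t; rewrite in_itv /= => /andP[t0 tz].
  have h : 0 <= t < 1 by rewrite t0 (le_lt_trans tz).
  by have [] := df t h.
have H : f z - f 0 = 0 - 0.
  apply: (@eq_of_derive _ f (fun=> 0) (fun=> 0) 0 z) => //.
  - by move=> t; exact: cvg_cst.
  - move=> t; rewrite in_itv /= => /andP[t0 tz]; apply: df.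
    by rewrite ltW // (lt_trans tz).
have f0 : f 0 = rgamma (3 / 2).
  rewrite /f subr0 sqrtr1 divr1 /hypF psum0 /hyp_coef !pochhammer0 fact0 addr0 halfint1.
  by rewrite !mul1r invr1 mulr1.
have sn : Num.sqrt (1 - z) != 0 by rewrite sqrtr_eq0 -ltNge subr_gt0.
have : f z = rgamma (3 / 2) by rewrite -f0; apply/eqP; rewrite -subr_eq0 H subrr.
by move=> <-; rewrite /f mulfVK.
Qed.

Let g l := rgamma (halfint R l.+1%:Z).

Let g_gt0 l : 0 < g l. Proof. exact: rgamma_half_gt0. Qed.

Let gE l : g l = (l%:R + 3 / 2) * g l.+1.
Proof.
rewrite /g (rgamma_halfint R l.+1%:Z).2 halfint_nat -PoszD addn1.
by congr (_ * _); rewrite -natr1; field.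
Qed.

(* 2F1(3/2, -1/2; l + 3/2; z), not regularized *)
Definition Phi l z : R := hypF l.+1%:Z z / rgamma (halfint R l.+1%:Z).
Definition dPhi l z : R := dhypF l.+1%:Z z / rgamma (halfint R l.+1%:Z).
(** l (l + 2) is (c - a)(c - b) at c = l + 3/2; the denominator comes from normalizing [Phi] to 1 at
    0. *)
Definition Kcoef l : R := l%:R * (l%:R + 2) / (l%:R + 3 / 2).

Lemma is_derive_Phi l z : `|z| < 1 -> is_derive z 1 (Phi l) (dPhi l z).
Proof.
move=> z1; rewrite /dPhi mulrC; have h := isdZ (g l)^-1 (is_derive_hypF l.+1%:Z z1).
have -> : Phi l = (fun y => (g l)^-1 * hypF l.+1%:Z y) by apply/funext => y; rewrite mulrC.
exact: h.
Qed.

Lemma Phi_lower l z : `|z| < 1 ->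
  z * dPhi l.+1 z = (l%:R + 3 / 2) * (Phi l z - Phi l.+1 z).
Proof.
move=> z1; have := hypF_lower l.+1%:Z z1.
rewrite -PoszD addn1 halfint_nat => E.
rewrite /dPhi /Phi -!/(g _) -E (gE l).
have g0 : g l.+1 != 0 by rewrite gt_eqF.
have l0 : l%:R + 3 / 2 != 0 :> R by rewrite gt_eqF // ltr_wpDl // divr_gt0.
have l0' : l%:R * 2 + 3 != 0 :> R by rewrite gt_eqF // ltr_wpDl // mulr_ge0.
by field; rewrite g0 l0'.
Qed.

Lemma Phi_raise l z : `|z| < 1 ->
  (1 - z) * dPhi l z = Kcoef l * Phi l.+1 z - (l%:R + 1 / 2) * Phi l z.
Proof.
move=> z1; have := hypF_raise l.+1%:Z z1.
rewrite -PoszD addn1 halfint_nat => E.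
rewrite /dPhi /Phi /Kcoef -!/(g _) (gE l).
have g0 : g l.+1 != 0 by rewrite gt_eqF.
have l0' : l%:R * 2 + 3 != 0 :> R by rewrite gt_eqF // ltr_wpDl // mulr_ge0.
have -> : (1 - z) * (dhypF l.+1 z / ((l%:R + 3 / 2) * g l.+1)) =
  ((l.+1%:R + 1 / 2 - 3 / 2) * (l.+1%:R + 1 / 2 + 1 / 2) * hypF l.+2 z
   - (l.+1%:R + 1 / 2 - 1) * hypF l.+1 z) / ((l%:R + 3 / 2) * g l.+1).
  rewrite -E; move: (dhypF _ z) (hypF _ z) (g l.+1) g0 {E} => A B C g0.
  by field; rewrite g0 l0'.
move: (hypF l.+2 z) (hypF l.+1 z) (g l.+1) g0 {E} => A B C g0.
by field; rewrite g0 l0'.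
Qed.

Let e l n := hyp_coef R l.+1%:Z n / g l.

Let e0 l : e l 0 = 1.
Proof.
rewrite /e /hyp_coef !pochhammer0 fact0 addr0 !mul1r invr1 mulr1 divff // gt_eqF //.
exact: g_gt0.
Qed.

Let eS l n : e l n.+1 =
  e l n * ((n%:R + 3 / 2) * (n%:R - 1 / 2) / ((l%:R + 3 / 2 + n%:R) * n.+1%:R)).
Proof.
have g0 : g l != 0 by rewrite gt_eqF // g_gt0.
have n1 : n.+1%:R != 0 :> R by rewrite pnatr_eq0.
have h : l%:R + 3 / 2 + n%:R != 0 :> R.
  by rewrite gt_eqF // ltr_wpDr // ltr_wpDl // divr_gt0.
have hh : halfint R l.+1%:Z + n%:R = l%:R + 3 / 2 + n%:R.
  by rewrite halfint_nat; field.
rewrite /e; apply: (mulfI n1); rewrite mulrA hyp_coef_succ.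
rewrite (hyp_coef_down R l.+1%:Z) hh.
have h2 : l%:R * 2 + 3 + n%:R * 2 != 0 :> R.
  by rewrite gt_eqF // ltr_wpDr ?mulr_ge0 // ltr_wpDl ?mulr_ge0.
by field; rewrite nat1r n1 h2 g0.
Qed.

(** Only the factor n - 1/2 at n = 0 is negative, and it enters every coefficient after the
    first. *)
Let e_le0 l n : e l n.+1 <= 0.
Proof.
elim: n => [|n IH].
  rewrite eS e0 mul1r pmulr_lle0; last first.
    by rewrite invr_gt0 mulr_gt0 // ltr_wpDr // ltr_wpDl // divr_gt0.
  lra.
rewrite eS; apply: mulr_le0_ge0 => //.
have n0 : 0 <= n%:R :> R by [].
apply: divr_ge0.
  by apply: mulr_ge0; rewrite -(natr1 n); lra.
by apply: mulr_ge0 => //; have l0 : 0 <= l%:R :> R by []; rewrite -(natr1 n); lra.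
Qed.

(** A larger l enlarges the denominators, so these nonpositive coefficients move towards 0. *)
Let e_mono l n : e l n.+1 <= e l.+1 n.+1.
Proof.
have n0 m : 0 <= m%:R :> R by [].
have ln := n0 l.
have p m j : 0 < j%:R + 3 / 2 + m%:R :> R by rewrite ltr_wpDr // ltr_wpDl // divr_gt0.
elim: n => [|n IH].
  rewrite !eS !e0 !mul1r ler_wnM2l //.
  rewrite lef_pV2 ?posrE ?mulr_gt0 // ler_wpM2r // -(natr1 l); lra.
rewrite !(eS _ n.+1).
set a := (X in e l _ * X); set b := (X in _ <= e l.+1 _ * X).
have nn := n0 n.
have num : 0 <= (n.+1%:R + 3 / 2) * (n.+1%:R - 1 / 2) :> R by rewrite mulr_ge0 // -(natr1 n); lra.
have b0 : 0 <= b by rewrite divr_ge0 // mulr_ge0 // ltW.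
have ba : b <= a.
  rewrite ler_wpM2l // lef_pV2 ?posrE ?mulr_gt0 // ler_wpM2r // -(natr1 l); lra.
apply: (@le_trans _ _ (e l n.+1 * b)); first by rewrite ler_wnM2l.
by rewrite ler_wpM2r.
Qed.

Let PhiE l z : `|z| < 1 -> Phi l z = psum (e l) z.
Proof.
move=> z1; rewrite /Phi mulrC /hypF -psumZ //; last exact: unit_radius_hyp_coef.
by congr (psum _ _); apply/funext => n; rewrite mulrC.
Qed.

Let e_radius l : unit_radius (e l).
Proof.
have -> : e l = (fun n => (g l)^-1 * hyp_coef R l.+1%:Z n) by apply/funext => n; rewrite mulrC.
by apply: unit_radiusZ; exact: unit_radius_hyp_coef.
Qed.

Lemma Phi_le1 l z : 0 <= z < 1 -> Phi l z <= 1.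
Proof.
move=> /andP[z0 z1]; have zn : `|z| < 1 by rewrite ger0_norm.
rewrite (PhiE l zn) /psum.
apply: limr_le; first exact: (cvg_unit_radius (e_radius l)).
apply: nearW => -[|n]; rewrite /pseries /series /=; first by rewrite big_geq.
rewrite big_nat_recl //= e0 expr0 mulr1 gerDl sumr_le0 // => i _.
by rewrite mulr_le0_ge0 ?e_le0 // exprn_ge0.
Qed.

Lemma Phi_mono l z : 0 <= z < 1 -> Phi l z <= Phi l.+1 z.
Proof.
move=> /andP[z0 z1]; have zn : `|z| < 1 by rewrite ger0_norm.
rewrite (PhiE l zn) (PhiE l.+1 zn) /psum; apply: ler_lim.
- exact: (cvg_unit_radius (e_radius l)).
- exact: (cvg_unit_radius (e_radius l.+1)).
apply: nearW => n; rewrite /pseries /series /=; apply: ler_sum => i _.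
by rewrite ler_wpM2r ?exprn_ge0 //; case: i => [|i]; rewrite ?e0 ?e_mono.
Qed.

Lemma Phi0 z : 0 <= z < 1 -> Phi 0 z = Num.sqrt (1 - z).
Proof.
move=> z01; rewrite /Phi hypF1 // halfint1 mulrAC divff ?mul1r //.
by rewrite -halfint1 gt_eqF // g_gt0.
Qed.

Lemma Phi_gt0 l z : 0 <= z < 1 -> 0 < Phi l z.
Proof.
move=> z01; elim: l => [|l IH]; last exact: lt_le_trans (Phi_mono l z01).
by rewrite Phi0 // sqrtr_gt0 subr_gt0; case/andP: z01.
Qed.

End Radial.

(** * Regular and singular solutions in the variable tan (theta / 2) *)

Section RadialSolutions.
Variable R : realType.
Implicit Types (x z s r : R) (n l : nat).

(** For s = tan (theta / 2) this is (1 - cos theta) / 2, the hypergeometric argument. *)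
Let zof s : R := s ^+ 2 / (1 + s ^+ 2).

Let s21 s : 0 < 1 + s ^+ 2.
Proof. by rewrite ltr_wpDr // sqr_ge0. Qed.

Lemma zof_bound s : 0 <= zof s < 1.
Proof.
by rewrite divr_ge0 ?sqr_ge0 ?(ltW (s21 s)) //= ltr_pdivrMr // mul1r ltrDr.
Qed.

Let zof_norm s : `|zof s| < 1.
Proof. by have /andP[h1 h2] := zof_bound s; rewrite ger0_norm. Qed.

Definition usol l s : R := s ^+ l * Num.sqrt (1 + s ^+ 2) * Phi l (s ^+ 2 / (1 + s ^+ 2)).

Definition dusol l s : R :=
  (l%:R * (1 - s ^+ 2) * usol l s + 2 * Kcoef R l * s * usol l.+1 s) / (s * (1 + s ^+ 2)).

Let is_derive_z s : is_derive s 1 zof (2 * s / (1 + s ^+ 2) ^+ 2).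
Proof.
have h1 : is_derive s 1 (fun s : R => s ^+ 2) (2 * s).
  by apply: (isd_eq (isdX 2 (isd_id s))); rewrite /=; ring.
have h2 : is_derive s 1 (fun s : R => 1 + s ^+ 2) (2 * s).
  by apply: (isd_eq (isdD (isd_cst 1 s) h1)); ring.
apply: (isd_eq (isdM h1 (isdV h2 (lt0r_neq0 (s21 s))))).
by field; rewrite gt_eqF.
Qed.

(** Multiplying the derivative by s keeps the identity valid at s = 0, where the curve used later
    starts and continuity is needed. *)
Let usol_raw l s : exists d, is_derive s 1 (usol l) d /\
  s * d = l%:R * usol l s + s ^+ 2 / (1 + s ^+ 2) * usol l s +
    2 * s ^+ l * Num.sqrt (1 + s ^+ 2) * (s / (1 + s ^+ 2)) ^+ 2 * dPhi l (zof s).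
Proof.
have h1 : is_derive s 1 (fun s : R => 1 + s ^+ 2) (2 * s).
  apply: (isd_eq (isdD (isd_cst 1 s) (isdX 2 (isd_id s)))); rewrite /=; ring.
have h2 := isd_sqrt h1 (s21 s).
have h3 := isd_comp (is_derive_z s) (is_derive_Phi l (zof_norm s)).
have h4 := isdM (isdM (isdX l (isd_id s)) h2) h3.
eexists; split; first exact: h4.
rewrite /usol -/(zof s).
have q0 : Num.sqrt (1 + s ^+ 2) != 0 by rewrite sqrtr_eq0 -ltNge.
have qE : 1 + s ^+ 2 = Num.sqrt (1 + s ^+ 2) ^+ 2 by rewrite sqr_sqrtr // ltW.
have ls : s * (l%:R * s ^+ l.-1) = l%:R * s ^+ l.
  by case: l {h3 h4} => [|l]; rewrite ?mul0r ?mulr0 //= exprS; ring.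
move: (Phi l (zof s)) (dPhi l (zof s)) => A B.
have -> : s * ((l%:R * s ^+ l.-1 * 1 * Num.sqrt (1 + s ^+ 2) +
    s ^+ l * (2 * s / (2 * Num.sqrt (1 + s ^+ 2)))) * A +
    s ^+ l * Num.sqrt (1 + s ^+ 2) * (B * (2 * s / (1 + s ^+ 2) ^+ 2))) =
  (s * (l%:R * s ^+ l.-1)) * Num.sqrt (1 + s ^+ 2) * A +
   s ^+ 2 * s ^+ l / Num.sqrt (1 + s ^+ 2) * A +
   2 * s ^+ l * Num.sqrt (1 + s ^+ 2) * (s / (1 + s ^+ 2)) ^+ 2 * B.
  by field; rewrite q0 gt_eqF.
rewrite ls; congr (_ + _ + _); first by ring.
have -> : zof s = s ^+ 2 / Num.sqrt (1 + s ^+ 2) ^+ 2 by rewrite -qE.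
by field.
Qed.

Lemma is_derive_usol l s : 0 < s -> is_derive s 1 (usol l) (dusol l s).
Proof.
move=> s0; have [d [h1 h2]] := usol_raw l s; apply: (isd_eq h1).
apply: (mulfI (lt0r_neq0 s0)); rewrite h2 /dusol.
have q := s21 s.
have := Phi_raise l (zof_norm s).
rewrite /usol -/(zof s).
move: (Phi l (zof s)) (Phi l.+1 (zof s)) (dPhi l (zof s)) => A C B E.
have {}E : B = (1 + s ^+ 2) * (Kcoef R l * C - (l%:R + 1 / 2) * A).
  by rewrite -E /zof; field; rewrite gt_eqF.
by rewrite E (exprS s l) /zof; field; rewrite !gt_eqF.
Qed.

Lemma usol_continuous l : continuous (usol l).
Proof. by move=> s; have [d [h1 _]] := usol_raw l s; exact: (isd_cvg h1). Qed.

(** The derivative of [Phi l.+1] is eliminated between [Phi_lower] and [Phi_raise]. *)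
Lemma usol_rec l s : 0 < s ->
  (2 * l%:R + 3) * (1 - s ^+ 2) * usol l.+1 s + 2 * Kcoef R l.+1 * s * usol l.+2 s =
  (2 * l%:R + 3) * s * usol l s.
Proof.
move=> s0; have q := s21 s.
have := Phi_raise l.+1 (zof_norm s); have := Phi_lower l (zof_norm s).
rewrite /usol -/(zof s).
move: (Phi l (zof s)) (Phi l.+1 (zof s)) (Phi l.+2 (zof s)) (dPhi l.+1 (zof s)) => A C D B E1 E2.
have {}E2 : B = (1 + s ^+ 2) * (Kcoef R l.+1 * D - (l.+1%:R + 1 / 2) * C).
  by rewrite -E2 /zof; field; rewrite gt_eqF.
have E : s ^+ 2 * (Kcoef R l.+1 * D - (l.+1%:R + 1 / 2) * C) = (l%:R + 3 / 2) * (A - C).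
  by rewrite -E1 E2 /zof; field; rewrite gt_eqF.
rewrite (exprS s l.+1) (exprS s l).
transitivity (2 * s * s ^+ l * Num.sqrt (1 + s ^+ 2) * (
  (l%:R + 3 / 2) * (1 - s ^+ 2) * C + s ^+ 2 * (l.+1%:R + 1 / 2) * C +
    s ^+ 2 * (Kcoef R l.+1 * D - (l.+1%:R + 1 / 2) * C))).
  by rewrite expr2; field.
by rewrite E -natr1; field.
Qed.

Lemma usol0 s : usol 0 s = 1.
Proof.
rewrite /usol expr0 mul1r Phi0 ?zof_bound //.
have -> : 1 - s ^+ 2 / (1 + s ^+ 2) = (1 + s ^+ 2)^-1 by field; rewrite gt_eqF.
by rewrite -sqrtrM ?(ltW (s21 s)) // divff ?gt_eqF // sqrtr1.
Qed.

Lemma usolS_at0 l : usol l.+1 0 = 0.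
Proof. by rewrite /usol expr0n !mul0r. Qed.

Lemma usol_gt0 l s : 0 < s -> 0 < usol l s.
Proof.
move=> s0; apply: mulr_gt0; last exact: (Phi_gt0 l (zof_bound s)).
by rewrite mulr_gt0 ?exprn_gt0 ?sqrtr_gt0.
Qed.

Lemma usol_le l s : 0 <= s -> `|usol l s| <= s ^+ l * Num.sqrt (1 + s ^+ 2).
Proof.
move=> s0; have P0 := Phi_gt0 l (zof_bound s).
have h : 0 <= s ^+ l * Num.sqrt (1 + s ^+ 2) by rewrite mulr_ge0 ?exprn_ge0 ?sqrtr_ge0.
rewrite ger0_norm; first by rewrite ler_piMr // Phi_le1 // zof_bound.
by rewrite mulr_ge0 // ltW.
Qed.

Lemma usol1_at1_ge1 : 1 <= usol 1 1.
Proof.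
apply: (@le_trans _ _ (usol 0 1)); first by rewrite usol0.
rewrite /usol expr0 expr1 !mul1r; apply: ler_wpM2l; first exact: sqrtr_ge0.
exact: (Phi_mono 0 (zof_bound 1)).
Qed.

Lemma Kcoef_ge0 l : 0 <= Kcoef R l.
Proof. by rewrite /Kcoef divr_ge0 // ?mulr_ge0 ?addr_ge0 ?divr_ge0. Qed.

Lemma Kcoef_le l : Kcoef R l <= l%:R + 1 / 2.
Proof.
have l0 : 0 <= l%:R :> R by [].
rewrite /Kcoef ler_pdivrMr; last lra.
nra.
Qed.

(** Since u_0 = 1, [usol_rec] expresses u_2 by u_1, so u_1 solves a first-order linear equation. The
    inhomogeneous terms at t and 1 / t cancel in the sum, and [q] is the integrating factor of what
    remains. *)
Lemma usol1_inv s : 0 < s ->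
  usol 1 s + usol 1 s^-1 = usol 1 1 * (1 + s ^+ 2) ^+ 2 / (2 * s ^+ 2).
Proof.
move=> s0; pose q t : R := t ^+ 2 / (1 + t ^+ 2) ^+ 2.
pose f t : R := q t * (usol 1 t + usol 1 t^-1).
have q1 (t : R) : 1 + t ^+ 2 != 0 by rewrite gt_eqF.
have dq (t : R) : is_derive t 1 q (2 * t * (1 - t ^+ 2) / (1 + t ^+ 2) ^+ 3).
  have h1 : is_derive t 1 (fun s : R => s ^+ 2) (2 * t).
    by apply: (isd_eq (isdX 2 (isd_id t))); rewrite /=; ring.
  have h2 : is_derive t 1 (fun s : R => (1 + s ^+ 2) ^+ 2) (4 * t * (1 + t ^+ 2)).
    by apply: (isd_eq (isdX 2 (isdD (isd_cst 1 t) h1))); rewrite /=; ring.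
  have q2 : (1 + t ^+ 2) ^+ 2 != 0 by rewrite expf_neq0.
  by apply: (isd_eq (isdM h1 (isdV h2 q2))); field; rewrite q1.
have rel t : 0 < t -> 3 * (1 - t ^+ 2) * usol 1 t + 2 * Kcoef R 1 * t * usol 2 t = 3 * t.
  move=> t0; have := usol_rec 0 t0; rewrite usol0 => E.
  transitivity ((2 * 0%:R + 3) * t * 1); last by ring.
  by rewrite -E; ring.
have df (t : R) : 0 < t -> is_derive t 1 f 0.
  move=> t0; have tn : t != 0 by rewrite gt_eqF.
  have ti : 0 < t^-1 by rewrite invr_gt0.
  have h3 := isdM (dq t) (isdD (is_derive_usol 1 t0)
    (isd_comp (isdV (isd_id t) tn) (is_derive_usol 1 ti))).
  apply: (isd_eq h3); rewrite /dusol /q.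
  have e1 : 2 * Kcoef R 1 * t * usol 2 t = 3 * t - 3 * (1 - t ^+ 2) * usol 1 t.
    by rewrite -(rel t) //; ring.
  have e2 : 2 * Kcoef R 1 * t^-1 * usol 2 t^-1 = 3 * t^-1 - 3 * (1 - t^-1 ^+ 2) * usol 1 t^-1.
    by rewrite -(rel t^-1) //; ring.
  rewrite e1 e2; move: (usol 1 t) (usol 1 t^-1) => A B.
  by field; rewrite tn addrC q1.
have cst a b : 0 < a -> a <= b -> f a = f b.
  move=> a0 ab; apply/eqP; rewrite eq_sym -subr_eq0; apply/eqP.
  rewrite -(subrr 0); apply: (@eq_of_derive _ f (fun=> 0) (fun=> 0) a b) => //.
  - apply: derivable_within_continuous => t; rewrite in_itv /= => /andP[t0 tz].
    by have [] := df t (lt_le_trans a0 t0).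
  - by move=> t; exact: cvg_cst.
  - by move=> t; rewrite in_itv /= => /andP[t0 tz]; apply: df; rewrite (lt_trans a0).
have fs : f s = f 1.
  by have [s1|s1] := leP s 1; [exact: cst | rewrite (cst 1 s) ?ltW].
have f1 : f 1 = usol 1 1 / 2 by rewrite /f /q invr1 expr1n; field.
have sn : s != 0 by rewrite gt_eqF.
rewrite f1 /f /q in fs.
have -> : usol 1 s + usol 1 s^-1 = (s ^+ 2 / (1 + s ^+ 2) ^+ 2 * (usol 1 s + usol 1 s^-1))
   * ((1 + s ^+ 2) ^+ 2 / s ^+ 2).
  by move: (usol 1 s) (usol 1 s^-1) => A B; field; rewrite sn q1.
by rewrite fs; move: (usol 1 1) => A; field.
Qed.

(* [lamS l] normalizes [vsol l.+1], so that the order-lowering recurrences of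
   [usol] and [vsol] match and the partial sums telescope. *)
Fixpoint lamS l : R :=
  if l is l1.+1 then lamS l1 * (l%:R * (l%:R + 2)) / (l%:R + 3 / 2) ^+ 2
  else 2 / 3 / usol 1 1.

(** The generic formula would give 0 at [l = 0], since u_0 is constant; there the singular solution
    is - 2 cot theta for r = tan (theta / 2). *)
Definition vsol l r : R :=
  if l is l1.+1 then - lamS l1 * (usol l r^-1 - (-1) ^+ l * usol l r)
  else - ((1 - r ^+ 2) / r).

Definition dvsol l r : R :=
  (l%:R * (1 - r ^+ 2) * vsol l r - (2 * l%:R + 3) * r * vsol l.+1 r) / (r * (1 + r ^+ 2)).

Lemma lamS_gt0 l : 0 < lamS l.
Proof.
elim: l => [|l IH] /=; first by rewrite !divr_gt0 // usol_gt0.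
have l0 : 0 <= l%:R :> R by [].
rewrite divr_gt0 // ?mulr_gt0 ?addr_gt0 ?exprn_gt0 //; lra.
Qed.

(** This decay compensates the factors of order l that accompany v_(l+1) in the telescoped sum. The
    left side decreases with l, and at l = 0 it is 1 / u_1(1) <= 1. *)
Lemma lamS_le l : (l%:R + 3 / 2) * lamS l <= 1.
Proof.
elim: l => [|l IH].
  rewrite /= add0r; have u1 : usol 1 1 != 0 by rewrite gt_eqF // usol_gt0.
  have -> : 3 / 2 * (2 / 3 / usol 1 1) = (usol 1 1)^-1 by move: (usol 1 1) u1 => A u1; field.
  by rewrite invf_le1 ?usol1_at1_ge1 // usol_gt0.
apply: le_trans IH; rewrite /=.
have l0 : 0 <= l%:R :> R by [].
have L := lamS_gt0 l.
have -> : (l.+1%:R + 3 / 2) * (lamS l * (l.+1%:R * (l.+1%:R + 2)) / (l.+1%:R + 3 / 2) ^+ 2) =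
  (l.+1%:R * (l.+1%:R + 2)) / (l.+1%:R + 3 / 2) * lamS l.
  by field; rewrite gt_eqF //; lra.
rewrite ler_pM2r // ler_pdivrMr; rewrite -(natr1 l); nra.
Qed.

Lemma lamS_rec l : (2 * l%:R + 5) * lamS l.+1 = 2 * Kcoef R l.+1 * lamS l.
Proof.
have l0 : 0 <= l%:R :> R by [].
by rewrite /= /Kcoef -(natr1 l); field; rewrite gt_eqF //; lra.
Qed.

(** The starting value of [lamS] is fixed by this formula, which is what makes [dvsol 0] the
    derivative of [vsol 0]. *)
Lemma vsol1 r : 0 < r -> vsol 1 r = - ((1 + r ^+ 2) ^+ 2 / (3 * r ^+ 2)).
Proof.
move=> r0; rewrite /vsol /lamS expr1 mulN1r opprK [usol 1 r^-1 + _]addrC usol1_inv //.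
have u1 : usol 1 1 != 0 by rewrite gt_eqF // usol_gt0.
by field; rewrite u1 gt_eqF.
Qed.

Let is_derive_winv l r : 0 < r ->
  is_derive r 1 (fun r => usol l r^-1)
   ((l%:R * (1 - r ^+ 2) * usol l r^-1 - 2 * Kcoef R l * r * usol l.+1 r^-1) / (r * (1 + r ^+ 2))).
Proof.
move=> r0; have rn : r != 0 by rewrite gt_eqF.
have ri : 0 < r^-1 by rewrite invr_gt0.
apply: (isd_eq (isd_comp (isdV (isd_id r) rn) (is_derive_usol l ri))).
have q : 1 + r ^+ 2 != 0 by rewrite gt_eqF.
rewrite /dusol; move: (usol l r^-1) (usol l.+1 r^-1) (Kcoef R l) => A B K.
by field; rewrite rn ?q // addrC q.
Qed.

Lemma is_derive_vsol l r : 0 < r -> is_derive r 1 (vsol l) (dvsol l r).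
Proof.
move=> r0; have rn : r != 0 by rewrite gt_eqF.
have q : 1 + r ^+ 2 != 0 by rewrite gt_eqF.
case: l => [|l].
  have h1 : is_derive r 1 (fun s : R => 1 - s ^+ 2) (- (2 * r)).
    by apply: (isd_eq (isdB (isd_cst 1 r) (isdX 2 (isd_id r)))); rewrite /=; ring.
  apply: (isd_eq (isdN (isdM h1 (isdV (isd_id r) rn)))).
  by rewrite /dvsol vsol1 //; field; rewrite rn q.
apply: (isd_eq (isdZ (- lamS l) (isdB (is_derive_winv l.+1 r0) (isdZ ((-1) ^+ l.+1) (is_derive_usol l.+1 r0))))).
have E := lamS_rec l.
have {}E : lamS l.+1 = 2 * Kcoef R l.+1 * lamS l / (2 * l%:R + 5).
  by rewrite -E; field; have l0 : 0 <= l%:R :> R by []; rewrite gt_eqF //; lra.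
rewrite /dvsol /dusol /vsol E -(natr1 l) (exprS _ l.+1).
move: (usol l.+1 r) (usol l.+1 r^-1) (usol l.+2 r) (usol l.+2 r^-1) (Kcoef R l.+1) (lamS l) ((-1) ^+ l.+1)=> A B C D K L S.
by field; have l0 : 0 <= l%:R :> R by []; rewrite rn q gt_eqF //; lra.
Qed.

Lemma vsol_rec l r : 0 < r ->
  (2 * l%:R + 3) * (1 - r ^+ 2) * vsol l.+1 r - (2 * l%:R + 5) * r * vsol l.+2 r =
  - (2 * Kcoef R l * r * vsol l r).
Proof.
move=> r0; have rn : r != 0 by rewrite gt_eqF.
have ri : 0 < r^-1 by rewrite invr_gt0.
have E1 := usol_rec l r0; have E2 := usol_rec l ri.
have E1' : 2 * Kcoef R l.+1 * r * usol l.+2 r = (2 * l%:R + 3) * r * usol l r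
   - (2 * l%:R + 3) * (1 - r ^+ 2) * usol l.+1 r by rewrite -E1; ring.
have E2' : 2 * Kcoef R l.+1 * r * usol l.+2 r^-1 = (2 * l%:R + 3) * r * usol l r^-1
   + (2 * l%:R + 3) * (1 - r ^+ 2) * usol l.+1 r^-1.
  transitivity (r ^+ 2 * (2 * Kcoef R l.+1 * r^-1 * usol l.+2 r^-1)).
    by move: (usol l.+2 r^-1) => A; field.
  have -> : 2 * Kcoef R l.+1 * r^-1 * usol l.+2 r^-1 = (2 * l%:R + 3) * r^-1 * usol l r^-1
     - (2 * l%:R + 3) * (1 - r^-1 ^+ 2) * usol l.+1 r^-1 by rewrite -E2; ring.
  by move: (usol l.+1 r^-1) (usol l r^-1) => A B; field.
have Ev : (2 * l%:R + 5) * r * vsol l.+2 r = - lamS l * (2 * Kcoef R l.+1 * r * usol l.+2 r^-1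
    - (-1) ^+ l * (2 * Kcoef R l.+1 * r * usol l.+2 r)).
  transitivity (- ((2 * l%:R + 5) * lamS l.+1) * r * (usol l.+2 r^-1 - (-1) ^+ l.+2 * usol l.+2 r)).
    rewrite /vsol; move: (usol l.+2 r) (usol l.+2 r^-1) (lamS l.+1) ((-1) ^+ l.+2) => A B L S.
    by ring.
  rewrite lamS_rec (exprS (-1) l.+1) (exprS (-1) l).
  move: (usol l.+2 r) (usol l.+2 r^-1) (lamS l) ((-1) ^+ l) (Kcoef R l.+1) => A B L S K.
  by ring.
rewrite Ev E1' E2'.
transitivity (lamS l * (2 * l%:R + 3) * r * (usol l r^-1 - (-1) ^+ l * usol l r)).
  rewrite /vsol (exprS (-1) l).
  move: (usol l r) (usol l r^-1) (usol l.+1 r) (usol l.+1 r^-1) (lamS l) ((-1) ^+ l) => A B C D L S.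
  by ring.
(* At index 0 both sides vanish: u_0 is constant and [Kcoef R 0 = 0]. *)
case: l {E1 E2 E1' E2' Ev} => [|l].
  by rewrite !usol0 expr0 /Kcoef; ring.
have := lamS_rec l; rewrite /vsol => E.
transitivity (((2 * l%:R + 5) * lamS l.+1) * r * (usol l.+1 r^-1 - (-1) ^+ l.+1 * usol l.+1 r)).
  rewrite -(natr1 l).
  move: (usol l.+1 r) (usol l.+1 r^-1) (lamS l.+1) ((-1) ^+ l.+1) => A B L S.
  by ring.
rewrite E; move: (usol l.+1 r) (usol l.+1 r^-1) (lamS l) ((-1) ^+ l.+1) (Kcoef R l.+1) => A B L S K.
by ring.
Qed.

Lemma vsolS_le l r : 0 < r -> `|vsol l.+1 r| <=
  lamS l * (r^-1 ^+ l.+1 * Num.sqrt (1 + r ^+ 2) / r + r ^+ l.+1 * Num.sqrt (1 + r ^+ 2)).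
Proof.
move=> r0; have ri : 0 <= r^-1 by rewrite invr_ge0 ltW.
rewrite /vsol normrM normrN (gtr0_norm (lamS_gt0 l)) ler_pM2l ?lamS_gt0 //.
apply: le_trans (ler_normB _ _) _; rewrite [`|(-1) ^+ _ * _|]normrM normrX normrN1 expr1n mul1r.
apply: lerD; last by apply: usol_le; exact: ltW.
apply: le_trans (usol_le _ ri) _.
have -> : Num.sqrt (1 + r^-1 ^+ 2) = Num.sqrt (1 + r ^+ 2) / r.
  have -> : 1 + r^-1 ^+ 2 = (1 + r ^+ 2) * (r^-1) ^+ 2 by field; rewrite gt_eqF.
  by rewrite sqrtrM ?(ltW (s21 r)) // sqrtr_sqr ger0_norm.
by rewrite mulrA.
Qed.

End RadialSolutions.

(** * Ferrers functions of degree 1/2 *)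

Section FerrersHalf.
Variable R : realType.
Implicit Types (x z s r : R) (n l : nat).

Lemma isd_unique (f : R -> R) x (a b : R) : is_derive x 1 f a -> is_derive x 1 f b -> a = b.
Proof. by move=> [_ <-] [_ <-]. Qed.

Let s21 s : 0 < 1 + s ^+ 2.
Proof. by rewrite ltr_wpDr // sqr_ge0. Qed.

Let zof s : R := s ^+ 2 / (1 + s ^+ 2).

Let zof_norm s : `|zof s| < 1.
Proof. by have /andP[h1 h2] := zof_bound s; rewrite ger0_norm. Qed.

Let V l r : R := Num.sqrt (1 + r ^+ 2) * r^-1 ^+ l.+1 * hypF (- l%:Z) (zof r).

Let is_derive_V l r : 0 < r ->
  is_derive r 1 (V l) ((l%:R * (1 - r ^+ 2) * V l r + 2 * r * V l.+1 r) / (r * (1 + r ^+ 2))).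
Proof.
move=> r0; have rn : r != 0 by rewrite gt_eqF.
have q := s21 r.
have h0 : is_derive r 1 (fun s : R => s ^+ 2) (2 * r).
  by apply: (isd_eq (isdX 2 (isd_id r))); rewrite /=; ring.
have h1 : is_derive r 1 (fun s : R => 1 + s ^+ 2) (2 * r).
  by apply: (isd_eq (isdD (isd_cst 1 r) h0)); ring.
have h2 : is_derive r 1 zof (2 * r / (1 + r ^+ 2) ^+ 2).
  apply: (isd_eq (isdM h0 (isdV h1 (lt0r_neq0 q)))).
  by field; rewrite gt_eqF.
have h3 := isdX l.+1 (isdV (isd_id r) rn).
have h4 := isdM (isdM (isd_sqrt h1 q) h3) (isd_comp h2 (is_derive_hypF (- l%:Z) (zof_norm r))).
apply: (isd_eq h4).
have := hypF_lower (- l.+1%:Z) (zof_norm r).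
have -> : - l.+1%:Z + 1 = - l%:Z by lia.
have -> : halfint R (- l.+1%:Z) = - (l%:R + 1 / 2).
  by rewrite /halfint mulrNz -pmulrn -natr1; field.
rewrite /V; move: (hypF (- l%:Z) (zof r)) (hypF (- l.+1%:Z) (zof r)) (dhypF (- l%:Z) (zof r)) => A B C E.
have {}E : B = zof r * C - (l%:R + 1 / 2) * A by rewrite -E; ring.
have qn : Num.sqrt (1 + r ^+ 2) != 0 by rewrite sqrtr_eq0 -ltNge.
have qE : Num.sqrt (1 + r ^+ 2) ^+ 2 = 1 + r ^+ 2 by rewrite sqr_sqrtr // ltW.
have -> : 2 * r / (2 * Num.sqrt (1 + r ^+ 2)) = r * Num.sqrt (1 + r ^+ 2) / (1 + r ^+ 2).
  by rewrite -{3}qE; field.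
rewrite E /= (exprS r^-1 l.+1) (exprS r^-1 l) /zof.
rewrite -(natr1 l); field; rewrite rn gt_eqF //.
Qed.

(** If the two sides agree at l, their derivatives agree, and each derivative formula contains the
    next member linearly; solving for it gives l + 1. The case l = 0 comes from the elementary
    [hypF1] and one contiguous relation. *)
Lemma vsol_hypF l r : 0 < r -> vsol l r =
  - (pi / 2) * (-1) ^+ l * rgamma (halfint R l.+1%:Z) *
  (Num.sqrt (1 + r ^+ 2) * r^-1 ^+ l.+1 * hypF (- l%:Z) (r ^+ 2 / (1 + r ^+ 2))).
Proof.
rewrite -/(zof r) -/(V l r).
elim: l r => [|l IH] r r0.
  have rn : r != 0 by rewrite gt_eqF.
  have q := s21 r.
  have z1 := zof_norm r.
  have := hypF_lower 0 z1; have := hypF_raise 1 z1; rewrite add0r.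
  have -> : halfint R 0 = 1 / 2 by rewrite /halfint add0r.
  rewrite halfint1 [X in _ = X * _](_ : _ = 0); last by field.
  rewrite mul0r expr0 mulr1 /V oppr0 expr1.
  have := hypF1 (zof_bound r); rewrite -/(zof r).
  move: (hypF 1 (zof r)) (dhypF 1 (zof r)) (hypF 0 (zof r)) => A B C EA E1 E2.
  have zE : 1 - zof r = (1 + r ^+ 2)^-1 by rewrite /zof; field; rewrite gt_eqF.
  have {}E1 : B = - (1 / 2) * A * (1 + r ^+ 2).
    have -> : B = ((1 - zof r) * B + (3 / 2 - 1) * A) * (1 + r ^+ 2) - 1 / 2 * A * (1 + r ^+ 2).
      by rewrite zE; field; rewrite gt_eqF.
    by rewrite E1; ring.
  have {}E2 : C = 1 / 2 * A * (1 - r ^+ 2).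
    by rewrite -E2 E1 /zof; field; rewrite gt_eqF.
  (* Gamma(3/2) = sqrt pi / 2; this is where the constant pi / 2 originates. *)
  have g : pi * rgamma (3 / 2) ^+ 2 = 4 :> R.
    have := (rgamma_halfint R 0).2; rewrite add0r halfint1.
    have -> : halfint R 0 = 1 / 2 by rewrite /halfint add0r.
    rewrite (rgamma_half R).2 => E.
    have -> : rgamma (3 / 2) = 2 * Num.sqrt pi^-1 :> R by rewrite E; field.
    rewrite exprMn sqr_sqrtr ?invr_ge0 ?pi_ge0 //.
    by move: (pi : R) (pi_gt0 R) => p p0; field; rewrite gt_eqF.
  rewrite E2 EA zE sqrtrV ?(ltW q) // /vsol.
  have qn : Num.sqrt (1 + r ^+ 2) != 0 by rewrite sqrtr_eq0 -ltNge.
  transitivity (- (pi * rgamma (3 / 2) ^+ 2 / 4) * ((1 - r ^+ 2) / r)).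
    by rewrite g; field.
  by move: (pi : R) (rgamma (3 / 2) : R) (Num.sqrt (1 + r ^+ 2)) qn => a b c qn; field; rewrite qn rn.
have rn : r != 0 by rewrite gt_eqF.
have q := s21 r.
set c := - (pi / 2) * (-1) ^+ l * rgamma (halfint R l.+1%:Z) in IH.
have h1 := is_derive_vsol l r0.
have h2 : is_derive r 1 (vsol l) (c * ((l%:R * (1 - r ^+ 2) * V l r + 2 * r * V l.+1 r) / (r * (1 + r ^+ 2)))).
  apply: isd_near (isdZ c (is_derive_V l r0)).
  near=> t; rewrite -IH //; near: t; exact: lt_nbhsr.
have := isd_unique h1 h2; rewrite /dvsol IH // => E.
have l0 : l%:R + 3 / 2 != 0 :> R by rewrite gt_eqF // ltr_wpDl // divr_gt0.
have gE : rgamma (halfint R l.+2%:Z) = rgamma (halfint R l.+1%:Z) / (l%:R + 3 / 2).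
  rewrite (rgamma_halfint R l.+1%:Z).2 -PoszD addn1.
  rewrite (_ : halfint R l.+1%:Z = l%:R + 3 / 2); last by rewrite halfint_nat -(natr1 l); field.
  by rewrite mulrAC divff // mul1r.
have {}E : (2 * l%:R + 3) * vsol l.+1 r = - (2 * c * V l.+1 r).
  have E' := congr1 (fun y => y * (1 + r ^+ 2)) E.
  clear IH h1 h2 E; clearbody c; move: E'; move: (vsol l.+1 r) (V l.+1 r) (V l r) c => A B C D E'.
  transitivity (- (((l%:R * (1 - r ^+ 2) * (D * C) - (2 * l%:R + 3) * r * A) / (r * (1 + r ^+ 2)) * (1 + r ^+ 2))
     - l%:R * (1 - r ^+ 2) * (D * C) / r)).
    by field; rewrite rn gt_eqF.
  by rewrite E'; field; rewrite rn gt_eqF.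
have l2 : 2 * l%:R + 3 != 0 :> R by rewrite gt_eqF // ltr_wpDl // mulr_ge0.
apply: (mulfI l2); rewrite E gE exprS /c.
move: (V l.+1 r) (rgamma _) ((-1) ^+ l) => A B S.
have l3 : l%:R * 2 + 3 != 0 :> R by rewrite mulrC.
by field; rewrite l3.
Unshelve. all: by end_near. Qed.

Let s2_neq0 s : s != 0 -> 1 + s ^+ 2 - (1 - s ^+ 2) != 0.
Proof.
move=> s0; have -> : 1 + s ^+ 2 - (1 - s ^+ 2) = 2 * s ^+ 2 by ring.
by rewrite mulf_neq0 // expf_neq0.
Qed.

Lemma powR_half_nat s l : 0 < s -> (s ^- 2) `^ (- (1 / 2 + l%:R) / 2) = s ^+ l * Num.sqrt s.
Proof.
move=> s0; have sn : s != 0 by rewrite gt_eqF.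
have -> : s ^- 2 = s `^ (- 2%:R) by rewrite powRN powR_mulrn // ltW.
rewrite -powRrM; have -> : - 2 * (- (1 / 2 + l%:R) / 2) = l%:R + 2^-1 :> R by field.
by rewrite powRD ?sn ?implybT // powR_mulrn ?ltW // powR12_sqrt // ltW.
Qed.

Lemma ferrersP_half_neg l s x : 0 < s -> x = (1 - s ^+ 2) / (1 + s ^+ 2) ->
  ferrersP (1 / 2) (- (1 / 2 + l%:R)) x =
  Num.sqrt (s / (1 + s ^+ 2)) * rgamma (halfint R l.+1%:Z) * usol l s.
Proof.
move=> s0 ->; have q := s21 s; have sn : s != 0 by rewrite gt_eqF.
rewrite /ferrersP.
have -> : (1 + (1 - s ^+ 2) / (1 + s ^+ 2)) / (1 - (1 - s ^+ 2) / (1 + s ^+ 2)) = s ^- 2.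
  by field; rewrite sn s2_neq0 // gt_eqF.
have -> : (1 - (1 - s ^+ 2) / (1 + s ^+ 2)) / 2 = s ^+ 2 / (1 + s ^+ 2) by field; rewrite gt_eqF.
have -> : 1 - - (1 / 2 + l%:R) = halfint R l.+1%:Z by rewrite halfint_nat -(natr1 l); field.
rewrite powR_half_nat // reg_hyp2F1_psum -/(hypF _ _) /usol /Phi.
have g0 : rgamma (halfint R l.+1%:Z) != 0 by rewrite gt_eqF // rgamma_half_gt0.
have qn : Num.sqrt (1 + s ^+ 2) != 0 by rewrite sqrtr_eq0 -ltNge.
rewrite sqrtrM ?(ltW s0) // sqrtrV ?(ltW q) //.
move: (rgamma _) g0 (hypF _ _) (Num.sqrt (1 + s ^+ 2)) qn => a a0 b c c0.
by field; rewrite a0 c0.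
Qed.

Lemma ferrersP_half_pos l r x : 0 < r -> x = (1 - r ^+ 2) / (1 + r ^+ 2) ->
  pi / 2 * rgamma (halfint R l.+1%:Z) * (-1) ^+ l * ferrersP (1 / 2) (1 / 2 + l%:R) x =
  - Num.sqrt (r / (1 + r ^+ 2)) * vsol l r.
Proof.
move=> r0 ->; have q := s21 r; have rn : r != 0 by rewrite gt_eqF.
rewrite /ferrersP.
have -> : (1 + (1 - r ^+ 2) / (1 + r ^+ 2)) / (1 - (1 - r ^+ 2) / (1 + r ^+ 2)) = r ^- 2.
  by field; rewrite rn s2_neq0 // gt_eqF.
have -> : (1 - (1 - r ^+ 2) / (1 + r ^+ 2)) / 2 = r ^+ 2 / (1 + r ^+ 2) by field; rewrite gt_eqF.
have -> : 1 - (1 / 2 + l%:R) = halfint R (- l%:Z).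
  by rewrite /halfint mulrNz -pmulrn; field.
have -> : (1 / 2 + l%:R) / 2 = - (- (1 / 2 + l%:R) / 2) :> R by ring.
rewrite powRN powR_half_nat // reg_hyp2F1_psum -/(hypF _ _) vsol_hypF //.
have qn : Num.sqrt (1 + r ^+ 2) != 0 by rewrite sqrtr_eq0 -ltNge.
have sn : Num.sqrt r != 0 by rewrite sqrtr_eq0 -ltNge.
rewrite sqrtrM ?(ltW r0) // sqrtrV ?(ltW q) // exprVn (exprS r l).
have rE : Num.sqrt r ^+ 2 = r by rewrite sqr_sqrtr // ltW.
have -> : (r * r ^+ l)^-1 = (Num.sqrt r ^+ 2 * r ^+ l)^-1 by rewrite rE.
have rl : r ^+ l != 0 by rewrite expf_neq0.
move: (rgamma _) (hypF _ _) (Num.sqrt (1 + r ^+ 2)) qn ((-1) ^+ l) (Num.sqrt r) sn (r ^+ l) rl (pi : R) => a b c c0 d f f0 k k0 p.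
by field; rewrite c0 f0 k0.
Qed.

Definition radial_coef l s r : R := - (l%:R + 1 / 2) * (usol l s * vsol l r).

Lemma ferrersP_half_prod l s r x y : 0 < s -> 0 < r ->
  x = (1 - s ^+ 2) / (1 + s ^+ 2) -> y = (1 - r ^+ 2) / (1 + r ^+ 2) ->
  (-1) ^+ l * (2 * l%:R + 1) * ferrersP (1 / 2) (- (1 / 2 + l%:R)) x *
    ferrersP (1 / 2) (1 / 2 + l%:R) y =
  4 / pi * Num.sqrt (s / (1 + s ^+ 2)) * Num.sqrt (r / (1 + r ^+ 2)) * radial_coef l s r.
Proof.
move=> s0 r0 xE yE; rewrite (ferrersP_half_neg l s0 xE).
have := ferrersP_half_pos l r0 yE; rewrite /radial_coef.
move: (rgamma _) (usol l s) (vsol l r) (ferrersP _ _ y) (Num.sqrt _) (Num.sqrt _) ((-1) ^+ l) (pi : R) (pi_gt0 R) => a b c d e f g p p0 E.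
transitivity (2 / p * (2 * l%:R + 1) * e * b * (p / 2 * a * g * d)).
  by field; rewrite gt_eqF.
by rewrite E; field; rewrite gt_eqF.
Qed.

End FerrersHalf.

Arguments vsol : simpl never.

(** * Summation at a fixed azimuth *)

Section Telescope.
Variable R : realType.
Implicit Types (x s r : R) (l N : nat).
Local Notation P := (fun l x => (legendre R l).[x]).

(* Along the curves of constant geodesic distance, the derivative of a partial
   sum collapses to its last terms, as in the Christoffel-Darboux formula. *)
Lemma telescope_radial N x s r : 0 < s -> 0 < r ->
  let al := 1 - s ^+ 2 in let be := s / r * (1 - r ^+ 2) in
  \sum_(l < N.+1) (- (l%:R + 1 / 2)) * P l x *
    ((al - x * be) * (l%:R * al * usol l s + 2 * Kcoef R l * s * usol l.+1 s) * vsol l r +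
     (x * al - be) * usol l s * (l%:R * be * vsol l r - (2 * l%:R + 3) * s * vsol l.+1 r)) =
  N.+1%:R * s *
   (be * (Kcoef R N * usol N.+1 s * vsol N r * P N.+1 x - (N%:R + 3 / 2) * usol N s * vsol N.+1 r * P N x) +
    al * ((N%:R + 3 / 2) * usol N s * vsol N.+1 r * P N.+1 x - Kcoef R N * usol N.+1 s * vsol N r * P N x)).
Proof.
move=> s0 r0 al be; have rn : r != 0 by rewrite gt_eqF.
elim: N => [|N IH].
  rewrite big_ord_recr big_ord0 /= legendre0 legendre1 hornerC hornerX.
  move: (usol 0 s) (usol 1 s) (vsol 0 r) (vsol 1 r) (Kcoef R 0) => A B C D K.
  by field.
rewrite big_ord_recr /= {}IH.
(* [Eu] and [Ev] remove u_N and v_N, so that only indices N + 1 and N + 2 remain in the radial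
   factors; Bonnet's recurrence then matches the Legendre factors. *)
have Eu : (2 * N%:R + 3) * s * usol N s =
    (2 * N%:R + 3) * al * usol N.+1 s + 2 * Kcoef R N.+1 * s * usol N.+2 s.
  by rewrite /al -usol_rec.
have Ev : 2 * Kcoef R N * s * vsol N r =
    (2 * N%:R + 5) * s * vsol N.+2 r - (2 * N%:R + 3) * be * vsol N.+1 r.
  have := vsol_rec N r0.
  move: (vsol N r) (vsol N.+1 r) (vsol N.+2 r) (Kcoef R N) => A B C K E.
  transitivity (- (s / r * - (2 * K * r * A))); first by field.
  by rewrite -E /be; field.
have EP : N.+2%:R * P N.+2 x = (2 * N.+1%:R + 1) * x * P N.+1 x - N.+1%:R * P N x.
  have := @dlegendre_rec R N.+1 0 x.
  by rewrite /dlegendre !derivn0 subr0 addn0 /= => ->; ring.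
transitivity (N.+1%:R / 2 *
   (be * ((2 * Kcoef R N * s * vsol N r) * usol N.+1 s * P N.+1 x - ((2 * N%:R + 3) * s * usol N s) * vsol N.+1 r * P N x) +
    al * (((2 * N%:R + 3) * s * usol N s) * vsol N.+1 r * P N.+1 x - (2 * Kcoef R N * s * vsol N r) * usol N.+1 s * P N x)) +
  - (N.+1%:R + 1 / 2) * P N.+1 x *
    ((al - x * be) * (N.+1%:R * al * usol N.+1 s + 2 * Kcoef R N.+1 * s * usol N.+2 s) * vsol N.+1 r +
     (x * al - be) * usol N.+1 s * (N.+1%:R * be * vsol N.+1 r - (2 * N.+1%:R + 3) * s * vsol N.+2 r))).
  move: (usol N s) (usol N.+1 s) (usol N.+2 s) (vsol N r) (vsol N.+1 r) (vsol N.+2 r).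
  move: (Kcoef R N) (Kcoef R N.+1) (P N x) (P N.+1 x) => A1 A2 A3 B1 B2 B3 K1 K2 P1 P2.
  by field.
rewrite Eu Ev.
transitivity (s * (be * (Kcoef R N.+1 * usol N.+2 s * vsol N.+1 r * (N.+2%:R * P N.+2 x)
     - N.+2%:R * ((N.+1%:R + 3 / 2) * usol N.+1 s * vsol N.+2 r) * P N.+1 x) +
    al * ((N.+1%:R + 3 / 2) * usol N.+1 s * vsol N.+2 r * (N.+2%:R * P N.+2 x)
     - N.+2%:R * (Kcoef R N.+1 * usol N.+2 s * vsol N.+1 r) * P N.+1 x))); last first.
  move: (usol N.+1 s) (usol N.+2 s) (vsol N.+1 r) (vsol N.+2 r) (Kcoef R N.+1) (P N.+1 x) (P N.+2 x) => A2 A3 B2 B3 K2 P2 P3.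
  by ring.
rewrite EP.
move: (usol N.+1 s) (usol N.+2 s) (vsol N.+1 r) (vsol N.+2 r) (Kcoef R N.+1) (P N x) (P N.+1 x) => A2 A3 B2 B3 K2 P1 P2.
rewrite -(natr1 N); by field.
Qed.

End Telescope.

(** * Curves of constant geodesic distance *)

Section Path.
Variable R : realType.
Implicit Types (x s r H t : R) (l N : nat).

Section Branch.
Variables (x H : R).
Hypothesis H0 : 0 < H.
Hypothesis Hx : 0 <= H + 2 * x - 2.
Hypothesis x1 : `|x| <= 1.

(* Along the curve, [h + 1 / h = p t / t] for [h = s / r], and likewise for
   [s * r] with [- x] and [K]; then (1 - cos Theta) / (1 + cos Theta) is the
   constant [H / K]. *)
Let p t := H + 2 * x * t.
Definition spath t : R := Num.sqrt (p t ^+ 2 - 4 * t ^+ 2).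

(** Writing the smaller root of h + 1 / h = p t / t as h = 2 t / [wpath t] avoids dividing by t and
    is regular at t = 0. *)
Definition wpath t : R := p t + spath t.

(** p t - 2 t is affine, equal to H at 0 and nonnegative at 1; hence the discriminant is positive
    before t = 1. *)
Let p_ge t : 0 <= t <= 1 -> 2 * t + (1 - t) * H <= p t.
Proof.
move=> /andP[t0 t1]; rewrite -subr_ge0.
have -> : p t - (2 * t + (1 - t) * H) = t * (H + 2 * x - 2) by rewrite /p; ring.
by rewrite mulr_ge0.
Qed.

Let disc_gt0 t : 0 <= t < 1 -> 0 < p t ^+ 2 - 4 * t ^+ 2.
Proof.
move=> /andP[t0 t1].
have h := p_ge (_ : 0 <= t <= 1); rewrite t0 ltW // in h.
have {}h := h isT.
have h2 : 0 < (1 - t) * H by rewrite mulr_gt0 // subr_gt0.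
have -> : p t ^+ 2 - 4 * t ^+ 2 = (p t - 2 * t) * (p t + 2 * t) by ring.
by rewrite mulr_gt0 //; lra.
Qed.

Lemma spath_gt0 t : 0 <= t < 1 -> 0 < spath t.
Proof. by move=> h; rewrite sqrtr_gt0 disc_gt0. Qed.

Lemma wpath_bounds t : 0 <= t <= 1 ->
  [/\ H / 2 <= wpath t, 2 * t <= wpath t & wpath t <= 2 * (H + 2)].
Proof.
move=> t01; have /andP[t0 t1] := t01; have h := p_ge t01.
have S0 : 0 <= spath t by exact: sqrtr_ge0.
have h1 : 0 <= (1 - t) * H by rewrite mulr_ge0 ?subr_ge0 // ltW.
have p0 : 0 <= p t by lra.
have /andP[xl xr] : - t <= x * t <= t.
  by rewrite -ler_norml normrM (ger0_norm t0) ler_piMl.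
split; rewrite /wpath.
- suff : H / 2 <= p t by lra.
  by move: h xl; rewrite /p; lra.
- by lra.
- have : spath t <= p t.
    by rewrite -[leRHS](ger0_norm p0) -sqrtr_sqr ler_wsqrtr // gerBl mulr_ge0 // sqr_ge0.
  by rewrite /p; lra.
Qed.

Lemma wpath_gt0 t : 0 <= t <= 1 -> 0 < wpath t.
Proof. by move=> /wpath_bounds[h _ _]; apply: lt_le_trans h; rewrite divr_gt0. Qed.

Lemma wpath_gt t : 0 <= t < 1 -> 2 * t < wpath t.
Proof.
move=> /andP[t0 t1].
have t01 : 0 <= t <= 1 by rewrite t0 ltW.
have h := p_ge t01; have h2 : 0 < (1 - t) * H by rewrite mulr_gt0 // subr_gt0.
have S0 : 0 <= spath t by exact: sqrtr_ge0.
rewrite /wpath; lra.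
Qed.

(* [2 * t / wpath t] is the root in [0, 1] of [y + 1 / y = p t / t]. *)
Lemma wpath_root t : 0 <= t < 1 -> let h := 2 * t / wpath t in
  [/\ 1 - h ^+ 2 = 2 * spath t / wpath t,
      1 - 2 * x * h + h ^+ 2 = 2 * H / wpath t &
      H / spath t = (1 - 2 * x * h + h ^+ 2) / (1 - h ^+ 2)].
Proof.
move=> t01 h; have /andP[t0 t1] := t01.
have wn : wpath t != 0 by rewrite gt_eqF // wpath_gt0 // t0 ltW.
have Sn : spath t != 0 by rewrite gt_eqF // spath_gt0.
have SE : spath t ^+ 2 = p t ^+ 2 - 4 * t ^+ 2 by rewrite sqr_sqrtr // ltW // disc_gt0.
have t2 : 4 * t ^+ 2 = (wpath t - spath t) ^+ 2 - spath t ^+ 2 by rewrite SE /wpath; ring.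
have e1 : 1 - h ^+ 2 = 2 * spath t / wpath t.
  rewrite /h expr_div_n exprMn (_ : 2 ^+ 2 = 4); last by ring.
  by rewrite t2; field.
have e2 : 1 - 2 * x * h + h ^+ 2 = 2 * H / wpath t.
  rewrite /h expr_div_n exprMn (_ : 2 ^+ 2 = 4); last by ring.
  have -> : 1 - 2 * x * (2 * t / wpath t) + 4 * t ^+ 2 / wpath t ^+ 2 =
    1 - 2 * (2 * x * t) / wpath t + 4 * t ^+ 2 / wpath t ^+ 2 by ring.
  have -> : 2 * x * t = wpath t - spath t - H by rewrite /wpath /p; ring.
  by rewrite t2; field.
split=> //; rewrite e1 e2; field.
by rewrite Sn wn.
Qed.

Lemma is_derive_wpath t : 0 < t < 1 ->
  is_derive t 1 wpath (wpath t / t * (1 - H / spath t)).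
Proof.
move=> /andP[t0 t1]; have t01 : 0 <= t < 1 by rewrite t1 ltW.
have tn : t != 0 by rewrite gt_eqF.
have Sn : spath t != 0 by rewrite gt_eqF // spath_gt0.
have h1 : is_derive t 1 p (2 * x).
  by apply: (isd_eq (isdD (isd_cst H t) (isdZ (2 * x) (isd_id t)))); ring.
have h2 : is_derive t 1 (fun t => p t ^+ 2 - 4 * t ^+ 2) (4 * x * p t - 8 * t).
  by apply: (isd_eq (isdB (isdX 2 h1) (isdZ 4 (isdX 2 (isd_id t))))); rewrite /=; ring.
apply: (isd_eq (isdD h1 (isd_sqrt h2 (disc_gt0 t01)))).
rewrite -/(spath t).
have SE : spath t ^+ 2 = p t ^+ 2 - 4 * t ^+ 2 by rewrite sqr_sqrtr // ltW // disc_gt0.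
have t2 : 4 * t ^+ 2 = p t ^+ 2 - spath t ^+ 2 by rewrite SE; ring.
apply: (mulfI tn).
transitivity ((2 * x * t) * (1 + p t / spath t) - 4 * t ^+ 2 / spath t); first by field.
rewrite t2; have -> : 2 * x * t = p t - H by rewrite /p; ring.
by rewrite /wpath; field; rewrite Sn tn.
Qed.

Lemma wpath_continuous : continuous wpath.
Proof.
move=> t.
have h1 : is_derive t 1 p (2 * x).
  by apply: (isd_eq (isdD (isd_cst H t) (isdZ (2 * x) (isd_id t)))); ring.
have h2 := isdB (isdX 2 h1) (isdZ 4 (isdX 2 (isd_id t))).
apply: cvgD; first exact: (isd_cvg h1).
apply: (@continuous_comp _ _ _ (fun t => p t ^+ 2 - 4 * t ^+ 2) Num.sqrt).
  exact: (isd_cvg h2).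
exact: sqrt_continuous.
Qed.

Lemma wpath_at1 y : 0 < y <= 1 -> H = y + y^-1 - 2 * x -> wpath 1 = 2 / y.
Proof.
move=> /andP[y0 y1] HE; have yn : y != 0 by rewrite gt_eqF.
rewrite /wpath /spath /p HE.
have -> : (y + y^-1 - 2 * x + 2 * x * 1) ^+ 2 - 4 * 1 ^+ 2 = (y^-1 - y) ^+ 2 by field.
rewrite sqrtr_sqr ger0_norm; first by field.
by rewrite subr_ge0 (le_trans y1) // invf_ge1.
Qed.

Lemma wpath_at0 : wpath 0 = 2 * H.
Proof.
rewrite /wpath /spath /p !mulr0 addr0 expr0n mulr0 subr0 sqrtr_sqr ger0_norm ?ltW //; ring.
Qed.

End Branch.

(** With a and b the logarithmic speeds of s / r and s r, these are the speeds of s and r. Their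
    factors 1 + s^2 and 1 + r^2 cancel the denominators of [dusol] and [dvsol]; what is left are the
    weights in [telescope_radial]. *)
Lemma log_speeds x s r : r != 0 -> 1 - (s / r) ^+ 2 != 0 -> 1 - (s * r) ^+ 2 != 0 ->
  let a := (1 - 2 * x * (s / r) + (s / r) ^+ 2) / (1 - (s / r) ^+ 2) in
  let b := (1 + 2 * x * (s * r) + (s * r) ^+ 2) / (1 - (s * r) ^+ 2) in
  let M := ((1 - (s / r) ^+ 2) * (1 - (s * r) ^+ 2))^-1 in
  (a + b) / 2 = M * (1 + s ^+ 2) * ((1 - s ^+ 2) - x * (s / r * (1 - r ^+ 2))) /\
  (b - a) / 2 = M * (s / r * (1 + r ^+ 2)) * (x * (1 - s ^+ 2) - s / r * (1 - r ^+ 2)).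
Proof.
move=> r0 h0 k0 a b M.
have e : r ^+ 2 - s ^+ 2 != 0.
  move: h0; have -> : 1 - (s / r) ^+ 2 = (r ^+ 2 - s ^+ 2) / r ^+ 2 by field.
  by rewrite mulf_eq0 negb_or => /andP[].
have k0' : 1 - s ^+ 2 * r ^+ 2 != 0 by rewrite -exprMn.
by split; rewrite /a /b /M; field; rewrite r0 ?k0 ?k0' ?e.
Qed.

(** If k <= h, the first factor is (1 + h)(1 - k): the small factor 1 - k gets paired with the
    larger A, and symmetrically. This pairing is what the speed of h^(N+1) + k^(N+1) can absorb. *)
Lemma gap_ineq (h k A B : R) : 0 <= h <= 1 -> 0 <= k <= 1 -> (k <= h -> B <= A) -> (h <= k -> A <= B) ->
  0 <= A -> 0 <= B ->
  ((1 - h * k) + `|h - k|) * (A + B) <= 4 * (A * (1 - k) + B * (1 - h)).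
Proof.
move=> /andP[h0 h1] /andP[k0 k1] AB BA A0 B0.
have [kh|hk] := leP k h.
  rewrite ger0_norm ?subr_ge0 //.
  have -> : 1 - h * k + (h - k) = (1 + h) * (1 - k) by ring.
  apply: (@le_trans _ _ (2 * (1 - k) * (2 * A))).
    have := AB kh => BA'; apply: ler_pM; first by rewrite mulr_ge0; lra.
    - lra.
    - by rewrite ler_wpM2r ?subr_ge0 //; lra.
    - lra.
  have : 0 <= B * (1 - h) by rewrite mulr_ge0 // subr_ge0.
  lra.
rewrite ltr0_norm ?subr_lt0 //.
have -> : 1 - h * k + - (h - k) = (1 + k) * (1 - h) by ring.
apply: (@le_trans _ _ (2 * (1 - h) * (2 * B))).
  have := BA (ltW hk) => BA'; apply: ler_pM; first by rewrite mulr_ge0; lra.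
  - lra.
  - by rewrite ler_wpM2r ?subr_ge0 //; lra.
  - lra.
have : 0 <= A * (1 - k) by rewrite mulr_ge0 // subr_ge0.
lra.
Qed.

Lemma bracket_le (al be a b p0 p1 : R) : 0 <= al ->
  `|be * (a * p1 - b * p0) + al * (b * p1 - a * p0)| <=
  (`|be| + al) * (`|a| + `|b|) * (`|p0| + `|p1|).
Proof.
move=> al0; rewrite -mulrA mulrDl.
have half (u v y z : R) : `|u * y - v * z| <= (`|u| + `|v|) * (`|z| + `|y|).
  apply: le_trans (ler_normB _ _) _; rewrite !normrM.
  have := mulr_ge0 (normr_ge0 u) (normr_ge0 z).
  have := mulr_ge0 (normr_ge0 v) (normr_ge0 y).
  rewrite mulrDl !mulrDr; lra.
apply: le_trans (ler_normD _ _) _; apply: lerD; rewrite normrM.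
  by rewrite ler_wpM2l.
by rewrite (ger0_norm al0) ler_wpM2l // [`|a| + _]addrC.
Qed.

(** The weights are 1 - h k and h - k for h = s / r, k = s r. [lamS_le] and [Kcoef_le] cancel all
    growth in N. N is positive so that v_N is of the form bounded by [vsolS_le]. *)
Lemma boundary_term_le N (s r p0 p1 al be : R) : (0 < N)%N -> 0 < s -> 0 < r -> s / r < 1 -> s * r < 1 ->
  al = 1 - s ^+ 2 -> be = s / r * (1 - r ^+ 2) ->
  `|s * (be * (Kcoef R N * usol N.+1 s * vsol N r * p1 - (N%:R + 3 / 2) * usol N s * vsol N.+1 r * p0) +
    al * ((N%:R + 3 / 2) * usol N s * vsol N.+1 r * p1 - Kcoef R N * usol N.+1 s * vsol N r * p0))| <=
  4 * (Num.sqrt (1 + s ^+ 2) * Num.sqrt (1 + r ^+ 2) * (2 + r^-1)) * (`|p0| + `|p1|) *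
   ((s / r) ^+ N.+1 * (1 - s * r) + (s * r) ^+ N.+1 * (1 - s / r)).
Proof.
move=> N0 s0 r0 h1 k1 al_def be_def.
pose h := s / r; pose k := s * r; rewrite -/h in h1; rewrite -/k in k1; rewrite -/h -/k.
have rn : r != 0 by rewrite gt_eqF.
have h0 : 0 < h by rewrite divr_gt0.
have k0 : 0 < k by rewrite mulr_gt0.
have s2 : s ^+ 2 = h * k by rewrite /h /k; field.
have s1 : s <= 1.
  by rewrite -(@ler_pXn2r _ 2) ?nnegrE ?(ltW s0) // expr1n s2 mulr_ile1 // ltW.
have alE : al = 1 - h * k by rewrite al_def s2.
have beE : be = h - k by rewrite be_def /h /k; field.
set Q := Num.sqrt (1 + s ^+ 2) * Num.sqrt (1 + r ^+ 2).
have Q0 : 0 <= Q by rewrite mulr_ge0 ?sqrtr_ge0.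
set a := Kcoef R N * usol N.+1 s * vsol N r.
set b := (N%:R + 3 / 2) * usol N s * vsol N.+1 r.
have ri0 : 0 < r^-1 by rewrite invr_gt0.
have hN0 : 0 < h ^+ N.+1 by rewrite exprn_gt0.
have kN0 : 0 < k ^+ N.+1 by rewrite exprn_gt0.
have us l : `|usol l s| <= s ^+ l * Num.sqrt (1 + s ^+ 2) by apply: usol_le; exact: ltW.
have sa : s * `|a| <= Q * (h ^+ N.+1 + k ^+ N.+1).
  case: N N0 @a @b hN0 kN0 => // n _ a b hN0 kN0.
  have L0 := lamS_gt0 R n.
  have KL : Kcoef R n.+1 * lamS R n <= 1.
    apply: le_trans (lamS_le R n); rewrite ler_wpM2r ?(ltW L0) //.
    by apply: le_trans (Kcoef_le R n.+1) _; rewrite -(natr1 n); lra.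
  apply: (@le_trans _ _ (s * (Kcoef R n.+1 * (s ^+ n.+2 * Num.sqrt (1 + s ^+ 2)) *
      (lamS R n * (r^-1 ^+ n.+1 * Num.sqrt (1 + r ^+ 2) / r + r ^+ n.+1 * Num.sqrt (1 + r ^+ 2)))))).
    rewrite ler_pM2l // /a [`|_ * vsol _ _|]normrM [`|_ * usol _ _|]normrM (ger0_norm (Kcoef_ge0 R _)).
    apply: ler_pM => //; [by rewrite mulr_ge0 // Kcoef_ge0| |exact: vsolS_le].
    by apply: ler_wpM2l; [exact: Kcoef_ge0|exact: us].
  have -> : s * (Kcoef R n.+1 * (s ^+ n.+2 * Num.sqrt (1 + s ^+ 2)) *
      (lamS R n * (r^-1 ^+ n.+1 * Num.sqrt (1 + r ^+ 2) / r + r ^+ n.+1 * Num.sqrt (1 + r ^+ 2)))) =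
    (Kcoef R n.+1 * lamS R n) * (Q * (s * h ^+ n.+2 + h * k ^+ n.+2)).
    rewrite /Q /h /k !exprMn exprVn (exprS r n.+1) (exprS r^-1 n.+1) (exprS s n.+1).
    move: (Kcoef R n.+1) (lamS R n) (Num.sqrt (1 + s ^+ 2)) (Num.sqrt (1 + r ^+ 2)) (s ^+ n.+1) => K L x1 x2 A.
    rewrite exprVn; have rm : r ^+ n.+1 != 0 by rewrite expf_neq0.
    move: (r ^+ n.+1) rm => B rm.
    by field; rewrite rn rm.
  have X0 : 0 <= s * h ^+ n.+2 + h * k ^+ n.+2 by rewrite addr_ge0 // mulr_ge0 // ltW.
  apply: (@le_trans _ _ (Q * (s * h ^+ n.+2 + h * k ^+ n.+2))).
    by rewrite ler_piMl // mulr_ge0.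
  by rewrite ler_wpM2l // lerD // ler_piMl // ltW.
have sb : s * `|b| <= Q * ((1 + r^-1) * (h ^+ N.+1 + k ^+ N.+1)).
  have L0 := lamS_gt0 R N.
  have NR : 0 <= N%:R + 3 / 2 :> R by rewrite addr_ge0 // divr_ge0.
  apply: (@le_trans _ _ (s * ((N%:R + 3 / 2) * (s ^+ N * Num.sqrt (1 + s ^+ 2)) *
      (lamS R N * (r^-1 ^+ N.+1 * Num.sqrt (1 + r ^+ 2) / r + r ^+ N.+1 * Num.sqrt (1 + r ^+ 2)))))).
    rewrite ler_pM2l // /b [`|_ * vsol _ _|]normrM [`|_ * usol _ _|]normrM (ger0_norm NR).
    apply: ler_pM => //; [by apply: ler_wpM2l|exact: vsolS_le].
  have -> : s * ((N%:R + 3 / 2) * (s ^+ N * Num.sqrt (1 + s ^+ 2)) *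
      (lamS R N * (r^-1 ^+ N.+1 * Num.sqrt (1 + r ^+ 2) / r + r ^+ N.+1 * Num.sqrt (1 + r ^+ 2)))) =
    ((N%:R + 3 / 2) * lamS R N) * (Q * (r^-1 * h ^+ N.+1 + k ^+ N.+1)).
    rewrite /Q /h /k !exprMn (exprS s N); ring.
  have X0 : 0 <= r^-1 * h ^+ N.+1 + k ^+ N.+1 by rewrite addr_ge0 ?mulr_ge0 // ltW.
  apply: (@le_trans _ _ (Q * (r^-1 * h ^+ N.+1 + k ^+ N.+1))).
    by rewrite ler_piMl ?lamS_le // mulr_ge0.
  rewrite ler_wpM2l //.
  have : 0 <= r^-1 * k ^+ N.+1 by rewrite mulr_ge0 // ltW.
  by rewrite mulrDl mulrDr mul1r; lra.
have sab : s * (`|a| + `|b|) <= Q * (2 + r^-1) * (h ^+ N.+1 + k ^+ N.+1).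
  by rewrite mulrDr; apply: le_trans (lerD sa sb) _; lra.
have gap := @gap_ineq h k (h ^+ N.+1) (k ^+ N.+1).
have {}gap : ((1 - h * k) + `|h - k|) * (h ^+ N.+1 + k ^+ N.+1) <=
    4 * (h ^+ N.+1 * (1 - k) + k ^+ N.+1 * (1 - h)).
  apply: gap; [by rewrite !ltW|by rewrite !ltW| | |exact: ltW|exact: ltW].
  - by move=> kh; rewrite lerXn2r // nnegrE ltW.
  - by move=> hk; rewrite lerXn2r // nnegrE ltW.
have al0 : 0 <= 1 - h * k by rewrite subr_ge0 mulr_ile1 // ltW.
apply: (@le_trans _ _ (((1 - h * k) + `|h - k|) * (s * (`|a| + `|b|)) * (`|p0| + `|p1|))).
  rewrite alE beE normrM (gtr0_norm s0).
  have -> : ((1 - h * k) + `|h - k|) * (s * (`|a| + `|b|)) * (`|p0| + `|p1|) =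
    s * ((`|h - k| + (1 - h * k)) * ((`|a| + `|b|) * (`|p0| + `|p1|))) by ring.
  by rewrite ler_pM2l // mulrA; exact: bracket_le.
have pp : 0 <= `|p0| + `|p1| by rewrite addr_ge0.
have QQ : 0 <= Q * (2 + r^-1) by rewrite mulr_ge0 // addr_ge0 // ltW.
apply: (@le_trans _ _ (((1 - h * k) + `|h - k|) * (Q * (2 + r^-1) * (h ^+ N.+1 + k ^+ N.+1)) * (`|p0| + `|p1|))).
  by rewrite ler_wpM2r // ler_wpM2l // addr_ge0.
have -> : ((1 - h * k) + `|h - k|) * (Q * (2 + r^-1) * (h ^+ N.+1 + k ^+ N.+1)) * (`|p0| + `|p1|) =
  (Q * (2 + r^-1) * (`|p0| + `|p1|)) * (((1 - h * k) + `|h - k|) * (h ^+ N.+1 + k ^+ N.+1)) by ring.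
apply: le_trans (ler_wpM2l (mulr_ge0 QQ pp) gap) _.
by rewrite le_eqVlt; apply/orP; left; apply/eqP; ring.
Qed.

End Path.

(** * Comparison of the partial sums with h^(N+1) + k^(N+1) along the curve *)

Section Curve.
Variable R : realType.
Variables (x H K : R).
Hypotheses (x1 : `|x| <= 1) (H0 : 0 < H) (K0 : 0 < K).
Hypotheses (Hx : 0 <= H + 2 * x - 2) (Kx : 0 <= K + 2 * (- x) - 2).
Implicit Types (t : R) (l N : nat).

Let x1' : `|- x| <= 1. Proof. by rewrite normrN. Qed.

Let wp t := wpath x H t.
Let wq t := wpath (- x) K t.
Let Q t := Num.sqrt (wp t * wq t).

(** [curve_s] and [curve_r] are recovered from s / r = 2 t / wp and s r = 2 t / wq, without a
    singularity at t = 0. *)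
Definition curve_s t : R := 2 * t / Q t.
Definition curve_r t : R := wp t / Q t.
Local Notation s := curve_s.
Local Notation r := curve_r.

Let wp0 t : 0 <= t <= 1 -> 0 < wp t. Proof. exact: wpath_gt0. Qed.
Let wq0 t : 0 <= t <= 1 -> 0 < wq t. Proof. exact: (wpath_gt0 K0 Kx x1'). Qed.

Let Q0 t : 0 <= t <= 1 -> 0 < Q t.
Proof. by move=> h; rewrite sqrtr_gt0 mulr_gt0 ?wp0 ?wq0. Qed.

Let Q2 t : 0 <= t <= 1 -> Q t ^+ 2 = wp t * wq t.
Proof. by move=> h; rewrite sqr_sqrtr // mulr_ge0 // ltW ?wp0 ?wq0. Qed.

Lemma curve_r_gt0 t : 0 <= t <= 1 -> 0 < r t.
Proof. by move=> h; rewrite divr_gt0 ?wp0 ?Q0. Qed.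

Lemma curve_s_gt0 t : 0 < t <= 1 -> 0 < s t.
Proof.
by move=> /andP[t0 t1]; rewrite divr_gt0 ?mulr_gt0 ?Q0 // (ltW t0).
Qed.

Lemma curve_ratio t : 0 <= t <= 1 -> s t / r t = 2 * t / wp t.
Proof.
move=> h; rewrite /s /r; have := wp0 h; have := Q0 h; have := Q2 h.
move: (Q t) (wp t) => a b E a0 b0.
by field; rewrite !gt_eqF.
Qed.

Lemma curve_prod t : 0 <= t <= 1 -> s t * r t = 2 * t / wq t.
Proof.
move=> h; rewrite /s /r; have := wp0 h; have := wq0 h; have := Q0 h; have := Q2 h.
move: (Q t) (wp t) (wq t) => a b c E a0 c0 b0.
have -> : 2 * t / a * (b / a) = 2 * t * b / a ^+ 2 by field; rewrite gt_eqF.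
by rewrite E; field; rewrite !gt_eqF.
Qed.

Lemma curve_r2 t : 0 <= t <= 1 -> r t ^+ 2 = wp t / wq t.
Proof.
move=> h; rewrite expr_div_n Q2 //; have := wp0 h; have := wq0 h.
by move: (wp t) (wq t) => a b b0 a0; field; rewrite !gt_eqF.
Qed.

Let a t := H / spath x H t.
Let b t := K / spath (- x) K t.

Let is_derive_Q t : 0 < t < 1 -> is_derive t 1 Q (Q t / t * ((2 - a t - b t) / 2)).
Proof.
move=> t01; have t01' : 0 <= t <= 1 by case/andP: t01 => h1 h2; rewrite !ltW.
have dp : is_derive t 1 wp (wp t / t * (1 - a t)) by exact: is_derive_wpath.
have dq : is_derive t 1 wq (wq t / t * (1 - b t)) by exact: is_derive_wpath.
have w0 : 0 < wp t * wq t by rewrite mulr_gt0 ?wp0 ?wq0.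
apply: (isd_eq (isd_sqrt (isdM dp dq) w0)); rewrite -/(Q t).
have := Q2 t01'; have := Q0 t01'; have := wp0 t01'; have := wq0 t01'.
case/andP: t01 => t0 _.
move: (Q t) (wp t) (wq t) (a t) (b t) => c d f g k f0 d0 c0 E.
have -> : d / t * (1 - g) * f + d * (f / t * (1 - k)) = c ^+ 2 / t * (2 - g - k).
  by rewrite E; ring.
by field; rewrite !gt_eqF.
Qed.

Lemma is_derive_curve_s t : 0 < t < 1 -> is_derive t 1 s (s t / t * ((a t + b t) / 2)).
Proof.
move=> t01; have t01' : 0 <= t <= 1 by case/andP: t01 => h1 h2; rewrite !ltW.
have c0 := Q0 t01'.
apply: (isd_eq (isdM (isdZ 2 (isd_id t)) (isdV (is_derive_Q t01) (lt0r_neq0 c0)))).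
rewrite /s; case/andP: t01 => t0 _.
by move: (Q t) (a t) (b t) c0 => c f g c0; field; rewrite !gt_eqF.
Qed.

Lemma is_derive_curve_r t : 0 < t < 1 -> is_derive t 1 r (r t / t * ((b t - a t) / 2)).
Proof.
move=> t01; have t01' : 0 <= t <= 1 by case/andP: t01 => h1 h2; rewrite !ltW.
have c0 := Q0 t01'.
have dp : is_derive t 1 wp (wp t / t * (1 - a t)) by exact: is_derive_wpath.
apply: (isd_eq (isdM dp (isdV (is_derive_Q t01) (lt0r_neq0 c0)))).
rewrite /r; case/andP: t01 => t0 _.
by move: (Q t) (wp t) (a t) (b t) c0 => c w f g c0; field; rewrite !gt_eqF.
Qed.

Let continuous_Q : continuous Q.
Proof.
move=> t; apply: (@continuous_comp _ _ _ (fun t => wp t * wq t) Num.sqrt).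
  by apply: cvgM; exact: wpath_continuous.
exact: sqrt_continuous.
Qed.

Lemma curve_s_continuous t : 0 <= t <= 1 -> {for t, continuous s}.
Proof.
move=> t01; apply: cvgM; first by apply: cvgMr; exact: cvg_id.
by apply: cvgV; [rewrite gt_eqF // Q0 | exact: continuous_Q].
Qed.

Lemma curve_r_continuous t : 0 <= t <= 1 -> {for t, continuous r}.
Proof.
move=> t01; apply: cvgM; first exact: wpath_continuous.
by apply: cvgV; [rewrite gt_eqF // Q0 | exact: continuous_Q].
Qed.

Let Psi N t := \sum_(l < N.+1) (legendre R l).[x] * radial_coef l (s t) (r t).
Let G N t : R := (s t / r t) ^+ N.+1 + (s t * r t) ^+ N.+1.

Let Psi_at0 N : Psi N 0 = (1 - r 0 ^+ 2) / (2 * r 0).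
Proof.
have r0 : r 0 != 0 by rewrite gt_eqF // curve_r_gt0 // lexx ler01.
rewrite /Psi big_ord_recl big1 ?addr0.
  rewrite legendre0 hornerC /radial_coef usol0 /vsol /=.
  by move: (r 0) r0 => y y0; field.
move=> i _; rewrite /radial_coef /s mulr0 mul0r.
by rewrite usolS_at0 mul0r mulr0 mulr0.
Qed.

Let dPsi N t := \sum_(l < N.+1) (legendre R l).[x] * (- (l%:R + 1 / 2) *
   (dusol l (s t) * (s t / t * ((a t + b t) / 2)) * vsol l (r t) +
    usol l (s t) * (dvsol l (r t) * (r t / t * ((b t - a t) / 2))))).

Let is_derive_Psi N t : 0 < t < 1 -> is_derive t 1 (Psi N) (dPsi N t).
Proof.
move=> t01; have /andP[t0 t1] := t01.
have t01' : 0 <= t <= 1 by rewrite !ltW.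
apply: (@isd_sum R N.+1 (fun l t => (legendre R l).[x] * radial_coef l (s t) (r t))
  (fun l => (legendre R l).[x] * (- (l%:R + 1 / 2) *
   (dusol l (s t) * (s t / t * ((a t + b t) / 2)) * vsol l (r t) +
    usol l (s t) * (dvsol l (r t) * (r t / t * ((b t - a t) / 2))))))) => l.
apply: isdZ; apply: isdZ; apply: isdM.
  apply: isd_comp; first exact: is_derive_curve_s.
  by apply: is_derive_usol; apply: curve_s_gt0; rewrite t0 ltW.
apply: isd_comp; first exact: is_derive_curve_r.
by apply: is_derive_vsol; exact: curve_r_gt0.
Qed.

Let h_lt1 t : 0 <= t < 1 -> s t / r t < 1.
Proof.
move=> t01; have t01' : 0 <= t <= 1 by case/andP: t01 => h1 h2; rewrite h1 ltW.
by rewrite curve_ratio // ltr_pdivrMr ?wp0 // mul1r wpath_gt.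
Qed.

Let k_lt1 t : 0 <= t < 1 -> s t * r t < 1.
Proof.
move=> t01; have t01' : 0 <= t <= 1 by case/andP: t01 => h1 h2; rewrite h1 ltW.
by rewrite curve_prod // ltr_pdivrMr ?wq0 // mul1r (wpath_gt K0 Kx).
Qed.

Let aE t : 0 < t < 1 ->
  a t = (1 - 2 * x * (s t / r t) + (s t / r t) ^+ 2) / (1 - (s t / r t) ^+ 2).
Proof.
move=> /andP[t0 t1]; have t01 : 0 <= t < 1 by rewrite t1 ltW.
have t01' : 0 <= t <= 1 by rewrite !ltW.
by rewrite curve_ratio //; have [_ _] := wpath_root H0 Hx x1 t01.
Qed.

Let bE t : 0 < t < 1 ->
  b t = (1 + 2 * x * (s t * r t) + (s t * r t) ^+ 2) / (1 - (s t * r t) ^+ 2).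
Proof.
move=> /andP[t0 t1]; have t01 : 0 <= t < 1 by rewrite t1 ltW.
have t01' : 0 <= t <= 1 by rewrite !ltW.
rewrite curve_prod //; have [_ _ E] := wpath_root K0 Kx x1' t01.
by rewrite /b E /wq; congr (_ / _); ring.
Qed.

Let M t := ((1 - (s t / r t) ^+ 2) * (1 - (s t * r t) ^+ 2))^-1.

Let dPsiE N t : 0 < t < 1 -> dPsi N t = M t / t * (N.+1%:R * s t *
   (s t / r t * (1 - r t ^+ 2) * (Kcoef R N * usol N.+1 (s t) * vsol N (r t) * (legendre R N.+1).[x]
       - (N%:R + 3 / 2) * usol N (s t) * vsol N.+1 (r t) * (legendre R N).[x]) +
    (1 - s t ^+ 2) * ((N%:R + 3 / 2) * usol N (s t) * vsol N.+1 (r t) * (legendre R N.+1).[x]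
       - Kcoef R N * usol N.+1 (s t) * vsol N (r t) * (legendre R N).[x]))).
Proof.
move=> t01; have /andP[t0 t1] := t01.
have t01' : 0 <= t <= 1 by rewrite !ltW.
have t01'' : 0 <= t < 1 by rewrite ltW.
have s0 : 0 < s t by apply: curve_s_gt0; rewrite t0 ltW.
have r0 := curve_r_gt0 t01'.
have h0 : 0 < s t / r t by rewrite divr_gt0.
have k0 : 0 < s t * r t by rewrite mulr_gt0.
rewrite -(telescope_radial N x s0 r0) big_distrr /=; apply: eq_bigr => l _.
have hn : 1 - (s t / r t) ^+ 2 != 0.
  by rewrite gt_eqF // subr_gt0 expr_lt1 ?h_lt1 // ltW.
have kn : 1 - (s t * r t) ^+ 2 != 0.
  by rewrite gt_eqF // subr_gt0 expr_lt1 ?k_lt1 // ltW.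
have [e1 e2] := log_speeds x (lt0r_neq0 r0) hn kn.
rewrite -aE // -bE // -/(M t) in e1 e2.
rewrite e1 e2 /dusol /dvsol.
have q1 : 1 + s t ^+ 2 != 0 by rewrite gt_eqF // ltr_wpDr // sqr_ge0.
have q2 : 1 + r t ^+ 2 != 0 by rewrite gt_eqF // ltr_wpDr // sqr_ge0.
move: (usol l (s t)) (usol l.+1 (s t)) (vsol l (r t)) (vsol l.+1 (r t)) (Kcoef R l) (legendre R l).[x] (M t) => A1 A2 B1 B2 k p m.
move: (s t) (r t) s0 r0 q1 q2 {h0 k0 hn kn e1 e2} => y z y0 z0 q1 q2.
by field; rewrite q1 q2 !gt_eqF.
Qed.

Let dG N t := N.+1%:R / t * ((s t / r t) ^+ N.+1 * a t + (s t * r t) ^+ N.+1 * b t).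

Let is_derive_G N t : 0 < t < 1 -> is_derive t 1 (G N) (dG N t).
Proof.
move=> t01; have /andP[t0 t1] := t01.
have t01' : 0 <= t <= 1 by rewrite !ltW.
have r0 := curve_r_gt0 t01'.
have ds := is_derive_curve_s t01; have dr := is_derive_curve_r t01.
apply: (isd_eq (isdD (isdX N.+1 (isdM ds (isdV dr (lt0r_neq0 r0)))) (isdX N.+1 (isdM ds dr)))).
rewrite /dG [N.+1.-1]/= !exprS.
move: (a t) (b t) (s t) (r t) r0 ((s t / r t) ^+ N) ((s t * r t) ^+ N) {ds dr} => f g y z z0 hN kN.
by field; rewrite !gt_eqF.
Qed.

(** One constant for three bounds along the whole curve: on r^2, on 1 / r, and on the reciprocals of
    the numerators of [a] and [b]. *)
Variable D : R.
Hypotheses (D1 : 1 <= D) (HD : 4 * (H + 2) <= D * K) (KD : 4 * (K + 2) <= D * H).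
Hypotheses (HD2 : H + 2 <= D * H) (KD2 : K + 2 <= D * K).

Let curve_r_bound t : 0 <= t <= 1 -> r t ^+ 2 <= D /\ (r t)^-1 <= D.
Proof.
move=> t01; have [p1 _ p2] := wpath_bounds H0 Hx x1 t01.
have [q1 _ q2] := wpath_bounds K0 Kx x1' t01.
have p0 := wp0 t01; have q0 := wq0 t01; have r0 := curve_r_gt0 t01.
have D0 : 0 < D by apply: lt_le_trans D1.
have r2 := curve_r2 t01.
split.
  rewrite r2 ler_pdivrMr //; apply: le_trans p2 _.
  apply: (@le_trans _ _ (D * (K / 2))); first by rewrite mulrA; move: (D * K) HD => y; lra.
  by rewrite ler_pM2l.
have ri : r t ^- 2 <= D.
  rewrite r2 invf_div ler_pdivrMr //; apply: le_trans q2 _.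
  apply: (@le_trans _ _ (D * (H / 2))); first by rewrite mulrA; move: (D * H) KD => y; lra.
  by rewrite ler_pM2l.
rewrite -(@ler_pXn2r _ 2) ?nnegrE ?invr_ge0 ?(ltW r0) ?(ltW D0) // exprVn.
by apply: le_trans ri _; rewrite expr2 ler_peMl // ltW.
Qed.

Let C : R := 4 * (2 * (1 + D) * (2 + D)) * D.

(** Rewriting a = M E (1 - k^2) with E >= 1 / D, where h = s / r and k = s r, gives a >= M (1 - k) /
    D, and likewise b >= M (1 - h) / D. The singular factor M is thus common to both sides, and the
    pairing left by [gap_ineq] fits term by term. *)
Let dPsi_le N t : (0 < N)%N -> 0 < t < 1 ->
  `|dPsi N t| <= C * (`|(legendre R N).[x]| + `|(legendre R N.+1).[x]|) * dG N t.
Proof.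
move=> N0 t01; have /andP[t0 t1] := t01.
have t01' : 0 <= t <= 1 by rewrite !ltW.
have t01'' : 0 <= t < 1 by rewrite ltW.
have s0 : 0 < s t by apply: curve_s_gt0; rewrite t0 ltW.
have r0 := curve_r_gt0 t01'.
have h0 : 0 < s t / r t by rewrite divr_gt0.
have k0 : 0 < s t * r t by rewrite mulr_gt0.
have h1 := h_lt1 t01''; have k1 := k_lt1 t01''.
have hn : 0 < 1 - (s t / r t) ^+ 2 by rewrite subr_gt0 expr_lt1 // ltW.
have kn : 0 < 1 - (s t * r t) ^+ 2 by rewrite subr_gt0 expr_lt1 // ltW.
have M0 : 0 < M t by rewrite invr_gt0 mulr_gt0.
have D0 : 0 < D by apply: lt_le_trans D1.
have [rD riD] := curve_r_bound t01'.
rewrite dPsiE // -(mulrA N.+1%:R) normrM [`|N.+1%:R * _|]normrM.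
rewrite [`|M t / t|]ger0_norm ?divr_ge0 ?(ltW M0) ?(ltW t0) // (ger0_norm (ler0n R N.+1)).
have := boundary_term_le (legendre R N).[x] (legendre R N.+1).[x] N0 s0 r0 h1 k1 erefl erefl.
set X := `| s t * _ |; move=> HX.
set pp := `|(legendre R N).[x]| + `|(legendre R N.+1).[x]| in HX *.
have pp0 : 0 <= pp by rewrite addr_ge0.
set hN := (s t / r t) ^+ N.+1 in HX *; set kN := (s t * r t) ^+ N.+1 in HX *.
have hN0 : 0 < hN by rewrite exprn_gt0.
have kN0 : 0 < kN by rewrite exprn_gt0.
have s2 : s t ^+ 2 <= 1.
  have -> : s t ^+ 2 = (s t / r t) * (s t * r t) by field; rewrite gt_eqF.
  by rewrite mulr_ile1 // ltW.
have sqle (y : R) : 0 <= y -> Num.sqrt (1 + y) <= 1 + y.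
  move=> y0; have y1 : 1 <= 1 + y by rewrite lerDl.
  rewrite -[leRHS]ger0_norm ?addr_ge0 // -sqrtr_sqr ler_wsqrtr //.
  by rewrite expr2 ler_peMl // addr_ge0.
have Qle : Num.sqrt (1 + s t ^+ 2) * Num.sqrt (1 + r t ^+ 2) * (2 + (r t)^-1) <= 2 * (1 + D) * (2 + D).
  apply: ler_pM; rewrite ?mulr_ge0 ?sqrtr_ge0 ?addr_ge0 ?invr_ge0 ?(ltW r0) //; last by rewrite lerD2l.
  apply: ler_pM; rewrite ?sqrtr_ge0 //.
    by apply: le_trans (sqle _ (sqr_ge0 _)) _; lra.
  by apply: le_trans (sqle _ (sqr_ge0 _)) _; rewrite lerD2l.
have eh : D^-1 <= 1 - 2 * x * (s t / r t) + (s t / r t) ^+ 2.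
  have [_ + _] := wpath_root H0 Hx x1 t01''; rewrite -curve_ratio // => ->.
  have [_ _ p2] := wpath_bounds H0 Hx x1 t01'.
  rewrite ler_pdivlMr ?wp0 // mulrC ler_pdivrMr //.
  by apply: le_trans p2 _; rewrite -mulrA ler_pM2l // mulrC.
have ek : D^-1 <= 1 + 2 * x * (s t * r t) + (s t * r t) ^+ 2.
  have [_ + _] := wpath_root K0 Kx x1' t01''; rewrite -curve_prod // => E.
  have -> : 1 + 2 * x * (s t * r t) + (s t * r t) ^+ 2 = 2 * K / wq t by rewrite -E; ring.
  have [_ _ q2] := wpath_bounds K0 Kx x1' t01'.
  rewrite ler_pdivlMr ?wq0 // mulrC ler_pdivrMr //.
  by apply: le_trans q2 _; rewrite -mulrA ler_pM2l // mulrC.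
have ha : M t * D^-1 * (1 - s t * r t) <= a t.
  rewrite aE //; set E := 1 - 2 * x * _ + _ in eh *; move: eh => eh.
  have -> : E / (1 - (s t / r t) ^+ 2) = M t * E * (1 - (s t * r t) ^+ 2).
    rewrite /M; clearbody E; move: (1 - (s t / r t) ^+ 2) (1 - (s t * r t) ^+ 2) hn kn => u v u0 v0.
    by field; rewrite !gt_eqF.
  apply: ler_pM.
  - by rewrite mulr_ge0 ?(ltW M0) // invr_ge0 ltW.
  - by rewrite subr_ge0 ltW.
  - by rewrite ler_pM2l.
  - by rewrite lerD2l lerN2 expr2 ler_piMl // ltW.
have kb : M t * D^-1 * (1 - s t / r t) <= b t.
  rewrite bE //; set E := 1 + 2 * x * _ + _ in ek *.
  have -> : E / (1 - (s t * r t) ^+ 2) = M t * E * (1 - (s t / r t) ^+ 2).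
    rewrite /M; clearbody E; move: (1 - (s t / r t) ^+ 2) (1 - (s t * r t) ^+ 2) hn kn => u v u0 v0.
    by field; rewrite !gt_eqF.
  apply: ler_pM.
  - by rewrite mulr_ge0 ?(ltW M0) // invr_ge0 ltW.
  - by rewrite subr_ge0 ltW.
  - by rewrite ler_pM2l.
  - by rewrite lerD2l lerN2 expr2 ler_piMl // ltW.
have step : M t * X <= C * pp * (hN * a t + kN * b t).
  apply: (@le_trans _ _ (M t * (4 * (2 * (1 + D) * (2 + D)) * pp * (hN * (1 - s t * r t) + kN * (1 - s t / r t))))).
    rewrite ler_pM2l //; apply: le_trans HX _.
    have w0 : 0 <= hN * (1 - s t * r t) + kN * (1 - s t / r t).
      by rewrite addr_ge0 // mulr_ge0 ?subr_ge0 ?(ltW hN0) ?(ltW kN0) ?(ltW h1) ?(ltW k1).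
    by apply: ler_wpM2r => //; apply: ler_wpM2r => //; apply: ler_wpM2l.
  have -> : M t * (4 * (2 * (1 + D) * (2 + D)) * pp * (hN * (1 - s t * r t) + kN * (1 - s t / r t))) =
    C * pp * (hN * (M t * D^-1 * (1 - s t * r t)) + kN * (M t * D^-1 * (1 - s t / r t))).
    by rewrite /C; clearbody X hN kN pp; field; rewrite !gt_eqF.
  rewrite ler_wpM2l //; first by rewrite /C !mulr_ge0 ?addr_ge0 // ltW.
  by apply: lerD; rewrite ler_pM2l.
rewrite /dG -/hN -/kN.
have -> : M t / t * (N.+1%:R * X) = N.+1%:R / t * (M t * X) by ring.
have -> : C * pp * (N.+1%:R / t * (hN * a t + kN * b t)) = N.+1%:R / t * (C * pp * (hN * a t + kN * b t)) by ring.
by rewrite ler_pM2l // divr_gt0.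
Qed.

Lemma curve_estimate N : (0 < N)%N ->
  `|\sum_(l < N.+1) (legendre R l).[x] * radial_coef l (s 1) (r 1) - (1 - r 0 ^+ 2) / (2 * r 0)| <=
  4 * (2 * (1 + D) * (2 + D)) * D * (`|(legendre R N).[x]| + `|(legendre R N.+1).[x]|) *
   ((s 1 / r 1) ^+ N.+1 + (s 1 * r 1) ^+ N.+1).
Proof.
move=> N0; rewrite -/(Psi N 1) -(Psi_at0 N) -/C.
set pp := `|_| + _.
have G0 : G N 0 = 0 by rewrite /G /s mulr0 !mul0r expr0n addr0.
have -> : (s 1 / r 1) ^+ N.+1 + (s 1 * r 1) ^+ N.+1 = G N 1 - G N 0 by rewrite G0 subr0.
have -> : C * pp * (G N 1 - G N 0) = C * pp * G N 1 - C * pp * G N 0 by ring.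
have cr t : 0 <= t <= 1 -> {for t, continuous (fun t => (r t)^-1)}.
  by move=> h; apply: cvgV; [rewrite gt_eqF // curve_r_gt0 | exact: curve_r_continuous].
have cX (f : R -> R) n t : {for t, continuous f} -> {for t, continuous (fun t => f t ^+ n)}.
  move=> cf; apply: (@continuous_comp _ _ _ f (fun y => y ^+ n)); first exact: cf.
  exact: exprn_continuous.
have cG : {in `[0, 1]%classic, continuous (G N)}.
  move=> t; rewrite inE /= in_itv /= => t01.
  apply: cvgD.
    apply: (cX (fun t => s t / r t)).
    by apply: cvgM; [exact: curve_s_continuous|exact: cr].
  apply: (cX (fun t => s t * r t)).
  by apply: cvgM; [exact: curve_s_continuous|exact: curve_r_continuous].
have cu l t : 0 <= t <= 1 -> {for t, continuous (fun t => usol l (s t))}.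
  move=> t01; apply: (@continuous_comp _ _ _ s (usol l)); first exact: curve_s_continuous.
  exact: usol_continuous.
have cv l t : 0 <= t <= 1 -> {for t, continuous (fun t => vsol l (r t))}.
  move=> t01; apply: (@continuous_comp _ _ _ r (vsol l)); first exact: curve_r_continuous.
  exact: (isd_cvg (is_derive_vsol l (curve_r_gt0 t01))).
have cP : {in `[0, 1]%classic, continuous (Psi N)}.
  move=> t; rewrite inE /= in_itv /= => t01.
  rewrite /Psi; elim: N.+1 => [|n IH].
    rewrite (_ : (fun t => _) = fun=> 0); first exact: cvg_cst.
    by apply/funext => y; rewrite big_ord0.
  rewrite (_ : (fun t => _) = fun t => \sum_(l < n) (legendre R l).[x] * radial_coef l (s t) (r t) +
      (legendre R n).[x] * radial_coef n (s t) (r t)); last first.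
    by apply/funext => y; rewrite big_ord_recr.
  apply: cvgD; first exact: IH.
  by apply: cvgMr; apply: cvgMr; apply: cvgM; [exact: cu|exact: cv].
pose g t := C * pp * G N t; pose dg t := C * pp * dG N t.
have dP t : t \in `]0, 1[ -> is_derive t 1 (Psi N) (dPsi N t).
  by rewrite in_itv /= => t01; exact: is_derive_Psi.
have dg' t : t \in `]0, 1[ -> is_derive t 1 g (dg t).
  by rewrite in_itv /= => t01; apply: isdZ; exact: is_derive_G.
have le t : t \in `]0, 1[ -> `|dPsi N t| <= dg t.
  by rewrite in_itv /= => t01; exact: dPsi_le.
have cg : {within `[0, 1], continuous g}.
  by apply: continuous_in_subspaceT => t ht; apply: cvgMr; exact: cG.
have cP' : {within `[0, 1], continuous (Psi N)} by exact: continuous_in_subspaceT.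
exact: (le_dist_of_derive ler01 cP' cg dP dg' le).
Qed.

End Curve.

Section Estimate.
Variable R : realType.
Implicit Types (x s r h k e B H K : R) (n l N : nat).

Lemma addrV_ge2 h : 0 < h -> 2 <= h + h^-1.
Proof.
move=> h0; rewrite -subr_ge0.
have -> : h + h^-1 - 2 = (h - 1) ^+ 2 / h by field; rewrite gt_eqF.
by rewrite divr_ge0 ?sqr_ge0 // ltW.
Qed.

Definition estimate_const e B : R :=
  4 * (2 * (1 + 4 * (B + 2) / e) * (2 + 4 * (B + 2) / e)) * (4 * (B + 2) / e).

(** The given point is the end t = 1 of its curve, whose start has r = sqrt (H / K) = tan (Theta /
    2). Only the bounds e and B on H and K enter the constant, so it can be used uniformly in the
    azimuth. *)
Lemma radial_estimate e B s r x H K N :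
  0 < e -> 0 < s -> 0 < r -> s / r <= 1 -> s * r <= 1 -> `|x| <= 1 ->
  H = s / r + r / s - 2 * x -> K = s * r + (s * r)^-1 + 2 * x ->
  e <= H <= B -> e <= K <= B -> (0 < N)%N ->
  `|\sum_(l < N.+1) (legendre R l).[x] * radial_coef l s r -
    (1 - H / K) / (2 * Num.sqrt (H / K))| <=
  estimate_const e B * (`|(legendre R N).[x]| + `|(legendre R N.+1).[x]|) *
   ((s / r) ^+ N.+1 + (s * r) ^+ N.+1).
Proof.
move=> e0 s0 r0 h1 k1 x1 HE KE /andP[eH HB] /andP[eK KB] N0.
have H0 : 0 < H by exact: lt_le_trans eH.
have K0 : 0 < K by exact: lt_le_trans eK.
have h0 : 0 < s / r by rewrite divr_gt0.
have k0 : 0 < s * r by rewrite mulr_gt0.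
have Vh : (s / r)^-1 = r / s by rewrite invf_div.
have HE' : H = s / r + (s / r)^-1 - 2 * x by rewrite Vh.
have KE' : K = s * r + (s * r)^-1 - 2 * - x by rewrite KE; ring.
have Hx : 0 <= H + 2 * x - 2 by rewrite HE'; have := addrV_ge2 h0; lra.
have Kx : 0 <= K + 2 * (- x) - 2 by rewrite KE'; have := addrV_ge2 k0; lra.
have t1 : (0 : R) <= (1 : R) <= (1 : R) by rewrite ler01 ?lexx.
have t0 : (0 : R) <= (0 : R) <= (1 : R) by rewrite ler01 ?lexx.
have h01 : 0 < s / r <= 1 by rewrite h0.
have k01 : 0 < s * r <= 1 by rewrite k0.
have rat := curve_ratio x1 H0 K0 Hx Kx t1.
have prd := curve_prod x1 H0 K0 Hx Kx t1.
have rr1 := curve_r2 x1 H0 K0 Hx Kx t1.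
have rr0 := curve_r2 x1 H0 K0 Hx Kx t0.
have r1_gt0 := curve_r_gt0 x1 H0 K0 Hx Kx t1.
have r0_gt0 := curve_r_gt0 x1 H0 K0 Hx Kx t0.
rewrite /= (wpath_at1 h01 HE') in rat; rewrite /= (wpath_at1 k01 KE') in prd.
rewrite /= (wpath_at1 h01 HE') (wpath_at1 k01 KE') in rr1.
rewrite /= (wpath_at0 _ H0) (wpath_at0 _ K0) in rr0.
have r1E : curve_r x H K 1 = r.
  apply/eqP; rewrite -(@eqrXn2 _ 2) ?(ltW r1_gt0) ?(ltW r0) // rr1; apply/eqP.
  by field; rewrite !gt_eqF.
have s1E : curve_s x H K 1 = s.
  move: rat; rewrite r1E => E; rewrite -[LHS](@divfK _ r) ?gt_eqF // E.
  by field; rewrite !gt_eqF.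
have r0E : curve_r x H K 0 = Num.sqrt (H / K).
  rewrite -[LHS]ger0_norm ?(ltW r0_gt0) // -sqrtr_sqr rr0; congr Num.sqrt.
  by field; rewrite gt_eqF.
have B0 : 0 < B by exact: lt_le_trans HB.
set D := 4 * (B + 2) / e.
have De : D * e = 4 * (B + 2) by rewrite /D divfK // gt_eqF.
have D0 : 0 <= D by rewrite /D divr_ge0 ?(ltW e0) //; lra.
have DH : D * e <= D * H by rewrite ler_wpM2l.
have DK : D * e <= D * K by rewrite ler_wpM2l.
have D1 : 1 <= D.
  rewrite /D ler_pdivlMr // mul1r; lra.
have E1 : 4 * (H + 2) <= D * K by lra.
have E2 : 4 * (K + 2) <= D * H by lra.
have E3 : H + 2 <= D * H by lra.
have E4 : K + 2 <= D * K by lra.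
have := curve_estimate x1 H0 K0 Hx Kx D1 E1 E2 E3 E4 N0.
rewrite r1E s1E r0E sqr_sqrtr; last by rewrite divr_ge0 ?(ltW H0) ?(ltW K0).
by rewrite /estimate_const -/D.
Qed.

(** Dominated convergence over the open interval: at psi = 0 or pi the Legendre argument can be 1 or
    -1, where pointwise convergence may fail. *)
Lemma int0pi_cvg0 (f : nat -> R -> R) (C : R) : (forall n, continuous (f n)) ->
  (forall n psi, `|f n psi| <= C) ->
  (forall psi, 0 < psi < pi -> f n psi @[n --> \oo] --> 0) ->
  int0pi (f n) @[n --> \oo] --> 0.
Proof.
move=> cf fC f0.
have I n : int0pi (f n) = \int[lebesgue_measure]_(psi in `]0, pi[) f n psi.
  have if0 := integrable0pi (cf n).
  have if1 : (@lebesgue_measure R).-integrable `]0, pi] (EFin \o f n).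
    by apply: integrableS if0 => //; apply: subset_itv; rewrite bnd_simp.
  rewrite /int0pi -Rintegral_itv_obnd_cbnd // -Rintegral_itv_bndo_bndc //.
  by apply: integrableS if1 => //; apply: subset_itv; rewrite bnd_simp.
rewrite (_ : (fun n => _) = fun n => \int[lebesgue_measure]_(psi in `]0, pi[) f n psi); last first.
  by apply/funext.
have mD : measurable (`]0, pi[ : set R) by exact: measurable_itv.
have := @dominated_cvg _ _ R (@lebesgue_measure R) `]0, pi[ mD
  (fun n => EFin \o f n) (fun=> 0%:E) (fun=> C%:E).
move=> /(_ _ _ _ _ _); rewrite integral0 => h.
apply: (@fine_cvg _ _ _ _ _ 0); apply: h.
- move=> n; apply: (measurable_int (@lebesgue_measure R)).
  by apply: integrableS (integrable0pi (cf n)) => //; apply: subset_itv; rewrite bnd_simp.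
- move=> x; rewrite /= in_itv /= => hx; apply: cvg_EFin; first by near=> n.
  exact: f0.
- by [].
- have ic : (@lebesgue_measure R).-integrable `[0, pi] (EFin \o (fun=> C)).
    by apply: integrable0pi => y; exact: cvg_cst.
  by apply: integrableS ic => //; apply: subset_itv; rewrite bnd_simp.
- by move=> n x _; rewrite /= lee_fin.
Unshelve. all: by end_near.
Qed.

End Estimate.

(** * Integration over the azimuth *)

Section Series.
Variable R : realType.
Implicit Types (x s r h k e B H K : R) (n l N : nat).

Lemma cvg0_le (u v : nat -> R) : (forall n, `|u n| <= v n) ->
  v n @[n --> \oo] --> 0 -> u n @[n --> \oo] --> 0.
Proof.
move=> uv v0; apply/norm_cvg0P; apply: (squeeze_cvgr _ (cvg_cst 0) v0).
by near=> n; rewrite normr_ge0 uv.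
Unshelve. all: by end_near.
Qed.

Lemma int0pi_sum (f : nat -> R -> R) (c : nat -> R) M : (forall l, continuous (f l)) ->
  int0pi (fun psi => \sum_(l < M) c l * f l psi) = \sum_(l < M) c l * int0pi (f l).
Proof.
move=> cf.
have cs N : continuous (fun psi => \sum_(l < N) c l * f l psi).
  elim: N => [|N IH] psi.
    rewrite (_ : (fun psi => _) = fun=> 0); first exact: cvg_cst.
    by apply/funext => y; rewrite big_ord0.
  rewrite (_ : (fun psi => _) = fun psi => \sum_(l < N) c l * f l psi + c N * f N psi).
    by apply: cvgD; [exact: IH | apply: cvgMr; exact: cf].
  by apply/funext => y; rewrite big_ord_recr.
elim: M => [|M IH].
  rewrite big_ord0 (_ : (fun psi => _) = fun=> 0) ?int0pi_cst ?mul0r //.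
  by apply/funext => y; rewrite big_ord0.
rewrite big_ord_recr /= -IH -int0piZ // -int0piD //; last first.
  by move=> psi; apply: cvgMr; exact: cf.
by apply: eq_int0pi => psi; rewrite big_ord_recr.
Qed.

Lemma cos_mix_le (a b y : R) : 0 <= sin a * sin b ->
  `|cos a * cos b + sin a * sin b * cos y| <= 1.
Proof.
move=> Y0; have := cos_le1 (a - b); have := cos_geN1 (a + b).
rewrite cosB cosD ler_norml => h1 h2.
have := ler_wpM2l Y0 (cos_le1 y); have := ler_wpM2l Y0 (cos_geN1 y).
move: (sin a * sin b) (cos a * cos b) (_ * cos y) h1 h2 => Y c z h1 h2 h3 h4.
by apply/andP; split; lra.
Qed.

Lemma cos_mix_lt (a b y : R) : 0 < sin a * sin b -> 0 < y < pi ->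
  `|cos a * cos b + sin a * sin b * cos y| < 1.
Proof.
move=> Y0 /andP[y0 yp]; have := cos_le1 (a - b); have := cos_geN1 (a + b).
have c1 : cos y < 1.
  by rewrite -cos0 ltr_cos // in_itv /= ?lexx ?pi_ge0 ?(ltW y0) ?(ltW yp).
have c2 : -1 < cos y.
  by rewrite -cospi ltr_cos // in_itv /= ?lexx ?pi_ge0 ?(ltW y0) ?(ltW yp).
rewrite cosB cosD ltr_norml => h1 h2.
rewrite -(ltr_pM2l Y0) in c1; rewrite -(ltr_pM2l Y0) in c2.
move: (sin a * sin b) (cos a * cos b) (_ * cos y) h1 h2 c1 c2 => Y c z h1 h2 h3 h4.
by apply/andP; split; lra.
Qed.

Lemma norm_cos_lt1 (a : R) : sin a != 0 -> `|cos a| < 1.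
Proof.
move=> sa; rewrite -(@expr_lt1 _ 2) // -normrX ger0_norm ?sqr_ge0 //.
by rewrite cos2sin2 ltrBlDr ltrDl lt_def sqr_ge0 sqrf_eq0 sa.
Qed.

Lemma radial_series_cvg (a b s r : R) n :
  0 <= sin a -> 0 <= sin b -> 0 < s -> 0 < r -> s / r <= 1 -> s * r <= 1 ->
  0 < s / r + r / s - 2 * (cos a * cos b + sin a * sin b) ->
  0 < s * r + (s * r)^-1 + 2 * (cos a * cos b - sin a * sin b) ->
  (n = 0%N -> sin a = 0 -> sin b = 0 -> s / r < 1 /\ s * r < 1) ->
  forall X : R -> R, (forall psi, X psi = cos a * cos b + sin a * sin b * cos psi) ->
  forall T : R -> R, (forall psi, T psi = (s / r + r / s - 2 * X psi) /
                                (s * r + (s * r)^-1 + 2 * X psi)) ->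
  \sum_(l < N.+1) radial_coef l s r *
     int0pi (fun psi => (legendre R l).[X psi] * cos (n%:R * psi)) @[N --> \oo] -->
  int0pi (fun psi => (1 - T psi) / (2 * Num.sqrt (T psi)) * cos (n%:R * psi)).
Proof.
move=> a0 b0 s0 r0 h1 k1 Hp Kp hp X XE T TE.
have ab0 : 0 <= sin a * sin b by rewrite mulr_ge0.
have XY psi : cos a * cos b - sin a * sin b <= X psi <= cos a * cos b + sin a * sin b.
  rewrite XE; have := ler_wpM2l ab0 (cos_le1 psi); have := ler_wpM2l ab0 (cos_geN1 psi).
  by move: (_ * cos psi) => z h2 h3; apply/andP; split; lra.
have X1 psi : `|X psi| <= 1 by rewrite XE; exact: cos_mix_le.
have ccos : continuous (fun psi : R => cos (n%:R * psi)) by exact: continuous_cosn.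
have cX : continuous X.
  have -> : X = fun psi => cos a * cos b + sin a * sin b * cos psi by apply/funext.
  move=> psi; apply: cvgD; first exact: cvg_cst.
  by apply: cvgMr; exact: continuous_cos.
have cP l : continuous (fun psi => (legendre R l).[X psi]).
  move=> psi; apply: (@continuous_comp _ _ _ X (fun x => (legendre R l).[x])); first exact: cX.
  exact: continuous_horner.
set h := s / r + r / s; set k := s * r + (s * r)^-1.
set Hm := h - 2 * (cos a * cos b + sin a * sin b) in Hp.
set Km := k + 2 * (cos a * cos b - sin a * sin b) in Kp.
(* h - 2 X is least at psi = 0 and k + 2 X at psi = pi, so [e] bounds both from below for all
   psi. *)
pose e := Num.min Hm Km; pose B := h + k + 2.
have e0 : 0 < e by rewrite lt_min Hp.
have hge : 2 <= h.
  by have := @addrV_ge2 R (s / r); rewrite invf_div; apply; rewrite divr_gt0.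
have kge : 2 <= k by apply: addrV_ge2; rewrite mulr_gt0.
have eH psi : e <= h - 2 * X psi <= B.
  have := XY psi; have := X1 psi; rewrite ler_norml => /andP[h2 h3] /andP[h4 h5].
  apply/andP; split; last by rewrite /B; lra.
  by rewrite ge_min; apply/orP; left; rewrite /Hm; lra.
have eK psi : e <= k + 2 * X psi <= B.
  have := XY psi; have := X1 psi; rewrite ler_norml => /andP[h2 h3] /andP[h4 h5].
  apply/andP; split; last by rewrite /B; lra.
  by rewrite ge_min; apply/orP; right; rewrite /Km; lra.
pose g psi := (1 - T psi) / (2 * Num.sqrt (T psi)).
have T0 psi : 0 < T psi.
  rewrite TE divr_gt0 //; apply: lt_le_trans e0 _; first by case/andP: (eH psi).
  by case/andP: (eK psi).
have cT : continuous T.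
  have -> : T = fun psi => (h - 2 * X psi) / (k + 2 * X psi) by apply/funext.
  move=> psi; apply: cvgM.
    by apply: cvgB; [exact: cvg_cst | apply: cvgMr; exact: cX].
  apply: cvgV; last by apply: cvgD; [exact: cvg_cst | apply: cvgMr; exact: cX].
  by rewrite gt_eqF //; apply: lt_le_trans e0 _; case/andP: (eK psi).
have cg : continuous g.
  move=> psi; apply: cvgM; first by apply: cvgB; [exact: cvg_cst | exact: cT].
  apply: cvgV; first by rewrite mulf_neq0 // gt_eqF // sqrtr_gt0.
  apply: cvgMr; apply: (@continuous_comp _ _ _ T Num.sqrt); first exact: cT.
  exact: sqrt_continuous.
pose F l psi := (legendre R l).[X psi] * cos (n%:R * psi).
have cF l : continuous (F l).
  by move=> psi; apply: cvgM; [exact: cP | exact: ccos].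
rewrite -/(g _) -/(F _).
(* The shift to [N.+2] terms lets [radial_estimate] be applied at the positive index N + 1. *)
pose Z N psi := \sum_(l < N.+2) radial_coef l s r * F l psi - g psi * cos (n%:R * psi).
have cS N : continuous (fun psi => \sum_(l < N) radial_coef l s r * F l psi).
  elim: N => [|N IH] psi.
    rewrite (_ : (fun psi => _) = fun=> 0); first exact: cvg_cst.
    by apply/funext => y; rewrite big_ord0.
  rewrite (_ : (fun psi => _) = fun psi => \sum_(l < N) radial_coef l s r * F l psi + radial_coef N s r * F N psi).
    by apply: cvgD; [exact: IH | apply: cvgMr; exact: cF].
  by apply/funext => y; rewrite big_ord_recr.
have cgc : continuous (fun psi => g psi * cos (n%:R * psi)).
  by move=> psi; apply: cvgM; [exact: cg | exact: ccos].
have cZ N : continuous (Z N).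
  by move=> psi; apply: cvgB; [exact: cS | exact: cgc].
(* Here X does not depend on psi, and both sides vanish because cos (n psi) has mean zero. The
   pointwise bound could fail to tend to 0, as |X| may be 1. *)
have [n0|nY] := boolP ((0 < n)%N && (sin a * sin b == 0)).
  case/andP: n0 => n0 /eqP Y0.
  have Xc psi : X psi = cos a * cos b by rewrite XE Y0 mul0r addr0.
  have z0 (c : R) (f : R -> R) : (forall psi, f psi = c) ->
      int0pi (fun psi => f psi * cos (n%:R * psi)) = 0.
    move=> fc; rewrite (@eq_int0pi _ _ (fun psi => c * cos (n%:R * psi))) => [|y].
      by rewrite int0piZ // int0pi_cosn (gtn_eqF n0) mul0r mulr0.
    by rewrite fc.
  rewrite (z0 (g 0)) => [|psi]; last by rewrite /g !TE !Xc.
  rewrite (_ : (fun N => _) = fun=> 0); first exact: cvg_cst.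
  apply/funext => N; rewrite big1 // => l _.
  by rewrite (z0 (legendre R l).[cos a * cos b]) ?mulr0 // => psi; rewrite Xc.
have Zle N psi : `|Z N psi| <= estimate_const e B *
    ((`|(legendre R N.+1).[X psi]| + `|(legendre R N.+2).[X psi]|) *
    ((s / r) ^+ N.+2 + (s * r) ^+ N.+2)).
  have -> : Z N psi = (\sum_(l < N.+2) (legendre R l).[X psi] * radial_coef l s r - g psi) *
                      cos (n%:R * psi).
    rewrite mulrBl mulr_suml; congr (_ - _); apply: eq_bigr => l _.
    by rewrite mulrCA mulrA.
  rewrite normrM; apply: le_trans (_ : _ <= _ * 1) _.
    by apply: ler_wpM2l => //; rewrite ler_norml cos_geN1 cos_le1.
  rewrite mulr1 mulrA /g TE.
  exact: (@radial_estimate R e B s r (X psi) (h - 2 * X psi) (k + 2 * X psi)).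
have C0 : 0 <= estimate_const e B.
  have D0 : 0 <= 4 * (B + 2) / e by rewrite divr_ge0 ?(ltW e0) // /B; lra.
  rewrite /estimate_const; move: (4 * _ / e) D0 => D D0.
  by rewrite !mulr_ge0 ?addr_ge0.
have h0 : 0 <= s / r by rewrite divr_ge0 ?ltW.
have k0 : 0 <= s * r by rewrite mulr_ge0 ?ltW.
have P2 N psi : `|(legendre R N.+1).[X psi]| + `|(legendre R N.+2).[X psi]| <= 2.
  by apply: lerD; exact: legendre_le1.
have hk2 N : (s / r) ^+ N.+2 + (s * r) ^+ N.+2 <= 2.
  by apply: lerD; rewrite exprn_ile1.
have hk0 N : 0 <= (s / r) ^+ N.+2 + (s * r) ^+ N.+2 by rewrite addr_ge0 ?exprn_ge0.
have Zb N psi : `|Z N psi| <= estimate_const e B * (2 * 2).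
  apply: le_trans (Zle N psi) _; apply: ler_wpM2l => //.
  by apply: ler_pM => //; rewrite addr_ge0.
have Z0 psi : 0 < psi < pi -> Z N psi @[N --> \oo] --> 0.
  move=> hpsi.
  (* Two sources of decay: P_N(X) -> 0, or geometric decay when X is 1 or -1, which is left only for
     n = 0 with both points at poles. *)
  have [x1|[h1' k1']] : `|X psi| < 1 \/ s / r < 1 /\ s * r < 1.
    have [Y0|Y0] := eqVneq (sin a * sin b) 0; last first.
      by left; rewrite XE; apply: cos_mix_lt => //; rewrite lt_def Y0.
    have n0 : n = 0%N by move: nY; rewrite Y0 eqxx andbT -eqn0Ngt => /eqP.
    have [sb0|sb0] := eqVneq (sin b) 0; have [sa0|sa0] := eqVneq (sin a) 0.
    - by right; exact: hp.
    - left; rewrite XE Y0 mul0r addr0 normrM.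
      by apply: le_lt_trans (norm_cos_lt1 sa0); rewrite ler_piMr // ler_norml cos_geN1 cos_le1.
    - left; rewrite XE Y0 mul0r addr0 normrM.
      by apply: le_lt_trans (norm_cos_lt1 sb0); rewrite ler_piMl // ler_norml cos_geN1 cos_le1.
    - by move/eqP: Y0; rewrite mulf_eq0 (negPf sa0) (negPf sb0).
  - have v0 : estimate_const e B *
        ((`|(legendre R N.+1).[X psi]| + `|(legendre R N.+2).[X psi]|) * 2) @[N --> \oo] --> 0.
      rewrite -[X in _ --> X](mulr0 (estimate_const e B)); apply: cvgMr.
      rewrite -[X in _ --> X](mul0r 2); apply: cvgMl.
      rewrite -[X in _ --> X](addr0 0); apply: cvgD; apply/norm_cvg0P.
        by rewrite (cvg_shiftS (fun N => (legendre R N).[X psi])); exact: legendre_cvg0.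
      rewrite (cvg_shiftS (fun N => (legendre R N.+1).[X psi])).
      by rewrite (cvg_shiftS (fun N => (legendre R N).[X psi])); exact: legendre_cvg0.
    apply: (cvg0_le _ v0) => N; apply: le_trans (Zle N psi) _.
    by apply: ler_wpM2l => //; apply: ler_wpM2l => //; rewrite addr_ge0.
  - have v0 : estimate_const e B * (2 * ((s / r) ^+ N.+2 + (s * r) ^+ N.+2)) @[N --> \oo] --> 0.
      rewrite -[X in _ --> X](mulr0 (estimate_const e B)); apply: cvgMr.
      rewrite -[X in _ --> X](mulr0 2); apply: cvgMr.
      rewrite -[X in _ --> X](addr0 0).
      have geo (q : R) : 0 <= q -> q < 1 -> q ^+ N.+2 @[N --> \oo] --> 0.
        move=> q0 q1; rewrite (cvg_shiftS (fun N => q ^+ N.+1)).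
        by rewrite (cvg_shiftS (fun N => q ^+ N)); apply: cvg_expr; rewrite ger0_norm.
      by apply: cvgD; exact: geo.
    apply: (cvg0_le _ v0) => N; apply: le_trans (Zle N psi) _.
    by apply: ler_wpM2l => //; apply: ler_wpM2r.
have IZ : int0pi (Z N) @[N --> \oo] --> 0 by exact: int0pi_cvg0 Zb Z0.
set I := int0pi _; rewrite -(cvg_shiftS (fun N => \sum_(l < N.+1) _)).
have E N : \sum_(l < N.+2) radial_coef l s r * int0pi (F l) = int0pi (Z N) + I.
  by rewrite (int0piB (cS N.+2) cgc) (int0pi_sum (fun l => radial_coef l s r) _ cF) subrK.
rewrite (_ : (fun N => _) = fun N => int0pi (Z N) + I); last by apply/funext.
have := cvgD IZ (cvg_cst I); rewrite add0r; exact.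
Qed.

End Series.

(** * Translation from angles to half-angle tangents *)

Section HalfAngle.
Variable R : realType.
Implicit Types (t a b s r x u T psi : R) (n l N : nat) (m : int).

Definition tan_half t : R := sin t / (1 + cos t).

Lemma tan_halfP t : 0 < t < pi ->
  [/\ 0 < tan_half t,
      cos t = (1 - tan_half t ^+ 2) / (1 + tan_half t ^+ 2) &
      sin t = 2 * tan_half t / (1 + tan_half t ^+ 2)].
Proof.
move=> t0p; have s0 := sin_gt0_pi t0p; have cs := cos2Dsin2 t.
have c0 : 0 < 1 + cos t.
  rewrite ltNge; apply/negP => h; have c1 := cos_geN1 t.
  have c2 : cos t = -1 by lra.
  have : 0 < sin t ^+ 2 by rewrite exprn_gt0.
  by move: cs; rewrite c2; move: (sin t ^+ 2) => z; lra.
have E : 1 + tan_half t ^+ 2 = 2 / (1 + cos t).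
  have -> : tan_half t ^+ 2 = (1 - cos t ^+ 2) / (1 + cos t) ^+ 2.
    by rewrite expr_div_n sin2cos2.
  by field; rewrite gt_eqF.
split; first by rewrite divr_gt0.
  have -> : 1 - tan_half t ^+ 2 = 2 - (1 + tan_half t ^+ 2) by ring.
  by rewrite E; move: (cos t) c0 => c c0; field; rewrite gt_eqF.
by rewrite E /tan_half; move: (cos t) (sin t) c0 => c y c0; field; rewrite gt_eqF.
Qed.

Lemma tan_half_compare a b s r : 0 < s -> 0 < r ->
  cos a = (1 - s ^+ 2) / (1 + s ^+ 2) -> cos b = (1 - r ^+ 2) / (1 + r ^+ 2) ->
  [/\ (s / r <= 1) = (cos b <= cos a), (s / r < 1) = (cos b < cos a),
      (s * r <= 1) = (0 <= cos a + cos b) & (s * r < 1) = (0 < cos a + cos b)].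
Proof.
move=> s0 r0 -> ->.
have p1 : 0 < 1 + s ^+ 2 by rewrite ltr_wpDr ?sqr_ge0.
have p2 : 0 < 1 + r ^+ 2 by rewrite ltr_wpDr ?sqr_ge0.
have p3 : 0 < 2 / ((1 + s ^+ 2) * (1 + r ^+ 2)) by rewrite divr_gt0 ?mulr_gt0.
have E1 : (1 - s ^+ 2) / (1 + s ^+ 2) - (1 - r ^+ 2) / (1 + r ^+ 2) =
  2 / ((1 + s ^+ 2) * (1 + r ^+ 2)) * (r ^+ 2 - s ^+ 2).
  by field; rewrite !gt_eqF.
have E2 : (1 - s ^+ 2) / (1 + s ^+ 2) + (1 - r ^+ 2) / (1 + r ^+ 2) =
  2 / ((1 + s ^+ 2) * (1 + r ^+ 2)) * (1 - (s * r) ^+ 2).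
  by field; rewrite !gt_eqF.
have sr0 : 0 < s * r by rewrite mulr_gt0.
split.
- by rewrite ler_pdivrMr // mul1r -[RHS]subr_ge0 E1 pmulr_rge0 // subr_ge0 ler_sqr // nnegrE ltW.
- by rewrite ltr_pdivrMr // mul1r -[RHS]subr_gt0 E1 pmulr_rgt0 // subr_gt0 ltr_sqr // nnegrE ltW.
- by rewrite E2 pmulr_rge0 // subr_ge0 expr_le1 // ltW.
- by rewrite E2 pmulr_rgt0 // subr_gt0 expr_lt1 // ltW.
Qed.

Lemma cos_sepE a0 b0 a b psi : cos_sep a0 b0 a b psi =
  cos a0 * cos b0 + sin a0 * sin b0 * (cos a * cos b + sin a * sin b * cos psi).
Proof. by rewrite /cos_sep /coefA /coefB; ring. Qed.

(** The common prefactor drops out of the quotient, which is tan^2 (Theta / 2). *)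
Lemma cos_sep_half a0 b0 s r x : 0 < s -> 0 < r ->
  cos a0 = (1 - s ^+ 2) / (1 + s ^+ 2) -> cos b0 = (1 - r ^+ 2) / (1 + r ^+ 2) ->
  sin a0 = 2 * s / (1 + s ^+ 2) -> sin b0 = 2 * r / (1 + r ^+ 2) ->
  1 - (cos a0 * cos b0 + sin a0 * sin b0 * x) =
    2 * (s * r) / ((1 + s ^+ 2) * (1 + r ^+ 2)) * (s / r + r / s - 2 * x) /\
  1 + (cos a0 * cos b0 + sin a0 * sin b0 * x) =
    2 * (s * r) / ((1 + s ^+ 2) * (1 + r ^+ 2)) * (s * r + (s * r)^-1 + 2 * x).
Proof.
move=> s0 r0 -> -> -> ->.
have p1 : 0 < 1 + s ^+ 2 by rewrite ltr_wpDr ?sqr_ge0.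
have p2 : 0 < 1 + r ^+ 2 by rewrite ltr_wpDr ?sqr_ge0.
by split; field; rewrite !gt_eqF.
Qed.

Lemma cot_sep u T : `|u| < 1 -> T = (1 - u) / (1 + u) ->
  u / Num.sqrt (1 - u ^+ 2) = (1 - T) / (2 * Num.sqrt T).
Proof.
rewrite ltr_norml => /andP[u1 u2] TE.
have p : 0 < 1 + u by lra.
have T0 : 0 < T by rewrite TE divr_gt0 //; lra.
have -> : 1 - u ^+ 2 = T * (1 + u) ^+ 2 by rewrite TE; field; rewrite gt_eqF.
rewrite sqrtrM ?(ltW T0) // sqrtr_sqr ger0_norm ?(ltW p) //.
have -> : 1 - T = 2 * u / (1 + u) by rewrite TE; field; rewrite gt_eqF.
have : 0 < Num.sqrt T by rewrite sqrtr_gt0.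
by move: (Num.sqrt T) => q q0; field; rewrite !gt_eqF.
Qed.

Lemma cos_absz m psi : cos (m%:~R * psi) = cos ((`|m|%N)%:R * psi) :> R.
Proof.
case: m => n //; rewrite NegzE mulrNz mulNr cosN abszN //.
Qed.

(** The sign of m is immaterial: for m < 0 the two Ferrers functions bring the square of the
    factorial ratio that [factorial_ratio] inverts, and for m > 0 the two phases (-1)^m multiply to
    1. *)
Lemma ferrers_product l m a b :
  0 <= sin a -> 0 <= sin b -> (`|m| <= l)%N ->
  factorial_ratio R l m * ferrersP l%:R m%:~R (cos a) * ferrersP l%:R m%:~R (cos b) =
  (l - `|m|)`!%:R / (l + `|m|)`!%:R * (sin a * sin b) ^+ `|m| *
  dlegendre l `|m| (cos a) * dlegendre l `|m| (cos b).
Proof.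
move=> a0 b0 ml.
have ca : `|cos a| <= 1 by rewrite ler_norml cos_geN1 cos_le1.
have cb : `|cos b| <= 1 by rewrite ler_norml cos_geN1 cos_le1.
have [n [nE [mE|[n0 mE]]]] : exists n : nat, `|m|%N = n /\
   (m = n%:Z \/ (0 < n)%N /\ m = - n%:Z).
  by exists `|m|%N; split => //; case: m ml => n _ /=; [left|right].
- rewrite nE in ml *; rewrite mE.
  have -> : factorial_ratio R l n = (l - n)`!%:R / (l + n)`!%:R.
    rewrite /factorial_ratio -PoszD /=; congr ((_)`!%:R / _); lia.
  rewrite !(ferrersP_nat _ _ ca a0 (sin2cos2 a)) !(ferrersP_nat _ _ cb b0 (sin2cos2 b)).
  have -> : (sin a * sin b) ^+ n = (- sin a) ^+ n * (- sin b) ^+ n by rewrite -exprMn mulrNN.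
  by ring.
- rewrite nE in ml *; rewrite mE.
  have -> : factorial_ratio R l (- n%:Z) = (l + n)`!%:R / (l - n)`!%:R.
    rewrite /factorial_ratio opprK -PoszD /=; congr (_ / (_)`!%:R); lia.
  have nl : (0 < n <= l)%N by rewrite n0.
  rewrite mulrNz (ferrersP_negnat nl ca a0 (sin2cos2 a)) (ferrersP_negnat nl cb b0 (sin2cos2 b)).
  have f1 : (l + n)`!%:R != 0 :> R by rewrite pnatr_eq0 -lt0n fact_gt0.
  have f2 : (l - n)`!%:R != 0 :> R by rewrite pnatr_eq0 -lt0n fact_gt0.
  rewrite exprMn; move: (_%:R) (_%:R) (_ ^+ n) (_ ^+ n) (dlegendre _ _ _) (dlegendre _ _ _) f1 f2.
  by move=> p q y z d e f1 f2; field; rewrite f1.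
Qed.

End HalfAngle.

Lemma ler_cos (R : realType) : {in `[0, pi] &, {mono @cos R : x y /~ y <= x}}.
Proof. by move=> x y hx hy; rewrite !leNgt ltr_cos. Qed.

(** * The Legendre series of the azimuthal coefficient *)

Section Expansion.
Variable R : realType.
Implicit Types (a b : R) (n l N : nat) (m : int).

Lemma legendre_termC m a0 b0 a b : legendre_term m a0 b0 a b = legendre_term (R := R) m b0 a0 a b.
Proof. by apply/funext => l; rewrite /legendre_term minC maxC. Qed.

Lemma cos_sepC a0 b0 a b : cos_sep a0 b0 a b = cos_sep (R := R) b0 a0 a b.
Proof. by apply/funext => psi; rewrite /cos_sep /coefA /coefB; ring. Qed.

Let kernel n a b l : R := int0pi (fun psi =>
  (legendre R l).[cos a * cos b + sin a * sin b * cos psi] * cos (n%:R * psi)).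

Lemma kernelE n a b l : kernel n a b l =
  pi * ((l - n)`!%:R / (l + n)`!%:R * (sin a * sin b) ^+ n *
        dlegendre l n (cos a) * dlegendre l n (cos b)).
Proof. by rewrite /kernel legendre_addition // exprMn !sin2cos2. Qed.

Lemma kernel_gt n a b l : (l < n)%N -> kernel n a b l = 0.
Proof. by move=> ln; rewrite kernelE dlegendre_gt // mulr0 mul0r mulr0. Qed.

Lemma legendre_termE m (a0 b0 a b : R) l :
  0 < a0 < pi -> 0 < b0 < pi -> a0 <= b0 -> 0 <= sin a -> 0 <= sin b -> (`|m| <= l)%N ->
  legendre_term m a0 b0 a b l = 2 * Num.sqrt (sin a0 * sin b0) / pi ^+ 2 *
    (radial_coef l (tan_half a0) (tan_half b0) * kernel `|m| a b l).
Proof.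
move=> ha hb hab sa sb ml; rewrite /legendre_term min_l // max_r //.
have [s0 ca sna] := tan_halfP ha; have [r0 cb snb] := tan_halfP hb.
have := ferrersP_half_prod l s0 r0 ca cb.
have := ferrers_product sa sb ml.
rewrite kernelE.
move: (ferrersP (1 / 2) _ _) (ferrersP (1 / 2) _ _) => f1 f2.
set g1 := ferrersP _ _ _; set g2 := ferrersP _ _ _; set ph := factorial_ratio _ _ _.
set A := (_ / _ * _ * _ * _); move=> E1 E2.
have -> : (-1) ^+ l * (2 * l%:R + 1) * ph * g1 * g2 * f2 * f1 =
   ((-1) ^+ l * (2 * l%:R + 1) * f2 * f1) * (ph * g1 * g2) by ring.
rewrite E1 E2 sna snb.
have p1 : 0 < 1 + tan_half a0 ^+ 2 by rewrite ltr_wpDr ?sqr_ge0.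
have p2 : 0 < 1 + tan_half b0 ^+ 2 by rewrite ltr_wpDr ?sqr_ge0.
clear E1 E2. move: (radial_coef _ _ _) A p1 p2 => q A.
move: (tan_half a0) (tan_half b0) s0 r0 => s r s0 r0 p1 p2.
have -> : 2 * s / (1 + s ^+ 2) * (2 * r / (1 + r ^+ 2)) =
  2 ^+ 2 * (s / (1 + s ^+ 2) * (r / (1 + r ^+ 2))) by ring.
have u0 : 0 <= s / (1 + s ^+ 2) by rewrite divr_ge0 ?ltW.
rewrite (sqrtrM _ (sqr_ge0 2)) sqrtr_sqr ger0_norm // (sqrtrM _ u0).
have pi0 := pi_gt0 R; move: (Num.sqrt _) (Num.sqrt _) (pi) pi0 => u v p pp.
by field; rewrite gt_eqF.
Qed.

Lemma legendre_series_cvg m (a0 b0 a b : R) :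
  0 < a0 < pi -> 0 < b0 < pi -> a0 <= b0 -> a0 + b0 <= pi ->
  0 <= a <= pi -> 0 <= b <= pi -> nonsingular a0 b0 a b ->
  ~ [/\ m = 0, sin a = 0, sin b = 0 & a0 = b0 \/ a0 + b0 = pi] ->
  series (legendre_tail m a0 b0 a b) N @[N --> \oo] -->
  2 * Num.sqrt (sin a0 * sin b0) / pi ^+ 2 *
  int0pi (fun psi => cos_sep a0 b0 a b psi * cos (m%:~R * psi) /
            Num.sqrt (1 - cos_sep a0 b0 a b psi ^+ 2)).
Proof.
move=> ha hb hab hab' ha1 hb1 ns np.
have sa : 0 <= sin a by rewrite sin_ge0_pi.
have sb : 0 <= sin b by rewrite sin_ge0_pi.
have [s0 ca sna] := tan_halfP ha; have [r0 cb snb] := tan_halfP hb.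
have [e1 e2 e3 e4] := tan_half_compare s0 r0 ca cb.
set n := `|m|%N; set s := tan_half a0; set r := tan_half b0.
have [a00 a0p] := andP ha; have [b00 b0p] := andP hb.
have iA : a0 \in `[0, pi] by rewrite in_itv /= !ltW.
have iB : b0 \in `[0, pi] by rewrite in_itv /= !ltW.
have iA' : pi - a0 \in `[0, pi] by rewrite in_itv /= subr_ge0 gerBl !ltW.
have cpi : cos (pi - a0) = - cos a0 by rewrite addrC cosDpi cosN.
have h1 : s / r <= 1 by rewrite e1 ler_cos.
have k1 : s * r <= 1.
  by rewrite e3 addrC -[cos a0]opprK -cpi subr_ge0 ler_cos // lerBrDl.
pose X psi : R := cos a * cos b + sin a * sin b * cos psi.
pose T psi := (s / r + r / s - 2 * X psi) / (s * r + (s * r)^-1 + 2 * X psi).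
pose q := 2 * (s * r) / ((1 + s ^+ 2) * (1 + r ^+ 2)).
have q0 : 0 < q.
  by apply: divr_gt0; apply: mulr_gt0; [|exact: mulr_gt0|rewrite ltr_wpDr ?sqr_ge0..].
have HK psi : 1 - cos_sep a0 b0 a b psi = q * (s / r + r / s - 2 * X psi) /\
   1 + cos_sep a0 b0 a b psi = q * (s * r + (s * r)^-1 + 2 * X psi).
  by rewrite cos_sepE; exact: cos_sep_half.
have z0 : 0 \in `[0, pi : R] by rewrite in_itv /= lexx pi_ge0.
have zp : pi \in `[0, pi : R] by rewrite in_itv /= lexx pi_ge0.
(* Nonsingularity enters at psi = 0, where 1 - cos Theta is smallest, and for [Kp] at psi = pi,
   where 1 + cos Theta is smallest. *)
have Hp : 0 < s / r + r / s - 2 * (cos a * cos b + sin a * sin b).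
  rewrite -(pmulr_rgt0 _ q0); have [+ _] := HK 0; rewrite /X cos0 mulr1 => <-.
  by rewrite subr_gt0; have := ns _ z0; rewrite ltr_norml => /andP[].
have Kp : 0 < s * r + (s * r)^-1 + 2 * (cos a * cos b - sin a * sin b).
  rewrite -(pmulr_rgt0 _ q0); have [_ +] := HK pi; rewrite /X cospi mulrN1 => <-.
  by have := ns _ zp; rewrite ltr_norml => /andP[+ _]; lra.
have hp : n = 0%N -> sin a = 0 -> sin b = 0 -> s / r < 1 /\ s * r < 1.
  move=> /eqP; rewrite absz_eq0 => /eqP m0 sa0 sb0; split.
    rewrite e2 ltr_cos // lt_neqAle hab andbT; apply/eqP => E; apply: np; split => //; by left.
  rewrite e4 addrC -[cos a0]opprK -cpi subr_gt0 ltr_cos // ltrBrDl lt_neqAle hab' andbT.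
  by apply/eqP => E; apply: np; split => //; right.
have L := radial_series_cvg sa sb s0 r0 h1 k1 Hp Kp hp (X := X) (fun=> erefl) (T := T) (fun=> erefl).
rewrite (_ : int0pi _ = int0pi (fun psi => (1 - T psi) / (2 * Num.sqrt (T psi)) * cos (n%:R * psi))); last first.
  apply: eq_Rintegral => psi; rewrite inE /= => hpsi.
  rewrite mulrAC (@cot_sep R _ (T psi)) ?cos_absz //; first exact: ns.
  have [-> ->] := HK psi; rewrite /T; move: (_ - 2 * X psi) (_ + 2 * X psi) => H K.
  by rewrite -mulf_div divff ?gt_eqF // mul1r.
set c := 2 * _ / _.
(* The sum may start at l = 0, since the kernel vanishes for l < n. *)
rewrite (_ : series _ = fun N => c * \sum_(l < N + n) radial_coef l s r * kernel n a b l); last first.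
  apply/funext => N; rewrite /series /= mulr_sumr addnC big_split_ord /=.
  rewrite [X in _ = X + _]big1 ?add0r => [|i _]; last by rewrite kernel_gt // mulr0 mulr0.
  rewrite big_mkord; apply: eq_bigr => i _.
  by rewrite /legendre_tail legendre_termE // leq_addr.
apply: cvgMr.
rewrite (cvg_shiftn n (fun N => \sum_(l < N) radial_coef l s r * kernel n a b l)).
by rewrite -(cvg_shiftS (fun N => \sum_(l < N) radial_coef l s r * kernel n a b l)).
Qed.

End Expansion.

(* Where the right-hand side is meaningless:
   - theta or theta' in {0, pi}: it is a quotient by sqrt 0, and the Ferrers
     functions of half-odd order are undefined at 1 and -1;
   - theta + theta' > pi: the terms grow like
     (tan (theta / 2) * tan (theta' / 2)) ^ l and the series diverges (unless
     m != 0 and theta2 or theta2' is in {0, pi}, when both sides vanish);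
   - m = 0, theta2 and theta2' in {0, pi}, and theta = theta' or
     theta + theta' = pi: the terms do not tend to 0. *)
Theorem corollary4p1 (R : realType) (m : int)
    (theta theta' theta2 theta2' : R)
    (htheta : theta \in `]0, pi[) (htheta' : theta' \in `]0, pi[)
    (htheta2 : theta2 \in `[0, pi]) (htheta2' : theta2' \in `[0, pi])
    (hsum : theta + theta' <= pi)
    (hnonsing : nonsingular theta theta' theta2 theta2')
    (hpoles : ~ [/\ m = 0, sin theta2 = 0, sin theta2' = 0
                  & theta = theta' \/ theta + theta' = pi]) :
  cvgn (series (legendre_tail m theta theta' theta2 theta2')) /\
  azimuthal_coef m theta theta' theta2 theta2' =
    pi * neumann_factor R m / (2 * Num.sqrt (sin theta * sin theta')) *
    limn (series (legendre_tail m theta theta' theta2 theta2')).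
Proof.
move: htheta htheta' htheta2 htheta2'; rewrite !in_itv /= => h1 h2 h3 h4.
have H : series (legendre_tail m theta theta' theta2 theta2') N @[N --> \oo] -->
    2 * Num.sqrt (sin theta * sin theta') / pi ^+ 2 *
    int0pi (fun psi => cos_sep theta theta' theta2 theta2' psi * cos (m%:~R * psi) /
       Num.sqrt (1 - cos_sep theta theta' theta2 theta2' psi ^+ 2)).
  have [le|/ltW le] := leP theta theta'; first exact: legendre_series_cvg.
  rewrite /legendre_tail legendre_termC cos_sepC [sin theta * _]mulrC.
  apply: legendre_series_cvg => //; first by rewrite addrC.
    by move=> psi hpsi; rewrite cos_sepC; exact: hnonsing.
  case=> m0 s1 s2 h; apply: hpoles; split => //.
  by rewrite addrC; case: h; [left|right].
split; first by apply/cvg_ex; eexists; exact: H.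
rewrite (cvg_lim _ H) // /azimuthal_coef -/(int0pi _).
have s1 : 0 < sin theta by exact: sin_gt0_pi.
have s2 : 0 < sin theta' by exact: sin_gt0_pi.
have : 0 < Num.sqrt (sin theta * sin theta') by rewrite sqrtr_gt0 mulr_gt0.
have := pi_gt0 R.
move: (int0pi _) (Num.sqrt _) (pi) => I q p p0 q0.
by field; rewrite !gt_eqF.
Qed.
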